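(* For a real number $p$ and a positive integer $N$, let $K_{p,N}$ be the best (smallest) constant such that $$\Big\|\sum_{|n|\le N}a_n e^{2\pi i(xn+tn^3)}\Big\|_{L^p_{x,t}(\mathbb{T}^2)}\le K_{p,N}\Big(\sum_{|n|\le N}|a_n|^2\Big)^{1/2}$$ holds for all complex numbers $a_n$, $|n|\le N$. Suppose $p\ge 12$. Then for every $\varepsilon>0$ there is a constant $C>0$ (depending on $p$ and $\varepsilon$), independent of $N$, such that $$K_{p,N}\le C\,N^{\frac12\left(1-\frac{8}{p}\right)+\varepsilon}.$$ If moreover $p>24$, one may take $\varepsilon=0$, i.e. there is a constant $C>0$ (depending on $p$), independent of $N$, such that $K_{p,N}\le C\,N^{\frac12\left(1-\frac8p\right)}$.
   Context: $\mathbb{T}^2=(\mathbb{R}/\mathbb{Z})^2$, identified with $[0,1]^2$ with Lebesgue measure; the norm is taken in the variables $(x,t)$. Sums over $|n|\le N$ run over integers $n$ with $-N\le n\le N$. *)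

(* Defs.v *)
From mathcomp Require Import all_boot all_order all_algebra.
From mathcomp Require Import complex.
From mathcomp Require Import all_classical all_reals all_analysis.

Set Implicit Arguments.
Unset Strict Implicit.
Unset Printing Implicit Defensive.

Import Order.TTheory GRing.Theory Num.Theory.
Import numFieldNormedType.Exports.

Local Open Scope classical_set_scope.
Local Open Scope ring_scope.

Section Torus.
Variable R : realType.

Definition unit_square : set (R * R) := `[0, 1] `*` `[0, 1].

Lemma measurable_unit_square :
  measurable (unit_square : set (measurableTypeR R * measurableTypeR R)).
Proof. by apply: measurableX; exact: measurable_itv. Qed.

(* Normalized Haar measure on (R/Z)^2: the two sides of each identified pair of
   edges are both kept, which is harmless as edges are Lebesgue-null. *)
Definition torus_measure :
    {measure set (measurableTypeR R * measurableTypeR R) -> \bar R} :=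
  mrestr (@lebesgue_measure R \x @lebesgue_measure R)%E measurable_unit_square.

End Torus.

Section CubicExponentialSums.
Variable R : realType.

Definition cmod (z : R[i]) : R := ComplexField.Normc.normc z.

Lemma cmodE (z : R[i]) : (cmod z)%:C%C = `|z|.
Proof. by []. Qed.

(* e(u) = exp(2 pi i u) *)
Definition e (u : R) : R[i] :=
  (cos (2 * pi * u) +i* sin (2 * pi * u))%C.

Definition freqs (N : nat) : seq int := [seq k%:Z - N%:Z | k <- iota 0 N.*2.+1].

Lemma freqs_uniq N : uniq (freqs N).
Proof. by rewrite map_inj_uniq ?iota_uniq// => i j /addIr[]. Qed.

Lemma mem_freqs N (n : int) : (n \in freqs N) = (`|n| <= N%:Z).
Proof.
rewrite ler_norml; apply/mapP/andP => [[k]|[Nn nN]].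
  rewrite mem_iota add0n ltnS /= => kN ->.
  rewrite lerBrDr addrC subrr lerBlDr -PoszD addnn.
  by split=> //; rewrite lez_nat.
have : 0 <= n + N%:Z by rewrite -lerBlDr sub0r.
case E : (n + N%:Z) => [k|//] _.
exists k; last by rewrite -E addrK.
by rewrite mem_iota /= add0n ltnS -lez_nat -E -addnn PoszD lerD2r.
Qed.

Definition cubic_sum (N : nat) (a : int -> R[i]) (z : R * R) : R[i] :=
  \sum_(n <- freqs N) a n * e (z.1 * n%:~R + z.2 * n%:~R ^+ 3).

Definition l2norm (N : nat) (a : int -> R[i]) : R :=
  Num.sqrt (\sum_(n <- freqs N) cmod (a n) ^+ 2).

Definition cubic_Lp_norm (p : R) (N : nat) (a : int -> R[i]) : \bar R :=
  Lnorm (torus_measure R) p%:E (fun z => (cmod (cubic_sum N a z))%:E).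

(* The infimum is taken in \bar R, so that it would be +oo, not a junk real,
   were no constant admissible. *)
Definition best_constant (p : R) (N : nat) : \bar R :=
  ereal_inf [set K%:E | K in [set K : R |
    forall a : int -> R[i], (cubic_Lp_norm p N a <= (K * l2norm N a)%:E)%E]].

End CubicExponentialSums.

(* Main.v *)
Require Import Defs.
From mathcomp Require Import all_boot all_order all_algebra.
From mathcomp Require Import complex zify ring lra.
From mathcomp Require Import all_classical all_reals all_analysis.
From mathcomp Require Import measurable_realfun.
Import Order.TTheory GRing.Theory Num.Theory.
Import numFieldNormedType.Exports.

(** Let [f] be the cubic exponential sum with coefficients [a_n] and let [sigma]
    be the sum of the [|a_n| ^ 2]. In terms of integrals, the claim is that [|f|
    ^ p] has integral [O (N ^ (p / 2 - 4 + eps) sigma ^ (p / 2))]. All estimates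
    are made for averages over a finite grid [(Z / Q) ^ 2], where orthogonality
    of characters is a finite geometric sum. When [Q >= 48 N ^ 4], the values of
    [|f|] at a point and at the corner of its grid cell differ by at most [sqrt
    sigma], so that averages over the grid control integrals
    ([integral_cubic_le_grid]).

    For [p >= 12] the main point is the tenth moment ([tenth_moment]): the
    average of [|f| ^ 10] is [O (N ^ (1 + eps) sigma ^ 5)]. The bound [|f| ^ 2
    <= 3 N sigma] takes care of the powers above the tenth. For the tenth
    moment, write [|f| ^ 2] as the sum of the [T_h], where [T_h] collects the
    products of two terms whose frequencies differ by [h]; by Cauchy-Schwarz,
    [|f| ^ 10 <= (4 N + 1) \sum_h |f ^ 3 T_h| ^ 2]. If the coefficients are of
    size about 1 on a set of [M] frequencies and vanish elsewhere, Parseval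
    turns the right-hand side into the number of solutions of a system in ten
    unknowns of this set: besides the balance of sums and of sums of cubes, two
    pairs of unknowns have the same difference [h]. This extra equation lets the
    cubic one factor as [3 h u v = L], where [h], [u] and [v] determine the
    unknowns of these pairs and [L] depends on the six others. The divisor bound
    leaves [O (N ^ eps M ^ 5)] solutions when [L] is nonzero; when [L = 0] there
    are more choices of [h], [u] and [v], but then the six others solve the
    corresponding system in six unknowns, which is rare ([card_tenfold]). A
    dyadic decomposition of the coefficients reduces the general case to this
    one, with a logarithmic loss.

    The loss disappears for [p > 24] through the twenty-fourth moment. The
    Fourier coefficients of [f ^ 12] are sums over the representations of a
    frequency, and Cauchy-Schwarz bounds the average of [|f| ^ 24] by [sigma ^
    12] times that of [|D| ^ 12], where [D] is the kernel with all coefficients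
    1 ([twentyfourth_moment]). It remains to show that the average of [|D| ^ 12]
    is [O (N ^ 8)] ([twelfth_moment]). Two Weyl differencings bound [|D| ^ 4] by
    a sum of geometric sums ([kernel_fourth]). If the approximation [a / q] of
    [t] given by Dirichlet's theorem has a large [q], this gives [|D| ^ 2 <= C N
    ^ (2 - 1 / 16)], and the saving pays for the [N ^ eps] in the tenth moment.
    Otherwise it gives, up to a term of the first kind, [|D| ^ 4 <= C N ^ 4 q ^
    (- 9 / 10) L ^ (- 1 / 2)] with [L = max (1, N ^ 3 |t - a / q|)]
    ([kernel_pointwise]); the power [5 / 2] of this bound is summable over the
    grid and over [a] and [q]. *)

Local Open Scope ring_scope.
Set Implicit Arguments.
Unset Strict Implicit.
Unset Printing Implicit Defensive.

(** * The additive character and distance to the integers *)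

Section Modulus.
Variable R : realType.
Implicit Types (z w : R[i]) (x y : R).

Lemma cmod_ge0 z : 0 <= cmod z.
Proof. by case: z => a b; exact: sqrtr_ge0. Qed.

Lemma cmod0 : cmod (0 : R[i]) = 0.
Proof. exact: ComplexField.Normc.normc0. Qed.

Lemma cmod1 : cmod (1 : R[i]) = 1.
Proof. exact: ComplexField.Normc.normc1. Qed.

Lemma cmodM z w : cmod (z * w) = cmod z * cmod w.
Proof. exact: ComplexField.Normc.normcM. Qed.

Lemma cmodX z n : cmod (z ^+ n) = cmod z ^+ n.
Proof. by elim: n => [|n IHn]; rewrite ?expr0 ?cmod1// !exprS cmodM IHn. Qed.

Lemma ler_cmodD z w : cmod (z + w) <= cmod z + cmod w.
Proof. exact: le_normcD. Qed.

Lemma cmodN z : cmod (- z) = cmod z.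
Proof. exact: normcN. Qed.

Lemma cmodC x : cmod x%:C%C = `|x|.
Proof. by rewrite /cmod /= expr0n addr0 sqrtr_sqr. Qed.

Lemma cmod_conj z : cmod (z^*)%C = cmod z.
Proof. by case: z => a b; rewrite /cmod /= sqrrN. Qed.

(* Versions of [rmorphM] and [rmorph_sum] that spare a call to [/=], which would
   unfold the conjugates of exponentials. *)
Lemma conjcM z w : ((z * w)^*)%C = (z^*)%C * (w^*)%C.
Proof. exact: rmorphM. Qed.

Lemma conjc_sum (I : Type) (r : seq I) (P : pred I) (F : I -> R[i]) :
  ((\sum_(i <- r | P i) F i)^*)%C = \sum_(i <- r | P i) ((F i)^*)%C.
Proof. exact: rmorph_sum. Qed.

Lemma cmod_sqr z : (cmod z ^+ 2)%:C%C = z * (z^*)%C.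
Proof.
case: z => a b; rewrite /cmod /= sqr_sqrtr ?addr_ge0 ?sqr_ge0//.
by apply/eqP; rewrite eq_complex /=; apply/andP; split; apply/eqP; ring.
Qed.

Lemma ler_cmod_sum (I : Type) (r : seq I) (P : pred I) (F : I -> R[i]) :
  cmod (\sum_(i <- r | P i) F i) <= \sum_(i <- r | P i) cmod (F i).
Proof.
elim/big_rec2: _ => [|i y z _ IH]; first by rewrite cmod0.
by rewrite (le_trans (ler_cmodD _ _))// lerD2l.
Qed.

Lemma ler_cmodB z w : cmod z <= cmod w + cmod (z - w).
Proof. by rewrite -{1}(subrK w z) addrC ler_cmodD. Qed.

Lemma eD x y : e (x + y) = e x * e y.
Proof.
rewrite /e mulrDr cosD sinD; apply/eqP; rewrite eq_complex /=.
by apply/andP; split; apply/eqP; ring.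
Qed.

Lemma e0 : e (0 : R) = 1.
Proof. by rewrite /e mulr0 cos0 sin0. Qed.

Lemma eN x : e (- x) = ((e x)^*)%C.
Proof. by rewrite /e mulrN cosN sinN. Qed.

Lemma cmod_e x : cmod (e x) = 1.
Proof. by rewrite /e /cmod /= cos2Dsin2 sqrtr1. Qed.

Lemma e1 : e (1 : R) = 1.
Proof. by rewrite /e mulr1 mulr_natl cos2pi sin2pi. Qed.

Lemma e_nat n : e (n%:R : R) = 1.
Proof. by elim: n => [|n IH]; rewrite ?e0// -natr1 eD IH e1 mulr1. Qed.

Lemma e_int (n : int) : e (n%:~R : R) = 1.
Proof. by case: n => n; rewrite ?NegzE ?rmorphN/= ?eN e_nat ?conjc1. Qed.

Lemma eDint x (n : int) : e (x + n%:~R) = e x.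
Proof. by rewrite eD e_int mulr1. Qed.

Lemma eMn x n : e (x *+ n) = e x ^+ n.
Proof. by elim: n => [|n IH]; rewrite ?e0// mulrS exprS eD IH. Qed.

(** [chord x], the chord from [1] to [e x], is used throughout as the distance
    from [x] to the nearest integer: it is subadditive, even and 1-periodic. *)
Definition chord x : R := cmod (1 - e x).

Lemma chord_ge0 x : 0 <= chord x. Proof. exact: cmod_ge0. Qed.

Lemma chordN x : chord (- x) = chord x.
Proof. by rewrite /chord eN -[in RHS]cmod_conj rmorphB rmorph1. Qed.

Lemma chordDint x (n : int) : chord (x + n%:~R) = chord x.
Proof. by rewrite /chord eDint. Qed.

Lemma cmod_eB x y : cmod (e x - e y) = chord (y - x).
Proof.
rewrite /chord; have -> : e x - e y = e x * (1 - e (y - x)).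
  by rewrite mulrBr mulr1 -eD subrKC.
by rewrite cmodM cmod_e mul1r.
Qed.

Lemma chordD x y : chord (x + y) <= chord x + chord y.
Proof.
have -> : chord (x + y) = cmod ((1 - e x) + (e x - e (x + y))).
  by rewrite /chord; congr cmod; ring.
by rewrite (le_trans (ler_cmodD _ _))// cmod_eB addrAC subrr add0r.
Qed.

Lemma chord_sqr x : chord x ^+ 2 = 2 - cos (2 * pi * x) *+ 2.
Proof.
apply: complexI; rewrite cmod_sqr /chord /e.
rewrite -[X in _ = real_complex R (X - _)]/(1 *+ 2).
rewrite -(cos2Dsin2 (2 * pi * x)).
apply/eqP; rewrite eq_complex /=.
move: (cos2Dsin2 (2 * pi * x)) => H.
apply/andP; split; apply/eqP; last by ring.
rewrite H; move: H.
set c := cos _; set s := sin _ => H.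
have -> : (1 - c) * (1 - c) - (0 - s) * - (0 - s) = 1 - c *+ 2 + (c ^+ 2 + s ^+ 2) by ring.
by rewrite H; ring.
Qed.

Lemma chordE x : chord x = 2 * `|sin (pi * x)|.
Proof.
apply: (@pexpIrn _ 2) => //; rewrite ?nnegrE ?mulr_ge0 ?chord_ge0//.
rewrite chord_sqr -mulrA mulr_natl cos_mulr2n exprMn real_normK ?num_real//.
by rewrite sin2cos2; ring.
Qed.

Lemma sin_mvt x : 0 <= x -> exists2 c, 0 <= c <= x & sin x = cos c * x.
Proof.
move=> x0; have [|c] := @MVT_segment R sin cos 0 x x0 (fun t _ => is_derive_sin t).
  by apply: continuous_subspaceT => t; exact: continuous_sin.
by rewrite in_itv /= sin0 !subr0 => cx ->; exists c.
Qed.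

Lemma pi_ge2 : 2 <= pi :> R.
Proof.
have [/andP[h0 h2] hc] := pihalf_02_cos_pihalf R.
have [p [/andP[p1 p2] pc]] : exists p : R, (1 <= p <= 2) /\ cos p = 0.
  by have [p ? ?] := cos_exists R; exists p.
have : pi / 2 = p by apply: cos_02_uniq => //; rewrite ?h0 ?h2 ?(le_trans ler01 p1).
lra.
Qed.

Lemma pi_le4 : pi <= 4 :> R.
Proof.
have [/andP[_ h2] _] := pihalf_02_cos_pihalf R.
lra.
Qed.

Lemma chord_le x : chord x <= 8 * `|x|.
Proof.
wlog x0 : x / 0 <= x.
  by move=> H; case: (leP 0 x) => [/H//|/ltW x0]; rewrite -chordN -normrN H ?oppr_ge0.
rewrite chordE (ger0_norm x0).
have px0 : 0 <= pi * x by rewrite mulr_ge0 ?pi_ge0.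
have [c _ ->] := sin_mvt px0.
rewrite normrM (ger0_norm px0).
have c1 := cos_max c.
have := ler_wpM2r px0 c1.
have := ler_wpM2r x0 pi_le4.
lra.
Qed.

(** A weak form of Jordan's inequality: [sin y = 2 sin (y/2) cos (y/2)] and the
    mean value theorem give two cosines of arguments in [0, pi/4], each at least
    [1 / sqrt 2]. *)
Lemma sin_ge_half y : 0 <= y <= pi / 2 -> y / 2 <= sin y.
Proof.
move=> /andP[y0 yp].
have c4 : cos (pi / 4 : R) ^+ 2 = 2^-1.
  have := cos_mulr2n (pi / 4 : R).
  rewrite (_ : pi / 4 *+ 2 = pi / 2); last by rewrite -mulr_natr; field.
  by rewrite cos_pihalf; lra.
have p2 := pi_ge2.
have p4 : 0 <= (pi : R) / 4 <= (pi : R) / 2 by apply/andP; split; lra.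
have c4_0 : 0 <= cos (pi / 4 : R) by apply: cos_ge0_pihalf; apply/andP; split; lra.
have cge (c : R) : 0 <= c <= pi / 4 -> cos (pi / 4) <= cos c.
  move=> /andP[c0 cp]; rewrite leNgt ltr_cos ?in_itv /= ?c0//.
  - by rewrite -leNgt.
  - lra.
  - lra.
have y2 : 0 <= y / 2 by lra.
have [c /andP[c0 cy] sE] := sin_mvt y2.
have sD : sin y = cos (y / 2) * sin (y / 2) *+ 2.
  by rewrite -sin_mulr2n; congr sin; field.
rewrite sD sE.
have C1 : cos (pi / 4) <= cos c by apply: cge; rewrite c0; lra.
have C2 : cos (pi / 4) <= cos (y / 2) by apply: cge; lra.
have : cos (pi / 4) ^+ 2 <= cos (y / 2) * cos c by rewrite expr2 ler_pM.
rewrite c4 => /(ler_wpM2r y2); lra.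
Qed.

Lemma chord_ge x : `|x| <= 2^-1 -> 2 * `|x| <= chord x.
Proof.
wlog x0 : x / 0 <= x.
  by move=> H; case: (leP 0 x) => [/H//|/ltW x0]; rewrite -chordN -normrN => /H-> //; rewrite oppr_ge0.
rewrite chordE (ger0_norm x0) => x2.
have p2 := pi_ge2.
have px : 0 <= pi * x <= pi / 2.
  by rewrite mulr_ge0 ?ler_wpM2l//; lra.
have := sin_ge_half px; have := ler_wpM2r x0 p2; have := ler_norm (sin (pi * x)).
lra.
Qed.

End Modulus.

(** * Orthogonality on a grid *)

Section Orthogonality.
Variable R : realType.

(** The relation [r] stands for the congruence of frequencies modulo the grid:
    of pairs of frequencies for sums over the grid, of first frequencies for
    sums over one row. *)
Lemma parseval_le (G T : finType) (c : T -> R[i]) (X : T -> G -> R[i])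
    (K : R) (r : rel T) :
  0 <= K ->
  (forall s t, \sum_g X s g * ((X t g)^*)%C = if r s t then K%:C%C else 0) ->
  \sum_g cmod (\sum_s c s * X s g) ^+ 2 <=
    K * \sum_s \sum_(t | r s t) cmod (c s) * cmod (c t).
Proof.
move=> K0 HX.
have E : (\sum_g cmod (\sum_s c s * X s g) ^+ 2)%:C%C =
    \sum_s \sum_(t | r s t) c s * ((c t)^*)%C * K%:C%C.
  rewrite rmorph_sum /=.
  under eq_bigr do rewrite cmod_sqr conjc_sum mulr_suml.
  rewrite exchange_big /=; apply: eq_bigr => s _.
  under eq_bigr do rewrite mulr_sumr.
  rewrite exchange_big /= [RHS]big_mkcond /=; apply: eq_bigr => t _.
  under eq_bigr do rewrite conjcM mulrACA.
  rewrite -mulr_sumr HX; case: ifP => // _; exact: mulr0.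
have L0 : 0 <= \sum_g cmod (\sum_s c s * X s g) ^+ 2.
  by apply: sumr_ge0 => g _; exact: sqr_ge0.
rewrite -[leLHS]ger0_norm// -cmodC E (le_trans (ler_cmod_sum _ _ _))//.
rewrite mulr_sumr ler_sum// => s _.
rewrite (le_trans (ler_cmod_sum _ _ _))// mulr_sumr ler_sum// => t _.
by rewrite !cmodM cmod_conj cmodC (ger0_norm K0) mulrC.
Qed.

Lemma sum_e_grid (Q : nat) (u : int) : (0 < Q)%N ->
  \sum_(j < Q) e (u%:~R * j%:R / Q%:R : R) = if (Q%:Z %| u)%Z then Q%:R else 0.
Proof.
move=> Q0; have Qn : Q%:R != 0 :> R by rewrite pnatr_eq0 -lt0n.
have E (j : 'I_Q) : e (u%:~R * j%:R / Q%:R : R) = e (u%:~R / Q%:R : R) ^+ j.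
  by rewrite -eMn mulrAC mulr_natr.
under eq_bigr do rewrite E.
have zQ : e (u%:~R / Q%:R : R) ^+ Q = 1.
  by rewrite -eMn -(mulr_natr (_ / _)) divfK// e_int.
case: ifPn => [/dvdzP[m ->]|ndv].
  rewrite rmorphM /= -pmulrn mulfK// e_int.
  by under eq_bigr do rewrite expr1n; rewrite sumr_const card_ord.
(* Otherwise the fractional part of [u / Q], which is not 0, would be at zero
   chord distance from the integers. *)
have z1 : e (u%:~R / Q%:R : R) != 1.
  set x : R := u%:~R / Q%:R.
  have xE : u%:~R = x * Q%:R by rewrite /x divfK.
  have [f0 f1] : 0 <= x - (Num.floor x)%:~R /\ x - (Num.floor x)%:~R < 1.
    by have /andP[] := floor_itv x; rewrite intrD; lra.
  rewrite -(subrK (Num.floor x)%:~R x) eDint.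
  set y := x - _ in f0 f1 *.
  have y0 : y != 0.
    apply: contra ndv; rewrite /y subr_eq0 => /eqP xF.
    apply/dvdzP; exists (Num.floor x); apply: (@intr_inj R).
    by rewrite xE rmorphM /= -pmulrn -xF.
  apply/eqP => ey1; have : chord y = 0 by rewrite /chord ey1 subrr cmod0.
  case: (leP y 2^-1) => [y2|y2].
    have := @chord_ge R y; rewrite ger0_norm// => /(_ y2) H E0.
    by move: y0; rewrite neq_lt; lra.
  have -> : chord y = chord (y - 1) by rewrite -(chordDint y (-1)) rmorphN.
  have := @chord_ge R (y - 1); rewrite ler0_norm; last lra.
  by move=> H ?; have := H ltac:(lra); lra.
apply/eqP; rewrite -(inj_eq (mulfI (_ : e (u%:~R / Q%:R) - 1 != 0))) ?subr_eq0//.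
by rewrite -subrX1 zQ subrr mulr0.
Qed.

Definition chi (Q : nat) (u : int * int) (g : 'I_Q * 'I_Q) : R[i] :=
  e ((u.1%:~R * g.1%:R + u.2%:~R * g.2%:R) / Q%:R).

Arguments chi {Q} u g : simpl never.

Lemma cmod_chi Q u g : cmod (@chi Q u g) = 1. Proof. exact: cmod_e. Qed.

Lemma chiD Q (u v : int * int) g : @chi Q (u + v) g = chi u g * chi v g.
Proof. by rewrite /chi -eD /= !intrD; congr e; ring. Qed.

Lemma chiN Q (u : int * int) g : @chi Q (- u) g = ((chi u g)^*)%C.
Proof. by rewrite /chi -eN /= !rmorphN /=; congr e; ring. Qed.

Lemma chi0 Q g : @chi Q 0 g = 1.
Proof. by rewrite /chi /= !mul0r addr0 mul0r e0. Qed.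

Lemma sum_chi Q (u : int * int) : (0 < Q)%N ->
  \sum_g @chi Q u g = if (Q %| u.1)%Z && (Q %| u.2)%Z then Q%:R ^+ 2 else 0.
Proof.
move=> Q0; transitivity (\sum_(j < Q) \sum_(k < Q)
    e (u.1%:~R * j%:R / Q%:R : R) * e (u.2%:~R * k%:R / Q%:R : R)).
  by rewrite pair_bigA; apply: eq_bigr => -[j k] _; rewrite /chi -eD mulrDl.
under eq_bigr do rewrite -mulr_sumr.
rewrite -mulr_suml !sum_e_grid//.
by do 2!case: ifP => _ //=; rewrite ?mul0r ?mulr0 ?expr2.
Qed.

Lemma chi_orthogonal Q (u v : int * int) : (0 < Q)%N ->
  \sum_g @chi Q u g * ((chi v g)^*)%C =
    if (Q %| u.1 - v.1)%Z && (Q %| u.2 - v.2)%Z then (Q%:R ^+ 2 : R)%:C%C else 0.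
Proof.
move=> Q0; under eq_bigr do rewrite -chiN -chiD.
by rewrite sum_chi// rmorphXn /= rmorph_nat.
Qed.

End Orthogonality.

Arguments chi R {Q} u g : simpl never.

(** * The divisor bound *)

Section DivisorBound.
Local Open Scope nat_scope.

Lemma bin_le_exp n m : 'C(n, m) <= 2 ^ n.
Proof.
elim: n m => [|n IH] [|m]; rewrite ?bin0 ?expn_gt0// binS expnS mul2n -addnn.
exact: leq_add.
Qed.

Lemma exp_le_ffact a k : a.+1 ^ k <= (a + k) ^_ k.
Proof.
elim: k => [|k IH]; first by rewrite expn0 ffactn0.
by rewrite addnS ffactSS expnS leq_mul// ltnS leq_addr.
Qed.

(** This handles the small primes, for which [p ^ a] only dominates the powers of
    [a + 1] up to a constant. *)
Lemma exp_le_pow2 k a : a.+1 ^ k <= k`! * 2 ^ k * 2 ^ a.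
Proof.
rewrite (leq_trans (exp_le_ffact a k))// -bin_ffact mulnC -mulnA leq_mul2l.
by rewrite -expnD addnC bin_le_exp orbT.
Qed.

Lemma size_add_divisors f s : size (prime.PrimeDecompAux.add_divisors f s) = f.2.+1 * size s.
Proof.
case: f => p a /=; elim: a => [|a IH] /=; first by rewrite mul1n.
by rewrite size_merge size_cat size_map IH addnC -mulSn.
Qed.

(** Write [n] as a product of prime powers [p ^ a], so that its number of
    divisors is the product of the [a + 1]. A factor [(a + 1) ^ k] is at most
    [p ^ a] as soon as [p >= 2 ^ k], and at most a constant times [p ^ a]
    for each of the boundedly many smaller [p]. *)
Lemma divisors_bound k :
  exists C, forall n, 0 < n -> size (divisors n) ^ k <= C * n.
Proof.
set B := k`! * 2 ^ k.
have B0 : 0 < B by rewrite muln_gt0 fact_gt0 expn_gt0.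
exists (B ^ 2 ^ k) => n n0.
set s := prime_decomp n.
have sp : all (leq 2) (unzip1 s).
  by apply/allP => p; rewrite -/(primes n) mem_primes => /andP[/prime_gt1].
have H : size (foldr prime.PrimeDecompAux.add_divisors [:: 1] s) ^ k <=
    B ^ count (fun p => p < 2 ^ k) (unzip1 s) * \prod_(f <- s) f.1 ^ f.2.
  elim: s sp => [|[p a] s IH]; first by rewrite /= exp1n big_nil.
  move=> /andP[p2 /IH {}IH]; simpl in p2.
  have -> t : foldr prime.PrimeDecompAux.add_divisors t ((p, a) :: s) =
    prime.PrimeDecompAux.add_divisors (p, a)
      (foldr prime.PrimeDecompAux.add_divisors t s) by [].
  rewrite size_add_divisors big_cons expnMn /=.
  have exp2r m x y : x <= y -> x ^ m <= y ^ m.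
    by case: m => // m; rewrite leq_exp2r.
  rewrite expnD mulnACA leq_mul//; case: ltnP => pk.
    by rewrite expn1 (leq_trans (exp_le_pow2 k a))// leq_mul2l exp2r ?orbT.
  rewrite mul1n (leq_trans (n := (2 ^ a) ^ k))//; first by rewrite exp2r// ltn_expl.
  by rewrite -expnM mulnC expnM exp2r.
rewrite /divisors (leq_trans H)// /s -(prod_prime_decomp n0).
rewrite leq_mul// leq_pexp2l// -size_filter.
rewrite -[leqRHS](size_iota 0) uniq_leq_size ?filter_uniq ?primes_uniq//.
by move=> p; rewrite mem_filter mem_iota => /andP[].
Qed.

End DivisorBound.

(** * Counting solutions of the Diophantine systems *)

Section Counting.

Lemma card_set_pair (S T : finType) (P : S -> T -> bool) :
  #|[set p : S * T | P p.1 p.2]| = (\sum_s #|[set t | P s t]|)%N.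
Proof.
rewrite -sum1_card (eq_bigl (fun p => true && P p.1 p.2)); last first.
  by move=> p; rewrite inE.
rewrite -(pair_big_dep xpredT P (fun _ _ => 1%N)).
by apply: eq_bigr => s _; rewrite -sum1_card; apply: eq_bigl => t; rewrite inE.
Qed.

Lemma leq_card_inj (S T : finType) (A : {set S}) (B : {set T}) (f : S -> T) :
  {in A &, injective f} -> {in A, forall x, f x \in B} -> (#|A| <= #|B|)%N.
Proof.
move=> fi fB; rewrite -(card_in_imset fi); apply: subset_leq_card.
by apply/fintype.subsetP => _ /imsetP[x xA ->]; exact: fB.
Qed.

Lemma leq_card_cover3 (T : finType) (S : {set T}) (P1 P2 P3 : pred T) k :
  {in S, forall x, [|| P1 x, P2 x | P3 x]} ->
  (#|[set x in S | P1 x]| <= k)%N -> (#|[set x in S | P2 x]| <= k)%N ->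
  (#|[set x in S | P3 x]| <= k)%N -> (#|S| <= 3 * k)%N.
Proof.
set S1 := [set x in S | P1 x]; set S2 := [set x in S | P2 x].
set S3 := [set x in S | P3 x] => HP k1 k2 k3.
have : (#|S| <= #|S1 :|: S2 :|: S3|)%N.
  apply: subset_leq_card; apply/fintype.subsetP => x xS.
  by rewrite !inE xS /= -orbA HP.
have := cardsU (S1 :|: S2) S3; have := cardsU S1 S2; lia.
Qed.

Variables (I : finType) (v : I -> int) (N D : nat).
Hypothesis v_inj : injective v.
Hypothesis v_le : forall i, `|v i| <= N%:Z.
Hypothesis D_ge : forall n, (0 < n <= 24 * N ^ 3)%N -> (size (divisors n) <= D)%N.

(** The factor [2 ^ 2] accounts for the signs of the two divisors. *)
Lemma card_divisor_pairs (T : finType) (S : {set T}) (f g : T -> int) (L : int) :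
  L != 0 -> (`|L| <= 24 * N ^ 3)%N ->
  {in S, forall t, (f t %| L)%Z && (g t %| L)%Z} ->
  {in S &, injective (fun t => (f t, g t))} ->
  (#|S| <= (2 * D) ^ 2)%N.
Proof.
move=> L0 LN fg inj.
pose s := map Posz (divisors `|L|) ++ map (fun n => - n%:Z) (divisors `|L|).
have sD : (size s <= 2 * D)%N.
  rewrite size_cat !size_map addnn -mul2n leq_mul2l /= D_ge// LN andbT.
  by rewrite absz_gt0.
have ins d : (d %| L)%Z -> d \in s.
  move=> dL; rewrite mem_cat.
  have : `|d|%N \in divisors `|L| by rewrite -dvdn_divisors ?absz_gt0.
  case: (intP d) => [|n|n] dd; apply/orP.
  - by left; apply/mapP; exists 0%N.
  - by left; apply/mapP; exists n.+1.
  - by right; apply/mapP; exists n.+1.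
rewrite cardE -(size_map (fun t => (f t, g t))).
rewrite (@leq_trans (size [seq (x, y) | x <- s, y <- s]))//; last first.
  by rewrite size_allpairs -mulnn leq_mul.
apply: uniq_leq_size.
  rewrite map_inj_in_uniq ?enum_uniq// => x y.
  by rewrite !mem_enum; exact: inj.
move=> _ /mapP[t tS ->]; rewrite mem_enum in tS.
by have /andP[ft gt] := fg t tS; apply/allpairsP; exists (f t, g t); rewrite /= !ins.
Qed.

Definition sum1 (x : I * I * I) : int := v x.1.1 + v x.1.2 + v x.2.
Definition sum3 (x : I * I * I) : int := v x.1.1 ^+ 3 + v x.1.2 ^+ 3 + v x.2 ^+ 3.

Definition cancelling (x : I * I * I) : bool :=
  [|| v x.1.1 + v x.1.2 == 0, v x.1.2 + v x.2 == 0 | v x.1.1 + v x.2 == 0].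

Variable A : {set I}.
Definition triples : {set I * I * I} :=
  [set x | [&& x.1.1 \in A, x.1.2 \in A & x.2 \in A]].

Lemma card_triples : #|triples| = (#|A| ^ 3)%N.
Proof.
have -> : triples = finset.setX (finset.setX A A) A by apply/setP => -[[a b] c]; rewrite !inE andbA.
by rewrite !cardsX; lia.
Qed.

(** Triples with a cancelling pair are those for which the factorization [sum13E]
    degenerates; they have only two degrees of freedom. *)
Lemma card_cancelling : (#|[set x in triples | cancelling x]| <= 3 * #|A| ^ 2)%N.
Proof.
have A2 : #|finset.setX A A| = (#|A| ^ 2)%N by rewrite cardsX mulnn.
rewrite -A2; apply: (leq_card_cover3 (P1 := fun x => v x.1.1 + v x.1.2 == 0)
  (P2 := fun x => v x.1.2 + v x.2 == 0) (P3 := fun x => v x.1.1 + v x.2 == 0)).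
- by move=> x; rewrite !inE => /andP[].
- apply: (@leq_card_inj _ _ _ _ (fun x => (x.1.1, x.2))).
    move=> [[a b] c] [[a' b'] c']; rewrite !inE /= => /andP[/andP[_ _] /eqP h] /andP[/andP[_ _] /eqP h'] [aa cc].
    have bb : b = b' by apply: v_inj; subst; lia.
    by subst.
  by move=> [[a b] c]; rewrite !inE /= => /andP[/andP[/and3P[-> _ ->]]].
- apply: (@leq_card_inj _ _ _ _ (fun x => (x.1.1, x.1.2))).
    move=> [[a b] c] [[a' b'] c']; rewrite !inE /= => /andP[/andP[_ _] /eqP h] /andP[/andP[_ _] /eqP h'] [aa bb].
    have cc : c = c' by apply: v_inj; subst; lia.
    by subst.
  by move=> [[a b] c]; rewrite !inE /= => /andP[/andP[/and3P[-> -> _]]].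
- apply: (@leq_card_inj _ _ _ _ (fun x => (x.1.1, x.1.2))).
    move=> [[a b] c] [[a' b'] c']; rewrite !inE /= => /andP[/andP[_ _] /eqP h] /andP[/andP[_ _] /eqP h'] [aa bb].
    have cc : c = c' by apply: v_inj; subst; lia.
    by subst.
  by move=> [[a b] c]; rewrite !inE /= => /andP[/andP[/and3P[-> -> _]]].
Qed.

Lemma sum13E x : sum1 x ^+ 3 - sum3 x =
  3 * (v x.1.1 + v x.1.2) * (v x.1.2 + v x.2) * (v x.1.1 + v x.2).
Proof. rewrite /sum1 /sum3; ring. Qed.

Lemma cancellingE x : cancelling x = (sum1 x ^+ 3 - sum3 x == 0).
Proof. by rewrite sum13E !mulf_eq0 /cancelling /= -orbA. Qed.

Lemma sum13_bound x : (`|sum1 x ^+ 3 - sum3 x| <= 24 * N ^ 3)%N.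
Proof.
rewrite -lez_nat abszE sum13E !normrM.
have H i j : `|v i + v j| <= 2 * N%:Z.
  by rewrite (le_trans (ler_normD _ _))// mulr_natl mulr2n lerD.
have -> : (24 * N ^ 3)%N%:Z = 3 * (2 * N%:Z) * (2 * N%:Z) * (2 * N%:Z).
  by rewrite PoszM !expnS expn0 muln1 !PoszM; ring.
by rewrite !ler_pM ?mulr_ge0.
Qed.

(** Let [s] be the prescribed sum and [c] the prescribed sum of cubes. Two of the
    factors of [s ^ 3 - c = 3 (x1 + x2) (x2 + x3) (x1 + x3)], together with [s],
    determine the points, and they are divisors of the left-hand side. When that
    side vanishes, some pair cancels, the remaining point is [s], and one free
    point is left. *)
Lemma card_same_sums y : y \in triples ->
  (#|[set x in triples | (sum1 x == sum1 y) && (sum3 x == sum3 y)]| <=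
    (2 * D) ^ 2 + (if cancelling y then 3 * #|A| else 0))%N.
Proof.
move=> yA; case: ifPn => cy; last first.
  rewrite addn0.
  apply: (@card_divisor_pairs _ _ (fun x => v x.1.1 + v x.1.2)
            (fun x => v x.1.2 + v x.2) (sum1 y ^+ 3 - sum3 y)).
  - by rewrite -cancellingE.
  - exact: sum13_bound.
  - move=> x; rewrite inE => /and3P[_ /eqP <- /eqP <-]; rewrite sum13E.
    apply/andP; split; apply/dvdzP.
      by exists (3 * (v x.1.2 + v x.2) * (v x.1.1 + v x.2)); ring.
    by exists (3 * (v x.1.1 + v x.1.2) * (v x.1.1 + v x.2)); ring.
  - move=> [[a b] c] [[a' b'] c']; rewrite !inE /= /sum1 /=.
    move=> /and3P[_ /eqP <- _] /and3P[_ /eqP h _] [h1 h2].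
    have aa : a = a' by apply: v_inj; lia.
    have bb : b = b' by apply: v_inj; lia.
    have cc : c = c' by apply: v_inj; lia.
    by subst.
rewrite (@leq_trans (3 * #|A|))// ?leq_addl//.
set S := [set x in _ | _].
apply: (leq_card_cover3 (P1 := fun x => v x.1.1 + v x.1.2 == 0)
  (P2 := fun x => v x.1.2 + v x.2 == 0) (P3 := fun x => v x.1.1 + v x.2 == 0)).
- move=> x; rewrite inE => /and3P[_ /eqP h1 /eqP h3].
  by rewrite -/(cancelling x) cancellingE h1 h3 -cancellingE.
- apply: (@leq_card_inj _ _ _ _ (fun x => x.1.1)); last first.
    by move=> [[a b] c]; rewrite !inE /= => /andP[/andP[/and3P[->]]].
  move=> [[a b] c] [[a' b'] c']; rewrite !inE /= /sum1 /=.
  move=> /andP[/and3P[_ /eqP h1 _] /eqP h] /andP[/and3P[_ /eqP h1' _] /eqP h'] aa.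
  have bb : b = b' by apply: v_inj; subst; lia.
  have cc : c = c' by apply: v_inj; lia.
  by subst.
- apply: (@leq_card_inj _ _ _ _ (fun x => x.1.2)); last first.
    by move=> [[a b] c]; rewrite !inE /= => /andP[/andP[/and3P[_ -> _]]].
  move=> [[a b] c] [[a' b'] c']; rewrite !inE /= /sum1 /=.
  move=> /andP[/and3P[_ /eqP h1 _] /eqP h] /andP[/and3P[_ /eqP h1' _] /eqP h'] bb.
  have cc : c = c' by apply: v_inj; subst; lia.
  have aa : a = a' by apply: v_inj; lia.
  by subst.
- apply: (@leq_card_inj _ _ _ _ (fun x => x.1.1)); last first.
    by move=> [[a b] c]; rewrite !inE /= => /andP[/andP[/and3P[->]]].
  move=> [[a b] c] [[a' b'] c']; rewrite !inE /= /sum1 /=.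
  move=> /andP[/and3P[_ /eqP h1 _] /eqP h] /andP[/and3P[_ /eqP h1' _] /eqP h'] aa.
  have cc : c = c' by apply: v_inj; subst; lia.
  have bb : b = b' by apply: v_inj; lia.
  by subst.
Qed.

(** Sum [card_same_sums] over [y]: the larger bound only occurs for the at most
    [3 #|A| ^ 2] cancelling triples. *)
Lemma card_sixth_moment :
  (#|[set p : (I * I * I) * (I * I * I) | [&& p.1 \in triples, p.2 \in triples,
      sum1 p.2 == sum1 p.1 & sum3 p.2 == sum3 p.1]]| <=
    #|A| ^ 3 * (4 * D ^ 2 + 9))%N.
Proof.
rewrite (@card_set_pair _ _ (fun y x => [&& y \in triples, x \in triples,
      sum1 x == sum1 y & sum3 x == sum3 y])) /=.
rewrite (bigID (fun y => y \in triples)) /= [X in (_ + X)%N]big1 ?addn0; last first.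
  by move=> y /negPf yA; apply/eqP; rewrite cards_eq0; apply/eqP/setP => x; rewrite !inE/= in yA *; rewrite yA.
apply: (@leq_trans (\sum_(y in triples)
    ((2 * D) ^ 2 + (if cancelling y then 3 * #|A| else 0)))%N).
  apply: leq_sum => y yA; rewrite (leq_trans _ (card_same_sums yA))//.
  by apply: subset_leq_card; apply/fintype.subsetP => x; rewrite !inE/= => /andP[_].
rewrite big_split /= sum_nat_const card_triples -big_mkcondr /= sum_nat_const.
have -> : #|[pred i in triples | cancelling i]| = #|[set x in triples | cancelling x]|.
  by apply: eq_card => x; rewrite !inE.
have := card_cancelling; nia.
Qed.

Definition gap (n : I * I) : int := v n.1 - v n.2.
Definition gap3 (n : I * I) : int := v n.1 ^+ 3 - v n.2 ^+ 3.

(** Cube differences over a common gap differ by a product of three linear forms,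
    which is what makes the divisor bound applicable. *)
Lemma gap3E (m n : I * I) : gap m = gap n ->
  gap3 n - gap3 m = 3 * gap m * (v n.2 - v m.2) * (v n.2 + v m.1).
Proof.
move=> h; have : v n.1 = gap m + v n.2 by rewrite h /gap subrK.
have : v m.1 = gap m + v m.2 by rewrite /gap subrK.
by rewrite /gap3 => -> ->; ring.
Qed.

Definition quads (L : int) : {set (I * I) * (I * I)} :=
  [set q | [&& q.1.1 \in A, q.1.2 \in A, q.2.1 \in A & q.2.2 \in A] &&
           ((gap q.1 == gap q.2) && (gap3 q.2 - gap3 q.1 == L))].

(** For [L] nonzero, the gap and [v n.2 - v m.2] are divisors of [L] that
    determine the third factor of [gap3E] and then all four points. For [L = 0]
    one of the three factors vanishes, and two free points remain. *)
Lemma card_quads (L : int) : (`|L| <= 24 * N ^ 3)%N ->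
  (#|quads L| <= if L == 0 then 3 * #|A| ^ 2 else (2 * D) ^ 2)%N.
Proof.
move=> LN; case: eqP => [->|/eqP L0]; last first.
  apply: (@card_divisor_pairs _ _ (fun q => gap q.1)
            (fun q => v q.2.2 - v q.1.2) L) => //.
    move=> [m n]; rewrite inE /= => /and3P[_ /eqP /gap3E -> /eqP <-].
    apply/andP; split; apply/dvdzP.
      by exists (3 * (v n.2 - v m.2) * (v n.2 + v m.1)); ring.
    by exists (3 * gap m * (v n.2 + v m.1)); ring.
  move=> [[a b] [c d]] [[a' b'] [c' d']]; rewrite !inE /=.
  move=> /andP[_ /andP[/eqP h /eqP hL]] /andP[_ /andP[/eqP h' /eqP hL']] [].
  rewrite /gap/= => e1 e2; rewrite (gap3E h) /gap/= in hL.
  rewrite (gap3E h') /gap/= -e1 -e2 in hL'; rewrite /gap/= in h h'.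
  have k0 : 3 * (v a - v b) * (v d - v b) != 0.
    by apply: contra_neq L0 => z; rewrite -hL z mul0r.
  have e3 : v d + v a = v d' + v a' by apply: (mulfI k0); rewrite hL hL'.
  have bb : b = b' by apply: v_inj; lia.
  have aa : a = a' by apply: v_inj; lia.
  have dd : d = d' by apply: v_inj; lia.
  have cc : c = c' by apply: v_inj; lia.
  by subst.
have A2 : #|finset.setX A A| = (#|A| ^ 2)%N by rewrite cardsX mulnn.
rewrite -A2; apply: (leq_card_cover3 (P1 := fun q => gap q.1 == 0)
  (P2 := fun q => v q.2.2 - v q.1.2 == 0) (P3 := fun q => v q.2.2 + v q.1.1 == 0)).
- move=> q; rewrite inE => /and3P[_ /eqP /gap3E ->].
  by rewrite !mulf_eq0 /= orbA.
- apply: (@leq_card_inj _ _ _ _ (fun q => (q.1.1, q.2.1))); last first.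
    by move=> q; rewrite !inE => /andP[/andP[/and4P[-> _ -> _]]].
  move=> [[a b] [c d]] [[a' b'] [c' d']]; rewrite !inE /gap /=.
  move=> /andP[/and3P[_ /eqP h _] /eqP h0] /andP[/and3P[_ /eqP h' _] /eqP h0'] [aa cc].
  have bb : b = b' by apply: v_inj; subst; lia.
  have dd : d = d' by apply: v_inj; subst; lia.
  by subst.
- apply: (@leq_card_inj _ _ _ _ (fun q => (q.1.1, q.1.2))); last first.
    by move=> q; rewrite !inE => /andP[/andP[/and4P[-> ->]]].
  move=> [[a b] [c d]] [[a' b'] [c' d']]; rewrite !inE /gap /=.
  move=> /andP[/and3P[_ /eqP h _] /eqP h0] /andP[/and3P[_ /eqP h' _] /eqP h0'] [aa bb].
  have dd : d = d' by apply: v_inj; subst; lia.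
  have cc : c = c' by apply: v_inj; subst; lia.
  by subst.
- apply: (@leq_card_inj _ _ _ _ (fun q => (q.1.1, q.1.2))); last first.
    by move=> q; rewrite !inE => /andP[/andP[/and4P[-> ->]]].
  move=> [[a b] [c d]] [[a' b'] [c' d']]; rewrite !inE /gap /=.
  move=> /andP[/and3P[_ /eqP h _] /eqP h0] /andP[/and3P[_ /eqP h' _] /eqP h0'] [aa bb].
  have dd : d = d' by apply: v_inj; subst; lia.
  have cc : c = c' by apply: v_inj; subst; lia.
  by subst.
Qed.

Lemma card_pairs_same_sum :
  (#|[set p : (I * I * I) * (I * I * I) | [&& p.1 \in triples, p.2 \in triples &
      sum1 p.2 == sum1 p.1]]| <= #|A| ^ 5)%N.
Proof.
have -> : (#|A| ^ 5)%N = #|finset.setX triples (finset.setX A A)|.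
  by rewrite !cardsX card_triples; lia.
apply: (@leq_card_inj _ _ _ _ (fun p => (p.1, p.2.1))); last first.
  move=> [x [[a b] c]]; rewrite finset.in_set => /and3P[xA].
  by rewrite !inE /= in xA *; rewrite xA => /and3P[-> -> _] _.
move=> [x [[a b] c]] [x' [[a' b'] c']]; rewrite !inE /sum1 /=.
move=> /and3P[_ _ /eqP h] /and3P[_ _ /eqP h'] [xx aa bb].
have cc : c = c' by apply: v_inj; subst; lia.
by subst.
Qed.

(** The system produced by the tenth moment: besides the equations for the sum
    and for the sum of cubes of ten unknowns, the equality of the two gaps, which
    Weyl differencing provides as a third equation. *)
Definition tenfold : pred ((I * I * I) * (I * I) * ((I * I * I) * (I * I))) :=
  fun p => [&& p.1.1 \in triples, p.2.1 \in triples,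
    [&& p.1.2.1 \in A, p.1.2.2 \in A, p.2.2.1 \in A & p.2.2.2 \in A] &
    [&& sum1 p.1.1 == sum1 p.2.1, gap p.1.2 == gap p.2.2 &
        sum3 p.1.1 + gap3 p.1.2 == sum3 p.2.1 + gap3 p.2.2]].

Lemma sum3_bound x : `|sum3 x| <= 3 * N%:Z ^+ 3.
Proof.
have H i : `|v i ^+ 3| <= N%:Z ^+ 3 by rewrite normrX lerXn2r ?nnegrE.
rewrite /sum3 (le_trans (ler_normD _ _))//.
rewrite (_ : 3 * N%:Z ^+ 3 = N%:Z ^+ 3 + N%:Z ^+ 3 + N%:Z ^+ 3); last by ring.
by rewrite lerD// (le_trans (ler_normD _ _))// lerD.
Qed.

(** Fixing the two triples, the remaining four points have a common gap [h] and
    satisfy [3 h u w = L] as in [gap3E]. If [L] is nonzero a divisor bound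
    applies; if [L = 0] the triples are a solution of the sixth moment system,
    which is rare enough to pay for the [3 #|A| ^ 2] choices of the gap. *)
Lemma card_tenfold : (0 < D)%N -> (#|[set p | tenfold p]| <= 43 * D ^ 2 * #|A| ^ 5)%N.
Proof.
move=> D0.
pose good (p : (I * I * I) * (I * I * I)) :=
  [&& p.1 \in triples, p.2 \in triples & sum1 p.2 == sum1 p.1].
pose Lof (p : (I * I * I) * (I * I * I)) := sum3 p.1 - sum3 p.2.
pose W := [set r : ((I * I * I) * (I * I * I)) * ((I * I) * (I * I)) |
             good r.1 && (r.2 \in quads (Lof r.1))].
apply: (@leq_trans #|W|).
  apply: (@leq_card_inj _ _ _ _ (fun p => ((p.1.1, p.2.1), (p.1.2, p.2.2)))).
    by move=> [[x m] [y n]] [[x' m'] [y' n']] _ _ [-> -> -> ->].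
  move=> [[x m] [y n]]; rewrite finset.in_set /tenfold /= => /and4P[xA yA mn /and3P[e1 e2 e3]].
  rewrite finset.in_set /good /= xA yA eq_sym e1 /= finset.in_set /= e2 mn /= /Lof /=.
  by apply/eqP; move/eqP: e3; lia.
rewrite /W (card_set_pair (fun p q => good p && (q \in quads (Lof p)))).
rewrite (bigID good) /= [X in (_ + X)%N]big1 ?addn0; last first.
  by move=> p /negPf gp; apply/eqP; rewrite cards_eq0; apply/eqP/setP => q; rewrite !inE gp.
apply: (@leq_trans (\sum_(p | good p) ((2 * D) ^ 2 + (if Lof p == 0 then 3 * #|A| ^ 2 else 0)))%N).
  apply: leq_sum => p gp.
  have -> : [set q | good p && (q \in quads (Lof p))] = quads (Lof p).
    by apply/setP => q; rewrite inE gp.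
  apply: (leq_trans (card_quads _)); last first.
    by case: (Lof p == 0); rewrite ?addn0 ?leq_addr ?leq_addl.
  rewrite -lez_nat abszE (le_trans (ler_normB _ _))//.
  apply: (le_trans (lerD (sum3_bound _) (sum3_bound _))).
  rewrite (_ : (24 * N ^ 3)%N%:Z = 24 * N%:Z ^+ 3); last by rewrite PoszM -!natz natrX.
  by rewrite -mulrDl ler_wpM2r// exprn_ge0.
rewrite big_split /= sum_nat_const -big_mkcondr /= sum_nat_const.
have h1 : (#|[pred p | good p]| <= #|A| ^ 5)%N.
  rewrite (leq_trans _ card_pairs_same_sum)//; apply: subset_leq_card.
  by apply/fintype.subsetP => p gp; rewrite finset.in_set.
have h2 : (#|[pred p | good p & Lof p == 0]| <= #|A| ^ 3 * (4 * D ^ 2 + 9))%N.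
  rewrite (leq_trans _ card_sixth_moment)//; apply: subset_leq_card.
  apply/fintype.subsetP => p; rewrite [p \in _]inE /= => /andP[/and3P[pA qA e1] e2].
  by rewrite finset.in_set; apply/and4P; split=> //; rewrite eq_sym -subr_eq0.
have D1 : (1 <= D ^ 2)%N by rewrite expn_gt0 D0.
have -> : ((2 * D) ^ 2 = 4 * D ^ 2)%N by lia.
move: h1 h2; rewrite (_ : #|A| ^ 5 = #|A| ^ 3 * #|A| ^ 2)%N; last by lia.
set m := #|[pred p | good p]|; set k := #|[pred p | good p & _]|.
move: (#|A| ^ 3)%N (#|A| ^ 2)%N (D ^ 2)%N D1 => a3 a2 d d1 h1 h2.
have h3 : (k * (3 * a2) <= a3 * (4 * d + 9) * (3 * a2))%N by rewrite leq_mul2r h2 orbT.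
have h4 : (m * (4 * d) <= a3 * a2 * (4 * d))%N by rewrite leq_mul2r h1 orbT.
have h5 : (a3 * a2 <= a3 * a2 * d)%N by rewrite leq_pmulr.
lia.
Qed.

End Counting.

(** * The tenth moment of flat sequences *)

Lemma sqr_sum_le (R : realType) (T : finType) (x : T -> R) :
  (\sum_i x i) ^+ 2 <= #|T|%:R * \sum_i x i ^+ 2.
Proof.
have E : #|T|%:R * \sum_i x i ^+ 2 =
    \sum_i \sum_j (2^-1 * x i ^+ 2 + 2^-1 * x j ^+ 2).
  under [RHS]eq_bigr do rewrite big_split /= sumr_const -mulr_sumr -[_ *+ #|_|]mulr_natl.
  by rewrite big_split /= sumr_const -[_ *+ #|_|]mulr_natl -!mulr_sumr; field.
rewrite E expr2 mulr_suml ler_sum// => i _; rewrite mulr_sumr ler_sum// => j _.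
have := sqr_ge0 (x i - x j); rewrite sqrrB; lra.
Qed.

Definition freq N (i : 'I_(N.*2.+1)) : int := i%:Z - N%:Z.

Lemma freq_inj N : injective (@freq N).
Proof. by move=> i j; rewrite /freq => h; apply: val_inj => /=; lia. Qed.

Lemma freq_le N (i : 'I_(N.*2.+1)) : `|freq i| <= N%:Z.
Proof. by have := ltn_ord i; rewrite /freq; lia. Qed.

(** On a grid of more than [12 N ^ 3] points per side, this turns the congruences
    coming from orthogonality into the equations counted above. *)
Lemma dvdz_small (Q : nat) (x : int) : (Q %| x)%Z -> `|x| < Q%:Z -> x = 0.
Proof.
move=> /dvdzP[m ->]; rewrite normrM; case: (m =P 0) => [->|/eqP m0]; first by rewrite mul0r.
by rewrite [`|Posz Q|]ger0_norm//; nia.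
Qed.

Section TenthMoment.
Variables (R : realType) (N Q : nat).
Hypothesis N0 : (0 < N)%N.
Hypothesis QN : (12 * N ^ 3 < Q)%N.

Let I := 'I_(N.*2.+1).

(** The exponential sum sampled on the grid [(Z / Q) ^ 2]. *)
Definition osum (a : 'I_(N.*2.+1) -> R[i]) (g : 'I_Q * 'I_Q) : R[i] :=
  \sum_i a i * chi R (freq i, freq i ^+ 3) g.

Lemma Q_gt0 : (0 < Q)%N. Proof. exact: leq_ltn_trans QN. Qed.

(** Gaps lie in [-2 N, 2 N]; the shift by [2 N] gives them a finite index type. *)
Definition hidx (n : I * I) : 'I_(N.*2.*2.+1) := inord (n.1 + N.*2 - n.2)%N.

Lemma hidxE n : (hidx n : nat)%:Z = gap (@freq N) n + N.*2%:Z.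
Proof.
case: n => i j; have := ltn_ord i; have := ltn_ord j; rewrite /hidx /= => ? ?.
by rewrite inordK /gap /freq /=; lia.
Qed.

Definition Tsum (a : I -> R[i]) (h : 'I_(N.*2.*2.+1)) (g : 'I_Q * 'I_Q) : R[i] :=
  \sum_(n : I * I)
    if hidx n == h then a n.1 * ((a n.2)^*)%C * chi R (gap (@freq N) n, gap3 (@freq N) n) g else 0.

(** Weyl differencing: in [|f|^2] collect the pairs with a given gap [h], then
    apply Cauchy-Schwarz to the sum over [h]. *)
Lemma weyl_cauchy a g :
  cmod (osum a g) ^+ 4 <= (4 * N + 1)%:R * \sum_h cmod (Tsum a h g) ^+ 2.
Proof.
have E : (cmod (osum a g) ^+ 2)%:C%C = \sum_h Tsum a h g.
  rewrite cmod_sqr /osum mulr_suml.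
  under eq_bigr do rewrite conjc_sum mulr_sumr.
  rewrite pair_bigA (partition_big hidx xpredT)//=; apply: eq_bigr => h _.
  rewrite /Tsum -big_mkcond; apply: eq_bigr => -[i j] _; rewrite conjcM mulrACA -chiN -chiD.
  by congr (_ * chi _ _ _).
have -> : cmod (osum a g) ^+ 4 = (cmod (osum a g) ^+ 2) ^+ 2 by rewrite -exprM.
have L0 : 0 <= cmod (osum a g) ^+ 2 by exact: sqr_ge0.
rewrite -[in leLHS](ger0_norm L0) -cmodC E.
apply: (@le_trans _ _ ((\sum_h cmod (Tsum a h g)) ^+ 2)).
  by rewrite lerXn2r ?nnegrE ?cmod_ge0 ?sumr_ge0 ?ler_cmod_sum// => *; exact: cmod_ge0.
rewrite (le_trans (sqr_sum_le _))// ler_wpM2r//.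
  by apply: sumr_ge0 => h _; exact: sqr_ge0.
by rewrite card_ord ler_nat; lia.
Qed.

Let T := (I * I * I * (I * I))%type.
Let phi (t : T) : int * int :=
  (sum1 (@freq N) t.1 + gap (@freq N) t.2, sum3 (@freq N) t.1 + gap3 (@freq N) t.2).
Let coef (a : I -> R[i]) h (t : T) : R[i] :=
  a t.1.1.1 * a t.1.1.2 * a t.1.2 *
  (if hidx t.2 == h then a t.2.1 * ((a t.2.2)^*)%C else 0).

Lemma osum3_Tsum a h g :
  osum a g ^+ 3 * Tsum a h g = \sum_t coef a h t * chi R (phi t) g.
Proof.
have E3 : osum a g ^+ 3 = \sum_x a x.1.1 * a x.1.2 * a x.2 *
    chi R (sum1 (@freq N) x, sum3 (@freq N) x) g.
  rewrite !exprS expr0 mulr1 mulrA /osum mulr_suml.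
  under eq_bigr do rewrite mulr_sumr.
  rewrite pair_bigA mulr_suml; under eq_bigr do rewrite mulr_sumr.
  rewrite pair_bigA; apply: eq_bigr => -[[i j] k] _ /=.
  by rewrite [X in X * _]mulrACA [LHS]mulrACA -!chiD.
rewrite E3 /Tsum mulr_suml.
under eq_bigr do rewrite mulr_sumr.
rewrite pair_bigA; apply: eq_bigr => -[x n] _ /=; rewrite /coef /=.
case: ifP => _; last by rewrite !mulr0 mul0r.
by rewrite mulrACA -chiD.
Qed.

Variables (D : nat) (a : I -> R[i]) (s : R) (A : {set I}).
Hypothesis D0 : (0 < D)%N.
Hypothesis D_ge : forall n, (0 < n <= 24 * N ^ 3)%N -> (size (divisors n) <= D)%N.
Hypothesis aA : forall i, cmod (a i) <= if i \in A then s else 0.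

Let conf (t : T) := [&& t.1 \in triples A, t.2.1 \in A & t.2.2 \in A].

Let coef_le h t :
  cmod (coef a h t) <= if conf t && (hidx t.2 == h) then s ^+ 5 else 0.
Proof.
rewrite /coef /conf finset.inE; case: (hidx t.2 == h); last by rewrite mulr0 cmod0 andbF.
rewrite andbT !cmodM cmod_conj.
have nil (i : I) : i \notin A -> cmod (a i) = 0.
  by move=> iA; apply/eqP; rewrite eq_le cmod_ge0 andbT; have := aA i; rewrite (negPf iA).
have big (i : I) : i \in A -> cmod (a i) <= s by move=> iA; have := aA i; rewrite iA.
have [h1|/nil ->] := boolP (t.1.1.1 \in A); last by rewrite !mul0r.
have [h2|/nil ->] := boolP (t.1.1.2 \in A); last by rewrite mulr0 !mul0r.
have [h3|/nil ->] := boolP (t.1.2 \in A); last by rewrite mulr0 !mul0r.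
have [h4|/nil ->] := boolP (t.2.1 \in A); last by rewrite mul0r mulr0.
have [h5|/nil ->] := boolP (t.2.2 \in A); last by rewrite !mulr0.
rewrite /= (_ : s ^+ 5 = s * s * s * (s * s)); last by ring.
by rewrite !ler_pM ?mulr_ge0 ?cmod_ge0 ?big.
Qed.

(** By [weyl_cauchy], [|f| ^ 10 <= (4 N + 1) \sum_h |f ^ 3 T_h| ^ 2], and Parseval
    turns the sum over the grid of the right-hand side into the number of
    solutions of the system [tenfold] with unknowns in [A]. *)
Lemma tenth_moment_flat :
  \sum_g cmod (osum a g) ^+ 10 <=
    Q%:R ^+ 2 * (4 * N + 1)%:R * (43 * D ^ 2 * #|A| ^ 5)%:R * s ^+ 10.
Proof.
have s10 : 0 <= s ^+ 10.
  by rewrite (_ : s ^+ 10 = (s ^+ 5) ^+ 2) ?sqr_ge0// -exprM.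
pose r (t t' : T) := (Q %| (phi t).1 - (phi t').1)%Z && (Q %| (phi t).2 - (phi t').2)%Z.
apply: (@le_trans _ _ (\sum_g (4 * N + 1)%:R *
    \sum_h cmod (osum a g ^+ 3 * Tsum a h g) ^+ 2)).
  apply: ler_sum => g _.
  rewrite (_ : cmod (osum a g) ^+ 10 = cmod (osum a g) ^+ 4 * cmod (osum a g) ^+ 6); last first.
    by rewrite -exprD.
  rewrite (le_trans (ler_wpM2r _ (weyl_cauchy a g))) ?exprn_ge0 ?cmod_ge0//.
  rewrite -mulrA ler_wpM2l// mulr_suml ler_sum// => h _.
  by rewrite cmodM cmodX exprMn -exprM mulrC.
rewrite -mulr_sumr exchange_big /=.
rewrite [Q%:R ^+ 2 * _]mulrC -[leRHS]mulrA -[leRHS]mulrA ler_wpM2l//.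
apply: (@le_trans _ _ (\sum_h Q%:R ^+ 2 * \sum_t \sum_(t' | r t t')
    cmod (coef a h t) * cmod (coef a h t'))).
  apply: ler_sum => h _; under eq_bigr do rewrite osum3_Tsum.
  apply: parseval_le; first exact: sqr_ge0.
  by move=> t t'; rewrite chi_orthogonal// Q_gt0.
rewrite -mulr_sumr ler_wpM2l ?sqr_ge0// exchange_big /=.
under eq_bigr do rewrite exchange_big /=.
apply: (@le_trans _ _ (\sum_(p : T * T) if tenfold (@freq N) A p then s ^+ 10 else 0)); last first.
  rewrite -big_mkcond /= sumr_const -[_ *+ #|_|]mulr_natl ler_wpM2r//.
  rewrite ler_nat (leq_trans _ (card_tenfold (@freq_inj N) (@freq_le N) D_ge A D0))//.
  by apply: subset_leq_card; apply/fintype.subsetP => p pA; rewrite finset.in_set.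
rewrite -(pair_bigA _ (fun t t' => if tenfold (@freq N) A (t, t') then s ^+ 10 else 0)) /=.
apply: ler_sum => t _; rewrite big_mkcond /=; apply: ler_sum => t' _.
case: ifPn => [/andP[/= r1 r2]|_]; last by case: ifP.
apply: (@le_trans _ _ (\sum_(h | h == hidx t.2)
    if [&& conf t, conf t' & hidx t'.2 == h] then s ^+ 10 else 0)).
  rewrite [leRHS]big_mkcond /=; apply: ler_sum => h _.
  apply: (le_trans (ler_pM (cmod_ge0 _) (cmod_ge0 _) (coef_le h t) (coef_le h t'))).
  case: (conf t); rewrite /= ?mul0r; last by case: ifP.
  rewrite eq_sym; case: eqP => _; rewrite /= ?mul0r//.
  case: (conf t'); rewrite /= ?mulr0//.
  by case: ifP; rewrite ?mulr0// -exprD.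
rewrite big_pred1_eq; case: ifP => [/and3P[]|]; last by case: ifP.
move=> /and3P[tA t1 t2] /and3P[tA' t1' t2'] /eqP hh.
have gg : gap (@freq N) t.2 = gap (@freq N) t'.2.
  by have := hidxE t.2; have := hidxE t'.2; rewrite hh; lia.
have NQ : 12 * N%:Z ^+ 3 < Q%:Z.
  by rewrite (_ : 12 * N%:Z ^+ 3 = (12 * N ^ 3)%N%:Z)// PoszM -!natz natrX.
have N1 : N%:Z <= N%:Z ^+ 3.
  by rewrite ler_eXnr// ?lez_nat.
have e1 : sum1 (@freq N) t.1 = sum1 (@freq N) t'.1.
  apply/eqP; rewrite -subr_eq0; apply/eqP; apply: (@dvdz_small Q).
    by move: r1; rewrite gg opprD addrACA subrr addr0.
  case: t t' {r1 r2 tA tA' t1 t2 t1' t2' hh gg} => [[[i j] k] m] [[[i' j'] k'] m'] /=.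
  rewrite /sum1 /=; move: (freq_le i) (freq_le j) (freq_le k).
  by move: (freq_le i') (freq_le j') (freq_le k'); lia.
have e3 : sum3 (@freq N) t.1 + gap3 (@freq N) t.2 = sum3 (@freq N) t'.1 + gap3 (@freq N) t'.2.
  apply/eqP; rewrite -subr_eq0; apply/eqP; apply: (@dvdz_small Q) => //.
  have F (i : I) : `|freq i ^+ 3| <= N%:Z ^+ 3 by rewrite normrX lerXn2r ?nnegrE ?freq_le.
  move: (sum3_bound (@freq_le N) t.1) (sum3_bound (@freq_le N) t'.1).
  case: t t' {r1 r2 tA tA' t1 t2 t1' t2' hh gg e1} => [x [m n]] [x' [m' n']] /=.
  by move: (F m) (F n) (F m') (F n'); rewrite /gap3 /=; lia.
by rewrite /tenfold /= tA tA' t1 t2 t1' t2' e1 gg e3 !eqxx.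
Qed.

End TenthMoment.

(** * The tenth moment of arbitrary sequences *)

(** Here [k] is chosen larger than [A / eps]. *)
Lemma root_bound (R : realType) (eps : R) (A : nat) : 0 < eps ->
  exists k, forall C, exists2 C' : R, 0 < C' &
    forall D N, (0 < N)%N -> (D ^ k <= C * N ^ A)%N -> D%:R <= C' * N%:R `^ eps.
Proof.
move=> e0; pose k := (Num.truncn (A%:R / eps)).+1; exists k => C.
have kA : A%:R <= eps * k%:R.
  by rewrite mulrC -ler_pdivrMr// ltW// /k truncnS_gt.
exists C.+1%:R => // D N N0 H.
have N1 : 1 <= N%:R :> R by rewrite ler1n.
have P0 : 0 <= N%:R `^ eps :> R by exact: powR_ge0.
rewrite -(@ler_pXn2r _ k) ?nnegrE ?mulr_ge0// exprMn.
apply: (@le_trans _ _ (C%:R * N%:R ^+ A)).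
  by rewrite -!natrX -natrM ler_nat.
apply: ler_pM; rewrite ?exprn_ge0//.
  by rewrite -natrX ler_nat (leq_trans (leqnSn C))// -[leqLHS]expn1 leq_pexp2l.
by rewrite -!powR_mulrn ?powR_ge0// -powRrM ler_powR.
Qed.

Lemma divisor_sup (R : realType) (eps : R) : 0 < eps ->
  exists2 C : R, 0 < C & forall N, (0 < N)%N -> exists D : nat,
    [/\ (0 < D)%N,
        forall n, (0 < n <= 24 * N ^ 3)%N -> (size (divisors n) <= D)%N &
        D%:R <= C * N%:R `^ eps].
Proof.
move=> e0; have [k Hk] := root_bound 3 e0.
have [C0 HC0] := divisors_bound k.
have [C C_gt0 HC] := Hk (24 * C0)%N.
exists C => // N N0.
pose D := \max_(n < (24 * N ^ 3).+1) size (divisors n).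
have D_ge n : (0 < n <= 24 * N ^ 3)%N -> (size (divisors n) <= D)%N.
  move=> /andP[n0 nN]; have n1 : (n < (24 * N ^ 3).+1)%N by rewrite ltnS.
  exact: (leq_bigmax (Ordinal n1)).
have N3 : (0 < N ^ 3)%N by rewrite expn_gt0 N0.
exists D; split => //.
  by apply: leq_trans (D_ge 1%N _) => //; lia.
apply: HC => //.
have [|i Di] := @bigop.eq_bigmax 'I_(24 * N ^ 3).+1 (fun n => size (divisors n)).
  by rewrite card_ord.
rewrite /D Di; case: (posnP i) => [->|i0].
  by have := HC0 1%N isT; rewrite exp1n muln1 muln_gt0; lia.
rewrite (leq_trans (HC0 _ i0))// -mulnA [leqRHS]mulnCA leq_mul2l.
by rewrite -ltnS ltn_ord orbT.
Qed.

Fact flat_const_key : unit. Proof. exact: tt. Qed.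
(* Locked, since this number is too large to be computed in unary. *)
Definition flat_const : nat := locked_with flat_const_key (5 * 43 * 4 ^ 5)%N.

Lemma flat_constE : flat_const = (5 * 43 * 4 ^ 5)%N.
Proof. by rewrite /flat_const unlock. Qed.

Lemma flat_const_gt0 : (0 < flat_const)%N.
Proof. by rewrite flat_constE !muln_gt0 ?expn_gt0. Qed.

Section Levels.
Variables (R : realType).

Lemma sum_exp_le (T : finType) (x : T -> R) n : (forall i, 0 <= x i) -> (0 < n)%N ->
  (\sum_i x i) ^+ n <= #|T|%:R ^+ n * \sum_i x i ^+ n.
Proof.
move=> x0 n0; have [i0 _|T0] := pickP T; last first.
  by rewrite big_pred0 ?T0// expr0n eqn0Ngt n0 /= mulr_ge0 ?exprn_ge0 ?sumr_ge0// => i; rewrite exprn_ge0.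
have [i _ xi] := @arg_maxP _ _ _ i0 xpredT x isT.
apply: (@le_trans _ _ ((#|T|%:R * x i) ^+ n)).
  rewrite lerXn2r ?nnegrE ?mulr_ge0 ?sumr_ge0//.
  rewrite mulr_natl -sumr_const ler_sum// => j _; exact: xi.
rewrite exprMn ler_wpM2l ?exprn_ge0// (bigD1 i)//= lerDl sumr_ge0// => j _.
exact: exprn_ge0.
Qed.

Variables (N Q : nat).
Hypothesis N0 : (0 < N)%N.
Hypothesis QN : (12 * N ^ 3 < Q)%N.
Variables (D : nat).
Hypothesis D0 : (0 < D)%N.
Hypothesis D_ge : forall n, (0 < n <= 24 * N ^ 3)%N -> (size (divisors n) <= D)%N.

Let I := 'I_(N.*2.+1).
Implicit Types a : I -> R[i].

Lemma osum_sum (T : finType) (c : T -> I -> R[i]) (g : 'I_Q * 'I_Q) :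
  osum (fun i => \sum_t c t i) g = \sum_t osum (c t) g.
Proof.
by rewrite /osum exchange_big; apply: eq_bigr => i _; rewrite mulr_suml.
Qed.

Definition energy a : R := \sum_i cmod (a i) ^+ 2.

Lemma energy_ge0 a : 0 <= energy a.
Proof. by apply: sumr_ge0 => i _; exact: sqr_ge0. Qed.

Lemma cmod_le_energy a i : cmod (a i) <= Num.sqrt (energy a).
Proof.
rewrite -(ler_pXn2r (_ : 0 < 2)%N) ?nnegrE ?cmod_ge0 ?sqrtr_ge0//.
rewrite sqr_sqrtr ?energy_ge0// /energy (bigD1 i)//= lerDl sumr_ge0// => j _.
exact: sqr_ge0.
Qed.

(** Dyadic decomposition of a sequence according to the size of its terms; [band]
    is the part of size about [level a j] and [low] is what remains below the
    last level. *)
Definition level a j : R := Num.sqrt (energy a) / 2 ^+ j.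
Definition band a j i : R[i] :=
  if level a j.+1 < cmod (a i) <= level a j then a i else 0.
Definition low a j i : R[i] := if cmod (a i) <= level a j then a i else 0.

Lemma level_ge0 a j : 0 <= level a j.
Proof. by rewrite divr_ge0 ?sqrtr_ge0 ?exprn_ge0. Qed.

Lemma levelS a j : level a j = 2 * level a j.+1.
Proof. by rewrite /level exprS invfM mulrCA mulVKf. Qed.

Lemma sum_band a J i : \sum_(j < J) band a j i + low a J i = a i.
Proof.
elim: J => [|J IH].
  by rewrite big_ord0 add0r /low /level expr0 divr1 cmod_le_energy.
rewrite big_ord_recr /= -[RHS]IH -addrA; congr (_ + _).
rewrite /band /low; have := levelS a J; have := level_ge0 a J.+1.
case: (ltP (level a J.+1) (cmod (a i))) => h1; case: (leP (cmod (a i)) (level a J)) => h2 h3 h4 /=;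
  rewrite ?addr0 ?add0r//; exfalso; clear IH; lra.
Qed.

(** On a band with support [A], the energy is at least [#|A|] times the square of
    half the level, so that the flat bound [#|A| ^ 5 level ^ 10] is of the order
    of the fifth power of the energy. *)
Lemma tenth_moment_band a j :
  \sum_g cmod (osum (Q := Q) (band a j) g) ^+ 10 <=
    Q%:R ^+ 2 * (flat_const * N * D ^ 2)%:R * energy a ^+ 5.
Proof.
pose A := [set i | level a j.+1 < cmod (a i) <= level a j].
have aA i : cmod (band a j i) <= if i \in A then level a j else 0.
  by rewrite /band finset.inE; case: ifP => [/andP[]|]; rewrite ?cmod0.
apply: (le_trans (tenth_moment_flat N0 QN D0 D_ge aA)).
have As : #|A|%:R * level a j ^+ 2 <= 4 * energy a.
  rewrite levelS exprMn mulrCA (_ : 4 = 2 ^+ 2 :> R); last by rewrite -natrX.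
  apply: ler_wpM2l; first exact: exprn_ge0.
  rewrite mulr_natl -sumr_const [leRHS](bigID (mem A))/=.
  apply: ler_wpDr.
    by apply: sumr_ge0 => i _; exact: sqr_ge0.
  apply: ler_sum => i; rewrite finset.inE => /andP[h _].
  by rewrite lerXn2r ?nnegrE ?level_ge0 ?cmod_ge0// ltW.
rewrite -[leLHS]mulrA -[leLHS]mulrA -[leRHS]mulrA ler_wpM2l ?sqr_ge0//.
rewrite (_ : _ * _ = ((4 * N + 1) * (43 * D ^ 2))%:R * (#|A|%:R * level a j ^+ 2) ^+ 5); last first.
  rewrite (_ : level a j ^+ 10 = (level a j ^+ 2) ^+ 5); last by rewrite -exprM.
  by rewrite exprMn !natrM; ring.
have E0 := energy_ge0 a.
apply: (@le_trans _ _ (((4 * N + 1) * (43 * D ^ 2))%:R * (4 * energy a) ^+ 5)).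
  apply: ler_wpM2l; first exact: ler0n.
  by rewrite lerXn2r ?nnegrE ?mulr_ge0 ?exprn_ge0 ?level_ge0.
rewrite exprMn mulrA -natrX -natrM ler_wpM2r ?exprn_ge0// ler_nat.
rewrite flat_constE; move: (D ^ 2)%N (4 ^ 5)%N => d m.
rewrite (_ : 5 * 43 * m * N * d = 5 * N * (43 * d) * m)%N; last by lia.
by rewrite !leq_mul//; lia.
Qed.

(** Terms below the level [sqrt (energy a) / (2 N + 1)] are small enough for the
    triangle inequality. *)
Lemma tenth_moment_low a J : (N.*2.+1 <= 2 ^ J)%N ->
  \sum_g cmod (osum (Q := Q) (low a J) g) ^+ 10 <=
    Q%:R ^+ 2 * (flat_const * N * D ^ 2)%:R * energy a ^+ 5.
Proof.
move=> NJ; have E0 := energy_ge0 a.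
have H g : cmod (osum (Q := Q) (low a J) g) ^+ 10 <= energy a ^+ 5.
  rewrite -[in leRHS](sqr_sqrtr E0) -exprM lerXn2r ?nnegrE ?cmod_ge0 ?sqrtr_ge0//.
  rewrite (le_trans (ler_cmod_sum _ _ _))//.
  apply: (@le_trans _ _ (\sum_(i < N.*2.+1) level a J)).
    apply: ler_sum => i _; rewrite cmodM cmod_chi mulr1 /low.
    by case: ifP; rewrite ?cmod0 ?level_ge0.
  rewrite sumr_const card_ord -mulr_natl /level mulrCA ler_piMr ?sqrtr_ge0//.
  by rewrite ler_pdivrMr ?exprn_gt0// mul1r -natrX ler_nat.
apply: (@le_trans _ _ (\sum_(g : 'I_Q * 'I_Q) energy a ^+ 5)); first exact: ler_sum.
rewrite sumr_const card_prod !card_ord -[_ *+ _]mulr_natl natrM -expr2.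
rewrite ler_wpM2r ?exprn_ge0// ler_peMr ?sqr_ge0// ler1n.
by rewrite !muln_gt0 flat_const_gt0 N0 ?expn_gt0 ?D0.
Qed.

Lemma tenth_moment_levels a J : (N.*2.+1 <= 2 ^ J)%N ->
  \sum_g cmod (osum (Q := Q) a g) ^+ 10 <=
    J.+1%:R ^+ 11 * (Q%:R ^+ 2 * (flat_const * N * D ^ 2)%:R * energy a ^+ 5).
Proof.
move=> NJ; pose c (j : 'I_J.+1) := if (j < J)%N then band a j else low a J.
have osumE g : osum (Q := Q) a g = \sum_j osum (c j) g.
  rewrite -osum_sum; apply: eq_bigr => i _; congr (_ * _).
  rewrite -[LHS](sum_band a J) big_ord_recr /= {2}/c /= ltnn; congr (_ + _).
  by apply: eq_bigr => j _; rewrite /c /= ltn_ord.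
apply: (@le_trans _ _ (\sum_g J.+1%:R ^+ 10 * \sum_j cmod (osum (Q := Q) (c j) g) ^+ 10)).
  apply: ler_sum => g _; rewrite osumE.
  apply: (@le_trans _ _ ((\sum_j cmod (osum (c j) g)) ^+ 10)).
    by rewrite lerXn2r ?nnegrE ?cmod_ge0 ?ler_cmod_sum ?sumr_ge0// => j _; exact: cmod_ge0.
  have := @sum_exp_le _ (fun j => cmod (osum (c j) g)) 10.
  by rewrite card_ord; apply => // j; exact: cmod_ge0.
rewrite -mulr_sumr exchange_big /= [_ ^+ 11]exprSr -[leRHS]mulrA ler_wpM2l ?exprn_ge0//.
rewrite mulr_natl -[in leRHS](card_ord J.+1) -sumr_const ler_sum// => j _.
by rewrite /c; case: ifP => _; [exact: tenth_moment_band | exact: tenth_moment_low].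
Qed.

End Levels.

(** The decomposition has about [log N] levels. Both this number, to the power 11,
    and the divisor bound [D], squared, are absorbed by [N `^ eps]; hence the
    choice of [eps / 13] for each factor. *)
Lemma tenth_moment (R : realType) (eps : R) : 0 < eps ->
  exists2 C : R, 0 < C & forall N Q (a : 'I_(N.*2.+1) -> R[i]),
    (0 < N)%N -> (12 * N ^ 3 < Q)%N ->
    \sum_g cmod (osum (Q := Q) a g) ^+ 10 <=
      C * Q%:R ^+ 2 * N%:R `^ (1 + eps) * energy a ^+ 5.
Proof.
move=> e0; have d0 : 0 < eps / 13 by rewrite divr_gt0.
have [CD CD0 HD] := divisor_sup d0.
have [k Hk] := root_bound 1 d0.
have [CJ CJ0 HJ] := Hk (k`! * 2 ^ k * 6)%N.
exists (CJ ^+ 11 * flat_const%:R * CD ^+ 2) => [|N Q a N0 QN].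
  by rewrite !mulr_gt0 ?exprn_gt0 ?ltr0n ?flat_const_gt0.
have [D [D0 D_ge DN]] := HD N N0.
pose J := (trunc_log 2 N.*2.+1).+1.
have NJ : (N.*2.+1 <= 2 ^ J)%N by rewrite ltnW// trunc_log_ltn.
have JN : J.+1%:R <= CJ * N%:R `^ (eps / 13).
  apply: HJ => //; rewrite (leq_trans (exp_le_pow2 k J))// expn1 -[leqRHS]mulnA leq_mul2l.
  have /andP[h _] := @trunc_log_bounds 2 N.*2.+1 isT isT.
  by rewrite /J expnS; apply/orP; right; lia.
apply: (le_trans (tenth_moment_levels N0 QN D0 D_ge a NJ)).
set P := N%:R `^ (eps / 13).
have P0 : 0 <= P by exact: powR_ge0.
have -> : N%:R `^ (1 + eps) = N%:R * P ^+ 13.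
  rewrite -powR_mulrn// -powRrM divfK// powRD ?powRr1//.
  by apply/implyP => _; rewrite pnatr_eq0 -lt0n.
have h1 : J.+1%:R ^+ 11 <= CJ ^+ 11 * P ^+ 11.
  by rewrite -exprMn lerXn2r ?nnegrE ?mulr_ge0// ltW.
have h2 : D%:R ^+ 2 <= CD ^+ 2 * P ^+ 2.
  by rewrite -exprMn lerXn2r ?nnegrE ?mulr_ge0// ltW.
set E := energy a; have E0 : 0 <= E by exact: energy_ge0.
have -> : (flat_const * N * D ^ 2)%:R = flat_const%:R * N%:R * D%:R ^+ 2 :> R.
  by rewrite [LHS]natrM [(_ * N)%N%:R]natrM natrX.
have -> : J.+1%:R ^+ 11 * (Q%:R ^+ 2 * (flat_const%:R * N%:R * D%:R ^+ 2) * E ^+ 5) =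
  (J.+1%:R ^+ 11 * D%:R ^+ 2) * (Q%:R ^+ 2 * flat_const%:R * N%:R * E ^+ 5) by ring.
have -> : CJ ^+ 11 * flat_const%:R * CD ^+ 2 * Q%:R ^+ 2 * (N%:R * P ^+ 13) * E ^+ 5 =
  (CJ ^+ 11 * P ^+ 11 * (CD ^+ 2 * P ^+ 2)) * (Q%:R ^+ 2 * flat_const%:R * N%:R * E ^+ 5) by ring.
apply: ler_wpM2r; first by rewrite !mulr_ge0 ?exprn_ge0.
by rewrite ler_pM ?exprn_ge0.
Qed.

(** * Weyl differencing *)

Section Differencing.
Variable R : realType.
Implicit Types (u : nat -> R[i]) (x t : R).

Lemma sum_triangle (V : nmodType) (F : nat -> nat -> V) K :
  \sum_(j < K) \sum_(h < K - j) F h j = \sum_(h < K) \sum_(j < K - h) F h j.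
Proof.
have E (G : nat -> nat -> V) :
    \sum_(j < K) \sum_(h < K - j) G h j = \sum_(j < K) \sum_(h < K | (h + j < K)%N) G h j.
  apply: eq_bigr => j _.
  rewrite (big_ord_widen _ (fun h => G h j) (leq_subr j K)).
  by apply: eq_bigl => h; rewrite ltn_subRL addnC.
rewrite E (E (fun j h => F h j)) (exchange_big_dep xpredT)//=.
by apply: eq_bigr => j _; apply: eq_bigl => h; rewrite addnC.
Qed.

(** Expand the square and group the terms by the difference [h] of their indices;
    negative differences give conjugates of positive ones, whence the factor 2. *)
Lemma weyl_differencing u K :
  cmod (\sum_(k < K) u k) ^+ 2 <=
    2 * \sum_(h < K) cmod (\sum_(k < K - h) u (k + h)%N * ((u k)^*)%C).
Proof.
have E : (cmod (\sum_(k < K) u k) ^+ 2)%:C%C =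
    \sum_(h < K) \sum_(k < K - h) u (k + h)%N * ((u k)^*)%C +
    \sum_(h < K) \sum_(k < K - h) (if h == 0%N :> nat then 0 else u k * ((u (k + h)%N)^*)%C).
  rewrite cmod_sqr conjc_sum mulr_sumr.
  rewrite -(sum_triangle (fun h k => u (k + h)%N * ((u k)^*)%C)).
  rewrite -(sum_triangle (fun h k => if h == 0%N then 0 else u k * ((u (k + h)%N)^*)%C)).
  have cut j (G : nat -> R[i]) : (j < K)%N ->
      \sum_(i < K) G i = \sum_(h < K - j) G (j + h)%N + \sum_(i < j) G i.
    move=> jK; rewrite addrC -(big_mkord xpredT G) (big_cat_nat (n := j))//=; last exact: ltnW.
    rewrite big_mkord; congr (_ + _).
    rewrite -{1}[j]add0n big_addn big_mkord.
    by apply: eq_bigr => h _; rewrite addnC.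
  under eq_bigr => j _ do
    rewrite mulr_suml (cut j (fun i => u i * ((u j)^*)%C) (ltn_ord j)).
  rewrite big_split; congr (_ + _).
  transitivity (\sum_(i < K) \sum_(j < K) if (i < j)%N then u i * ((u j)^*)%C else 0).
    rewrite exchange_big; apply: eq_bigr => j _.
    by rewrite -big_mkcond (big_ord_widen _ (fun i => u i * ((u j)^*)%C) (ltnW (ltn_ord j))).
  apply: eq_bigr => i _.
  rewrite (cut i (fun j => if (i < j)%N then u i * ((u j)^*)%C else 0) (ltn_ord i)).
  rewrite [X in _ + X]big1 ?addr0; last by move=> j _; rewrite ltnNge ltnW.
  by apply: eq_bigr => h _; rewrite -[X in (X < _)%N]addn0 ltn_add2l lt0n; case: eqP.
have L0 : 0 <= cmod (\sum_(k < K) u k) ^+ 2 by exact: sqr_ge0.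
rewrite -[leLHS](ger0_norm L0) -cmodC E (le_trans (ler_cmodD _ _))//.
rewrite mulr_natl mulr2n lerD ?ler_cmod_sum//.
rewrite (le_trans (ler_cmod_sum _ _ _))// ler_sum// => h _.
case: eqP => [_|_]; first by rewrite big1 ?cmod0 ?cmod_ge0.
rewrite -[leRHS]cmod_conj conjc_sum.
by under [X in _ <= cmod X]eq_bigr do rewrite conjcM conjcK mulrC.
Qed.

(** The common bound for the partial sums of [\sum_k e x ^+ k] of length at
    most [K]. *)
Definition geo (K : nat) x : R := if chord x * K%:R <= 2 then K%:R else 2 / chord x.

Lemma geo_ge0 K x : 0 <= geo K x.
Proof. by rewrite /geo; case: ifP => // _; rewrite divr_ge0 ?chord_ge0. Qed.

Lemma geo_le K x : geo K x <= K%:R.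
Proof.
rewrite /geo; case: ifPn => //; rewrite -ltNge => h.
have c0 : 0 < chord x.
  rewrite lt_neqAle chord_ge0 andbT eq_sym; apply: contraTneq h => ->.
  by rewrite mul0r -leNgt.
by rewrite ler_pdivrMr// mulrC ltW.
Qed.

Lemma geo_chord K x : geo K x * chord x <= 2.
Proof.
rewrite /geo; case: ifPn => [|h]; first by rewrite mulrC.
have [->|c0] := eqVneq (chord x) 0; first by rewrite mulr0.
by rewrite divfK.
Qed.

Lemma geometric_le K K' x : (K' <= K)%N -> cmod (\sum_(k < K') e x ^+ k) <= geo K x.
Proof.
move=> KK; rewrite /geo; case: ifPn => h.
  rewrite (le_trans (ler_cmod_sum _ _ _))//.
  under eq_bigr do rewrite cmodX cmod_e expr1n.
  by rewrite sumr_const card_ord ler_nat.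
have c0 : 0 < chord x.
  rewrite lt_neqAle chord_ge0 andbT eq_sym; apply: contraNneq h => ->.
  by rewrite mul0r.
rewrite ler_pdivlMr// /chord -cmodM mulrC -[1 - e x]opprB mulNr -subrX1 cmodN.
by rewrite (le_trans (ler_cmodD _ _))// cmodN cmod1 cmodX cmod_e expr1n.
Qed.

(** Two differencings of a cubic phase leave geometric sums of ratio
    [e (6 h m t)]. *)
Lemma kernel_fourth K x c t :
  cmod (\sum_(k < K) e (x * (k%:R - c) + t * (k%:R - c) ^+ 3)) ^+ 4 <=
    8 * K%:R * \sum_(h < K) \sum_(m < K) geo K ((6 * h * m)%:R * t).
Proof.
pose f (k : nat) : R := x * (k%:R - c) + t * (k%:R - c) ^+ 3.
pose u k := e (f k).
have H : cmod (\sum_(k < K) u k) ^+ 4 <=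
    4 * K%:R * \sum_(h < K) cmod (\sum_(k < K - h) u (k + h)%N * ((u k)^*)%C) ^+ 2.
  rewrite (_ : _ ^+ 4 = (cmod (\sum_(k < K) u k) ^+ 2) ^+ 2); last by rewrite -exprM.
  apply: (@le_trans _ _ ((2 * \sum_(h < K) cmod (\sum_(k < K - h) u (k + h)%N * ((u k)^*)%C)) ^+ 2)).
    rewrite lerXn2r ?nnegrE ?sqr_ge0 ?weyl_differencing// mulr_ge0// sumr_ge0// => h _.
    exact: cmod_ge0.
  rewrite exprMn -mulrA (_ : 2 ^+ 2 = 4 :> R); last by rewrite -natrX.
  by apply: ler_wpM2l => //; rewrite (le_trans (sqr_sum_le _))// card_ord.
rewrite (le_trans H)// (_ : 8 * K%:R = 4 * K%:R * 2); last by ring.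
rewrite -[leRHS]mulrA; apply: ler_wpM2l; first by rewrite mulr_ge0.
rewrite mulr_sumr ler_sum// => h _.
rewrite (le_trans (weyl_differencing (fun k => u (k + h)%N * ((u k)^*)%C) _))//.
rewrite ler_wpM2l//.
apply: (@le_trans _ _ (\sum_(m < K - h) geo K ((6 * h * m)%:R * t))).
  apply: ler_sum => m _.
  pose d := f (m + h)%N - f m - f h + f 0%N.
  have E k : u (k + m + h)%N * ((u (k + m)%N)^*)%C * ((u (k + h)%N * ((u k)^*)%C)^*)%C =
      e d * e ((6 * h * m)%:R * t) ^+ k.
    rewrite conjcM conjcK /u -!eN -eMn -!eD; congr e.
    by rewrite /d /f !natrD !natrM -[_ *+ k]mulr_natr; ring.
  under eq_bigr do rewrite E.
  rewrite -mulr_sumr cmodM cmod_e mul1r geometric_le//.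
  by rewrite (leq_trans (leq_subr _ _))// leq_subr.
rewrite (big_ord_widen _ (fun m => geo K ((6 * h * m)%:R * t)) (leq_subr h K)).
rewrite big_mkcond /=; apply: ler_sum => m _; case: ifP => // _.
exact: geo_ge0.
Qed.

End Differencing.

(** * Diophantine approximation and spacing of multiples *)

Lemma modnMr_inj q a c d : coprime q a -> (c < q)%N -> (d < q)%N ->
  (c * a = d * a %[mod q])%N -> c = d.
Proof.
move=> qa; wlog cd : c d / (c <= d)%N => [H cq dq E|_ dq /eqP].
  by case: (leqP c d) => h; [exact: H | apply/esym/H => //; exact: ltnW].
rewrite eq_sym eqn_mod_dvd ?leq_mul2r ?cd ?orbT// -mulnBl Gauss_dvdl//.
by case: (posnP (d - c)%N) => [|h /(dvdn_leq h)]; lia.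
Qed.

Section Dirichlet.
Variable R : realType.

(** Pigeonhole on the fractional parts of [0, t, .., Y t], after which the fraction
    obtained is put in lowest terms. *)
Lemma dirichlet (t : R) Y : 0 <= t -> (0 < Y)%N ->
  exists q a : nat, [/\ (0 < q <= Y)%N, coprime q a & `|t - a%:R / q%:R| <= (q * Y)%:R^-1].
Proof.
move=> t0 Y0; have YR : 0 < Y%:R :> R by rewrite ltr0n.
pose fr (k : nat) : R := t *+ k - (Num.truncn (t *+ k))%:R.
have fr01 k : 0 <= fr k /\ fr k < 1.
  have /andP[h1 h2] := truncn_itv (mulrn_wge0 k t0).
  by rewrite /fr -natr1 in h2 *; split; lra.
have box k : (Num.truncn (Y%:R * fr k) < Y)%N.
  have [f0 f1] := fr01 k.
  by rewrite truncn_lt_nat ?mulr_ge0// gtr_pMr.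
pose b (k : 'I_Y.+1) : 'I_Y := Ordinal (box k).
have [i [j [ij bij]]] : exists i j : 'I_Y.+1, (i < j)%N /\ b i = b j.
  have : ~~ injectiveb b.
    by apply/injectiveP => /leq_card; rewrite !card_ord ltnn.
  case/injectivePn => i [j ij bij].
  by case: (ltngtP i j) => h; [exists i, j | exists j, i | move: ij; rewrite (val_inj h) eqxx].
have close : `|fr j - fr i| <= Y%:R^-1.
  have E := congr1 val bij; rewrite /= in E.
  have [fi0 fi1] := fr01 i; have [fj0 fj1] := fr01 j.
  have /andP[hi1 hi2] := truncn_itv (mulr_ge0 (ltW YR) fi0).
  have /andP[hj1 hj2] := truncn_itv (mulr_ge0 (ltW YR) fj0).
  rewrite E -!natr1 in hi1 hi2 hj1 hj2.
  rewrite -(ler_pM2l YR) divff ?gt_eqF// -[X in X * _](ger0_norm (ltW YR)) -normrM.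
  rewrite ler_norml mulrBr; lra.
pose q0 := (j - i)%N; pose a0 := (Num.truncn (t *+ j) - Num.truncn (t *+ i))%N.
have q00 : (0 < q0)%N by rewrite subn_gt0.
have q0Y : (q0 <= Y)%N by rewrite (leq_trans (leq_subr _ _))// -ltnS.
have qa0 : `|t *+ q0 - a0%:R| <= Y%:R^-1.
  rewrite (_ : t *+ q0 - a0%:R = fr j - fr i)// /q0 /a0 /fr.
  rewrite mulrnBr ?natrB; [ring | | exact: ltnW].
  by apply: le_truncn; rewrite ler_wpMn2l// ltnW.
pose g := gcdn q0 a0; have g0 : (0 < g)%N by rewrite gcdn_gt0 q00.
have gq : (q0 %/ g * g)%N = q0 by rewrite divnK// dvdn_gcdl.
have ga : (a0 %/ g * g)%N = a0 by rewrite divnK// dvdn_gcdr.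
have q1 : (0 < q0 %/ g)%N by rewrite divn_gt0// dvdn_leq// dvdn_gcdl.
exists (q0 %/ g)%N, (a0 %/ g)%N; split.
- by rewrite q1 (leq_trans (leq_div _ _)).
- by rewrite /coprime -(eqn_pmul2r g0) muln_gcdl gq ga mul1n.
have q0R : 0 < q0%:R :> R by rewrite ltr0n.
have gR : g%:R != 0 :> R by rewrite pnatr_eq0 -lt0n.
have -> : (a0 %/ g)%:R / (q0 %/ g)%:R = a0%:R / q0%:R :> R.
  by rewrite -{2}ga -{2}gq !natrM -mulf_div divff ?mulr1.
apply: (@le_trans _ _ (q0 * Y)%:R^-1).
  rewrite natrM invfM -(ler_pM2l q0R) mulrA divff ?gt_eqF// mul1r.
  rewrite -[X in X * _](ger0_norm (ltW q0R)) -normrM mulrBr mulrCA divff ?gt_eqF//.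
  by rewrite mulr1 mulr_natl.
rewrite lef_pV2 ?posrE ?ltr0n ?muln_gt0 ?q00 ?q1 ?Y0// ler_nat leq_mul2r.
by rewrite leq_div orbT.
Qed.

Lemma card_le_real (q : nat) (z : R) : 0 <= z ->
  #|[set c : 'I_q | (0 < c)%N && (c%:R <= z)]|%:R <= z.
Proof.
move=> z0; apply: (@le_trans _ _ (Num.truncn z)%:R); last by rewrite truncn_le.
rewrite ler_nat -[leqRHS]card_ord.
case: (Num.truncn z) (truncn_itv z0) => [|n] /andP[h1 h2].
  rewrite card_ord leqn0 cards_eq0; apply/eqP/setP => c; rewrite !finset.inE.
  apply/negP => /andP[c0 cz].
  by have := le_lt_trans cz h2; rewrite ltr_nat ltnNge c0.
rewrite -cardsT; apply: (@leq_card_inj _ _ _ _ (fun c : 'I_q => inord c.-1 : 'I_n.+1)) => //.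
have small (c : 'I_q) : (0 < c)%N && (c%:R <= z) -> (c.-1 < n.+1)%N.
  move=> /andP[c0 cz]; rewrite prednK// -ltnS.
  by have := le_lt_trans cz h2; rewrite ltr_nat.
move=> c d; rewrite !finset.inE => hc hd /(congr1 val) /=.
rewrite !inordK ?small// => E; apply: val_inj => /=.
by move: hc hd E => /andP[c0 _] /andP[d0 _]; lia.
Qed.

Lemma chord_frac_ge (q c : nat) : (c < q)%N ->
  2 * (minn c (q - c))%:R <= chord (c%:R / q%:R : R) * q%:R.
Proof.
move=> cq; have qR : 0 < q%:R :> R by rewrite ltr0n (leq_ltn_trans _ cq).
have cR : c%:R < q%:R :> R by rewrite ltr_nat.
have cq1 : c%:R / q%:R <= 1 :> R by rewrite ler_pdivrMr// mul1r ltW.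
have c0 : 0 <= c%:R / q%:R :> R by rewrite divr_ge0.
case: (leqP c (q - c)) => h.
  rewrite -ler_pdivrMr// -mulrA -[X in 2 * X <= _]ger0_norm// chord_ge//.
  rewrite ger0_norm// ler_pdivrMr// mulrC ler_pdivlMr// -natrM ler_nat; lia.
rewrite -ler_pdivrMr// -mulrA -(chordDint _ (-1)) rmorphN /= -chordN.
have -> : - (c%:R / q%:R + - 1%:~R) = (q - c)%:R / q%:R :> R.
  by rewrite natrB 1?ltnW// mulrBl divff ?gt_eqF// opprD opprK addrC.
have d0 : 0 <= (q - c)%:R / q%:R :> R by rewrite divr_ge0.
rewrite -[X in 2 * X <= _]ger0_norm// chord_ge//.
rewrite ger0_norm// ler_pdivrMr// mulrC ler_pdivlMr// -natrM ler_nat; lia.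
Qed.

Section Spacing.
Variables (t : R) (q a Y : nat).
Hypothesis q0 : (0 < q)%N.
Hypothesis Y0 : (0 < Y)%N.
Hypothesis qa : coprime q a.
Hypothesis ta : `|t - a%:R / q%:R| <= (q * Y)%:R^-1.

Let qR : 0 < q%:R :> R. Proof. by rewrite ltr0n. Qed.

Lemma chord_mul_approx (l : nat) :
  chord (l%:R * (a%:R / q%:R) : R) <= chord (l%:R * t) + 8 * (l%:R / (q * Y)%:R).
Proof.
have -> : l%:R * (a%:R / q%:R) = l%:R * t + (l%:R * (a%:R / q%:R - t)) :> R by ring.
rewrite (le_trans (chordD _ _))// lerD2l (le_trans (chord_le _))//.
by rewrite ler_wpM2l// normrM ger0_norm// ler_wpM2l// distrC.
Qed.

Lemma chord_residue (l : nat) :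
  chord (l%:R * (a%:R / q%:R) : R) = chord ((l * a %% q)%:R / q%:R : R).
Proof.
have -> : l%:R * (a%:R / q%:R) = (l * a %% q)%:R / q%:R + (l * a %/ q)%:Z%:~R :> R.
  rewrite mulrA -natrM {1}(divn_eq (l * a) q) natrD natrM mulrDl mulfK ?gt_eqF//.
  by rewrite addrC.
exact: chordDint.
Qed.

Lemma card_chord_frac (z : R) : 0 <= z ->
  #|[set c : 'I_q | (0 < c)%N && (chord (c%:R / q%:R : R) <= z)]|%:R <= z * q%:R.
Proof.
move=> z0; pose A (y : R) := [set c : 'I_q | (0 < c)%N && (c%:R <= y)].
pose y := z * q%:R / 2.
have y0 : 0 <= y by rewrite /y !mulr_ge0.
apply: (@le_trans _ _ (#|A y|%:R + #|A y|%:R)); last first.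
  by rewrite (le_trans (lerD (card_le_real _ y0) (card_le_real _ y0)))// /y; lra.
rewrite -natrD ler_nat.
pose op (c : 'I_q) : 'I_q := Ordinal (ltn_pmod (q - c) q0).
pose B := [set c : 'I_q | (0 < c)%N && ((q - c)%:R <= y)].
apply: (@leq_trans (#|A y :|: B|)).
  apply: subset_leq_card; apply/fintype.subsetP => c; rewrite !finset.inE.
  move=> /andP[c0 cz]; rewrite c0 /=; apply/orP.
  have := chord_frac_ge (ltn_ord c).
  have : chord (c%:R / q%:R : R) * q%:R <= z * q%:R by rewrite ler_wpM2r.
  rewrite /y; case: leqP => _ h1 h2; [left | right]; lra.
have BA : (#|B| <= #|A y|)%N.
  have opE (c : 'I_q) : (0 < c)%N -> (op c : nat) = (q - c)%N.
    by move=> c0; rewrite /op /= modn_small//; have := ltn_ord c; lia.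
  apply: (@leq_card_inj _ _ _ _ op).
    move=> c d; rewrite !finset.inE => /andP[c0 _] /andP[d0 _] /(congr1 val)/=.
    rewrite -!/(nat_of_ord (op _)).
    have := opE c c0; have := opE d d0; rewrite /op /= => -> -> E.
    by apply: val_inj => /=; have := ltn_ord c; have := ltn_ord d; lia.
  move=> c; rewrite !finset.inE => /andP[c0 cy]; rewrite opE// cy andbT.
  by rewrite subn_gt0.
by have := cardsU (A y) B; lia.
Qed.

Let kap' (k : R) := 2 * k + 8 / Y%:R.

(** As [d] runs over the residues modulo [q], so does [d a]; hence the multiples
    [d t] that are close to integers are nearly the fractions [c / q] that are. *)
Lemma card_multiples (k : R) : 0 <= k ->
  #|[set d : 'I_q | (0 < d)%N && (chord (d%:R * t) <= 2 * k)]|%:R <= kap' k * q%:R.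
Proof.
move=> k0; have k'0 : 0 <= kap' k by rewrite addr_ge0 ?mulr_ge0// divr_ge0.
apply: le_trans (card_chord_frac k'0); rewrite ler_nat.
apply: (@leq_card_inj _ _ _ _ (fun d : 'I_q => Ordinal (ltn_pmod (d * a) q0))).
  move=> c d _ _ /(congr1 val)/= E; apply: val_inj => /=.
  exact: (modnMr_inj qa) E.
move=> d; rewrite !finset.inE /= => /andP[d0 hd]; apply/andP; split.
  rewrite lt0n -/(_ %| _)%N Gauss_dvdl//.
  by apply/negP => /dvdn_leq; rewrite d0 => /(_ isT); rewrite leqNgt ltn_ord.
rewrite -chord_residue (le_trans (chord_mul_approx d))// lerD// ler_wpM2l//.
rewrite natrM invfM mulrA ler_piMl ?invr_ge0// ler_pdivrMr// mul1r ler_nat.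
exact: ltnW.
Qed.

(** Among [q] consecutive multiples of [t], two that are both close to integers
    differ by a small multiple of [t] that is close to an integer, and the
    small multiples [d t] are nearly the distinct fractions [d a / q]. *)
Lemma card_block (b : nat) (k : R) : 0 <= k ->
  #|[set r : 'I_q | chord ((b + r)%:R * t) <= k]|%:R <= 1 + kap' k * q%:R.
Proof.
move=> k0; set P := [set r : 'I_q | _].
have [->|[r1 r1P]] := set_0Vmem P.
  by rewrite finset.cards0 addr_ge0// mulr_ge0// addr_ge0 ?mulr_ge0// divr_ge0.
have [r0 r0P r0min] := @arg_minnP _ r1 (fun r => r \in P) (fun r => r : nat) r1P.
rewrite (cardsD1 r0) r0P natrD lerD2l.
apply: le_trans (card_multiples k0); rewrite ler_nat.
have ltq (r : 'I_q) : (r - r0 < q)%N by rewrite (leq_ltn_trans (leq_subr _ _)).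
apply: (@leq_card_inj _ _ _ _ (fun r => Ordinal (ltq r))).
  move=> r s; rewrite !finset.in_setD1 => /andP[_ /r0min h1] /andP[_ /r0min h2].
  by move=> /(congr1 val)/= E; apply: val_inj => /=; lia.
move=> r; rewrite finset.in_setD1 => /andP[rr0 rP]; have h := r0min r rP.
rewrite !finset.inE /= in rP r0P *; apply/andP; split.
  by rewrite subn_gt0 ltn_neqAle h andbT eq_sym.
have -> : (r - r0)%:R * t = (b + r)%:R * t + - ((b + r0)%:R * t).
  by rewrite natrB// !natrD; ring.
by rewrite (le_trans (chordD _ _))// chordN (_ : 2 * k = k + k) ?lerD//; ring.
Qed.

(** The threshold [k] separates the multiples of [t] near integers, which are few
    by [card_block] and are each charged [K], from the others, charged [2 / k]. *)
Lemma sum_geo_le (K B : nat) (k : R) : 0 < k ->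
  \sum_(l < B * q) geo K (l%:R * t) <=
    K%:R * B%:R * (1 + kap' k * q%:R) + (B * q)%:R * (2 / k).
Proof.
move=> k0; have geoK l : geo K (l%:R * t) <=
    K%:R * (chord (l%:R * t) <= k)%R%:R + 2 / k.
  case: (leP (chord (l%:R * t)) k) => h /=; first by rewrite mulr1 ler_wpDr ?geo_le ?divr_ge0 ?ltW.
  rewrite mulr0 add0r ler_pdivlMr// (le_trans _ (geo_chord K (l%:R * t)))//.
  by rewrite ler_wpM2l ?geo_ge0// ltW.
apply: (@le_trans _ _ (\sum_(l < B * q) (K%:R * (chord (l%:R * t) <= k)%R%:R + 2 / k))).
  by apply: ler_sum => l _; exact: geoK.
rewrite big_split /= sumr_const card_ord; apply: lerD; last by rewrite [(B * q)%:R * _]mulr_natl.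
rewrite -mulr_sumr -[leRHS]mulrA ler_wpM2l//.
rewrite -(big_mkord xpredT (fun l => (chord (l%:R * t) <= k)%R%:R)) big_nat_mul.
rewrite mulr_natl -[X in _ *+ X]subn0 -sumr_const_nat; apply: ler_sum => b _.
rewrite mulSn -{1}[(b * q)%N]add0n big_addn addnK big_mkord.
apply: le_trans (card_block (b * q)%N (ltW k0)).
rewrite -sum1_card natr_sum [leRHS]big_mkcond /=; apply: ler_sum => r _.
by rewrite finset.inE addnC; case: (leP (chord _) k).
Qed.

End Spacing.
End Dirichlet.

(** * Weyl sums on minor and major arcs *)

Lemma leq_mul_double (h m N : nat) :
  (h < N.*2)%N -> (m < N.*2)%N -> (h.+1 * m.+1 <= 4 * N ^ 2)%N.
Proof.
move=> hN mN; rewrite (_ : 4 * N ^ 2 = N.*2 * N.*2)%N ?leq_mul//.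
by rewrite -!muln2 -mulnn; lia.
Qed.

Lemma double_le3 (N : nat) : (0 < N)%N -> (N.*2.+1 <= 3 * N)%N.
Proof. lia. Qed.

Section WeylSum.
Variable R : realType.

(** The sum in [kernel_fourth] without the terms having [h = 0] or [m = 0]. *)
Definition weyl_sum (K X : nat) (t : R) : R :=
  \sum_(h < X) \sum_(m < X) geo K ((6 * h.+1 * m.+1)%:R * t).

(** A number is of the form [6 h m] in at most as many ways as it has divisors. *)
Lemma sum_products_le (F : nat -> R) X L D : (forall l, 0 <= F l) ->
  (6 * X * X < L)%N ->
  (forall n, (0 < n <= 6 * X * X)%N -> (size (divisors n) <= D)%N) ->
  \sum_(h < X) \sum_(m < X) F (6 * h.+1 * m.+1)%N <= D%:R * \sum_(l < L) F l.
Proof.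
move=> F0 XL HD; rewrite pair_bigA /=.
have bnd (p : 'I_X * 'I_X) : (6 * p.1.+1 * p.2.+1 <= 6 * X * X)%N.
  by rewrite leq_mul// leq_mul2l /=.
pose f (p : 'I_X * 'I_X) : 'I_L := Ordinal (leq_ltn_trans (bnd p) XL).
rewrite (partition_big f xpredT)//= mulr_sumr; apply: ler_sum => l _.
rewrite (eq_bigr (fun=> F l)); last by move=> p /eqP <-.
rewrite sumr_const -[_ *+ _]mulr_natl ler_wpM2r// ler_nat.
set A := [pred p | f p == l].
have [->//|[p0 p0A]] : #|A| = 0%N \/ exists p, p \in A.
  by have [p pA|A0] := pickP A; [right; exists p | left; exact: eq_card0].
have lE p : p \in A -> (6 * p.1.+1 * p.2.+1)%N = l by move=> /eqP <-.
have l0 : (0 < l)%N by rewrite -(lE _ p0A).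
apply: (@leq_trans (size (divisors l))); last first.
  by apply: HD; rewrite l0 -(lE _ p0A) bnd.
rewrite cardE -(size_map (fun p : 'I_X * 'I_X => p.1.+1)); apply: uniq_leq_size.
  rewrite map_inj_in_uniq ?enum_uniq// => -[h m] [h' m'].
  rewrite !mem_enum => /lE/= e1 /lE/= e2 [hh].
  have {}hh : h = h' by apply: val_inj.
  by subst; congr (_, _); apply: val_inj => /=; nia.
move=> _ /mapP[p + ->]; rewrite mem_enum => /lE e1.
rewrite -dvdn_divisors//; apply/dvdnP; exists (6 * p.2.+1)%N.
by rewrite -e1 -!mulnA [(p.1.+1 * _)%N]mulnC.
Qed.

(** Replace the sum over products by [D] times a sum over all [l <= 24 N ^ 2], cut
    it in blocks of length [q], and apply [sum_geo_le] with threshold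
    [r ^- 2]. *)
Lemma weyl_sum_minor N D r q a (t : R) :
  (0 < r)%N -> (r ^ 4 <= N)%N ->
  (forall n, (0 < n <= 24 * N ^ 3)%N -> (size (divisors n) <= D)%N) ->
  (r ^ 2 <= q)%N -> (q <= N ^ 2 * r)%N -> coprime q a ->
  `|t - a%:R / q%:R| <= (q * (N ^ 2 * r))%:R^-1 ->
  weyl_sum N.*2.+1 N.*2 t <= 910 * D%:R * N%:R ^+ 3 / r%:R.
Proof.
move=> r0 rN HD rq qY qa ta.
have N0 : (0 < N)%N by rewrite (leq_trans _ rN)// expn_gt0 r0.
have q0 : (0 < q)%N by rewrite (leq_trans _ rq)// expn_gt0 r0.
have Y0 : (0 < N ^ 2 * r)%N by rewrite muln_gt0 expn_gt0 N0.
pose L := (24 * N ^ 2 + 1)%N; pose B := (L %/ q).+1.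
have LB : (L <= B * q)%N by rewrite ltnW// ltn_ceil.
pose F l : R := geo N.*2.+1 (l%:R * t).
have F0 l : 0 <= F l by exact: geo_ge0.
have XL : (6 * N.*2 * N.*2 < L)%N by rewrite /L; nia.
apply: (le_trans (sum_products_le F0 XL (D := D) _)).
  move=> n /andP[n0 nX]; apply: HD; rewrite n0 (leq_trans nX)//; nia.
pose k : R := r%:R ^- 2.
have rR : 1 <= r%:R :> R by rewrite ler1n.
have k0 : 0 < k by rewrite invr_gt0 exprn_gt0// (lt_le_trans ltr01).
have := sum_geo_le q0 Y0 qa ta N.*2.+1 B k0.
have : \sum_(l < L) F l <= \sum_(l < B * q) F l.
  rewrite (big_ord_widen _ F LB) big_mkcond /=; apply: ler_sum => l _.
  by case: ifP.
move=> h1 h2; have {h1 h2} := le_trans h1 h2; move: (\sum_(l < L) _) => S hS.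
rewrite (_ : 910 * D%:R * N%:R ^+ 3 / r%:R = D%:R * (910 * N%:R ^+ 3 / r%:R)); last by ring.
rewrite ler_wpM2l// (le_trans hS)//.
have BL : B%:R * q%:R <= 25 * N%:R ^+ 2 + q%:R :> R.
  rewrite -natrX -!natrM -natrD ler_nat /B mulSn addnC leq_add2r.
  by rewrite (leq_trans (leq_divM _ _))// /L; nia.
have n1 : 1 <= N%:R :> R by rewrite ler1n.
have rn : r%:R ^+ 4 <= N%:R :> R by rewrite -natrX ler_nat.
have rq' : r%:R ^+ 2 <= q%:R :> R by rewrite -natrX ler_nat.
have qY' : q%:R <= N%:R ^+ 2 * r%:R :> R by rewrite -natrX -natrM ler_nat.
have K3 : N.*2.+1%:R <= 3 * N%:R :> R by rewrite -natrM ler_nat double_le3.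
have b1 : 1 <= B%:R :> R by rewrite ler1n.
rewrite natrM natrM natrX /k invrK.
move: K3 BL n1 rn rq' qY' rR b1 (ltr0n R q).
move: (B%:R : R) (q%:R : R) (N.*2.+1%:R : R) (N%:R : R) (r%:R : R).
move=> b Q K n p K3 BL n1 rn rq' qY' p1 b1; rewrite q0 => Q0.
have p0 : 0 < p by lra.
have n0 : 0 < n by lra.
have n2 : 0 < n ^+ 2 by rewrite exprn_gt0.
have n2n : n <= n ^+ 2 by rewrite expr2 ler_peMl// ltW.
have p2p : p <= p ^+ 2 by rewrite expr2 ler_peMl// ltW.
have pn : p <= n.
  by rewrite (le_trans p2p)// (le_trans _ rn)// ler_weXn2l.
have bQ : b * Q <= 26 * (n ^+ 2 * p).
  have : n ^+ 2 <= n ^+ 2 * p by rewrite ler_peMr// ltW.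
  lra.
have bp : b * p <= 26 * n ^+ 2.
  have : (b - 1) * p <= (b - 1) * Q by rewrite ler_wpM2l//; lra.
  rewrite !mulrBl !mul1r; lra.
have w : b * Q / p <= 26 * n ^+ 2 by rewrite ler_pdivrMr// -mulrA.
have z : b * Q / n ^+ 2 <= 26 * p by rewrite ler_pdivrMr// -mulrA [p * _]mulrC.
have y : b * Q * p ^+ 3 <= 26 * n ^+ 3.
  apply: (@le_trans _ _ (26 * (n ^+ 2 * p) * p ^+ 3)).
    by rewrite ler_wpM2r// exprn_ge0// ltW.
  rewrite (_ : _ * p ^+ 3 = 26 * n ^+ 2 * p ^+ 4); last by ring.
  rewrite (_ : 26 * n ^+ 3 = 26 * n ^+ 2 * n); last by ring.
  by apply: ler_wpM2l => //; rewrite mulr_ge0// ltW.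
rewrite ler_pdivlMr//.
have -> : (K * b * (1 + (2 / p ^+ 2 + 8 / (n ^+ 2 * p)) * Q) + b * Q * (2 * p ^+ 2)) * p =
    K * (b * p + 2 * (b * Q / p) + 8 * (b * Q / n ^+ 2)) + 2 * (b * Q * p ^+ 3).
  by field; rewrite !gt_eqF.
have : K * (b * p + 2 * (b * Q / p) + 8 * (b * Q / n ^+ 2)) <= 3 * n * (286 * n ^+ 2).
  apply: (@le_trans _ _ (3 * n * (b * p + 2 * (b * Q / p) + 8 * (b * Q / n ^+ 2)))).
    have b0 : 0 < b by lra.
    by apply: ler_wpM2r => //; rewrite !addr_ge0 ?mulr_ge0 ?invr_ge0 ?ltW ?mulr_gt0 ?exprn_gt0.
  by apply: ler_wpM2l; [rewrite mulr_ge0// ltW | lra].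
have -> : 3 * n * (286 * n ^+ 2) = 858 * n ^+ 3 by ring.
lra.
Qed.

(** For [d = 1] this compares the sum with the increments of [2 sqrt]; the general
    case reduces to the multiples of [d]. *)
Lemma sum_rsqrt (d X : nat) : (0 < d)%N ->
  \sum_(h < X | (d %| h.+1)%N) (Num.sqrt h.+1%:R)^-1 <= 2 * Num.sqrt X%:R / d%:R :> R.
Proof.
move=> d0; have dR : 0 < d%:R :> R by rewrite ltr0n.
have sd : 0 < Num.sqrt d%:R :> R by rewrite sqrtr_gt0.
have H : \sum_(h < X | (d %| h.+1)%N) (Num.sqrt h.+1%:R)^-1 <=
    2 * Num.sqrt (X %/ d)%:R / Num.sqrt d%:R :> R.
  elim: X => [|X IH]; first by rewrite big_ord0 div0n sqrtr0 mulr0 mul0r.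
  rewrite big_mkcond big_ord_recr /= -big_mkcond /= divnS//.
  case: ifPn => [dX|_]; last by rewrite add0n addr0.
  set k := (X %/ d)%N in IH *; rewrite add1n.
  have XE : X.+1 = (d * k.+1)%N.
    by rewrite mulnC -[LHS](divnK dX) divnS// dX.
  rewrite XE natrM sqrtrM//.
  apply: (le_trans (lerD IH (lexx _))).
  rewrite -(ler_pM2r sd) mulrDl !divfK ?gt_eqF// invfM mulrAC mulVf ?gt_eqF// mul1r.
  set u := Num.sqrt k%:R; set v := Num.sqrt k.+1%:R.
  have v0 : 0 < v by rewrite sqrtr_gt0.
  have v2 : v ^+ 2 = u ^+ 2 + 1 by rewrite !sqr_sqrtr// natr1.
  rewrite -(ler_pM2r v0) mulrDl mulVf ?gt_eqF//.
  by have := sqr_ge0 (u - v); rewrite sqrrB; lra.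
apply: (le_trans H); rewrite -[leLHS]mulrA -[leRHS]mulrA; apply: ler_wpM2l => //.
rewrite ler_pdivrMr// -[X in _ / X * _](sqr_sqrtr (ler0n R d)).
rewrite (_ : _ / _ * _ = Num.sqrt X%:R / Num.sqrt d%:R); last first.
  by field; rewrite gt_eqF.
rewrite ler_pdivlMr// -sqrtrM// ler_wsqrtr// -natrM ler_nat.
exact: leq_divM.
Qed.

Lemma divides_split (q x m : nat) : (0 < q)%N -> (q %| x * m)%N ->
  exists2 d, d \in divisors q & ((d %| x) && (q %/ d %| m))%N.
Proof.
move=> q0 qxm; exists (gcdn q x); first by rewrite -dvdn_divisors// dvdn_gcdl.
rewrite dvdn_gcdr /=.
have g0 : (0 < gcdn q x)%N by rewrite gcdn_gt0 q0.
have co : coprime (q %/ gcdn q x) (x %/ gcdn q x).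
  by rewrite /coprime -(eqn_pmul2r g0) muln_gcdl !divnK ?dvdn_gcdl ?dvdn_gcdr ?mul1n.
rewrite -(Gauss_dvdr _ co) -(dvdn_pmul2r g0) divnK ?dvdn_gcdl//.
by rewrite mulnAC divnK ?dvdn_gcdr.
Qed.

(** If [d] divides [6 h], then [d / gcdn d 6] divides [h]. *)
Lemma sum_rsqrt6 (d X : nat) : (0 < d)%N ->
  \sum_(h < X | (d %| 6 * h.+1)%N) (Num.sqrt h.+1%:R)^-1 <=
    12 * Num.sqrt X%:R / d%:R :> R.
Proof.
move=> d0; pose g := gcdn d 6; pose d' := (d %/ g)%N.
have g0 : (0 < g)%N by rewrite gcdn_gt0 d0.
have dE : (d' * g)%N = d by rewrite divnK// dvdn_gcdl.
have d'0 : (0 < d')%N by move: d0; rewrite -dE muln_gt0 => /andP[].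
have g6 : (g <= 6)%N by rewrite dvdn_leq// dvdn_gcdr.
apply: (@le_trans _ _ (\sum_(h < X | (d' %| h.+1)%N) (Num.sqrt h.+1%:R)^-1)).
  rewrite big_mkcond [leRHS]big_mkcond; apply: ler_sum => h _.
  case: (boolP (d %| 6 * h.+1)%N) => [dh|_]; last first.
    by case: ifP => // _; rewrite invr_ge0 sqrtr_ge0.
  suff -> : (d' %| h.+1)%N by [].
  have co : coprime d' (6 %/ g).
    by rewrite /coprime -(eqn_pmul2r g0) muln_gcdl dE divnK ?mul1n// dvdn_gcdr.
  by rewrite -(Gauss_dvdr _ co) -(dvdn_pmul2r g0) dE mulnAC divnK// dvdn_gcdr.
apply: (le_trans (sum_rsqrt X d'0)).
rewrite ler_pdivrMr ?ltr0n// mulrAC ler_pdivlMr ?ltr0n//.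
rewrite -dE natrM; have := ler_wpM2r (sqrtr_ge0 X%:R) (ler0n R d').
have : g%:R <= 6 :> R by rewrite ler_nat.
have s0 : 0 <= Num.sqrt X%:R * d'%:R :> R by rewrite mulr_ge0 ?sqrtr_ge0.
move=> /(ler_wpM2r s0) + _.
lra.
Qed.

(** If [q] divides [6 h m], then some divisor [d] of [q] divides [6 h] while its
    cofactor divides [m]; for each [d] the double sum factors. *)
Lemma sum_rsqrt_pairs (q X : nat) : (0 < q)%N ->
  \sum_(h < X) \sum_(m < X | (q %| 6 * h.+1 * m.+1)%N)
     (Num.sqrt h.+1%:R)^-1 * (Num.sqrt m.+1%:R)^-1 <=
    (size (divisors q))%:R * (24 * X%:R / q%:R) :> R.
Proof.
move=> q0; pose s n : R := (Num.sqrt n.+1%:R)^-1.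
have s0 n : 0 <= s n by rewrite invr_ge0 sqrtr_ge0.
apply: (@le_trans _ _ (\sum_(d <- divisors q)
    (\sum_(h < X | (d %| 6 * h.+1)%N) s h) * (\sum_(m < X | (q %/ d %| m.+1)%N) s m))).
  rewrite (eq_bigr (fun d => \sum_(h < X) \sum_(m < X)
      if (d %| 6 * h.+1)%N && (q %/ d %| m.+1)%N then s h * s m else 0)); last first.
    move=> d _; rewrite big_mkcond mulr_suml; apply: eq_bigr => h _.
    rewrite big_mkcond mulr_sumr; apply: eq_bigr => m _.
    by case: ifP => _; case: ifP => _; rewrite ?mul0r ?mulr0.
  rewrite exchange_big; apply: ler_sum => h _.
  rewrite exchange_big big_mkcond; apply: ler_sum => m _ /=.
  have c0 (d : nat) : 0 <= if (d %| 6 * h.+1)%N && (q %/ d %| m.+1)%N then s h * s m else 0.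
    by case: ifP => // _; rewrite mulr_ge0.
  case: ifPn => [qhm|_]; last by apply: sumr_ge0 => d _.
  have [d dq dd] := divides_split q0 qhm.
  rewrite (bigD1_seq d dq (divisors_uniq q))/= dd lerDl.
  by apply: sumr_ge0 => e _.
rewrite (_ : _ * _ = \sum_(d <- divisors q) 24 * X%:R / q%:R); last first.
  by rewrite big_const_seq count_predT iter_addr_0 mulr_natl.
rewrite big_seq [leRHS]big_seq; apply: ler_sum => d.
rewrite -dvdn_divisors// => dq.
have d0 : (0 < d)%N by rewrite (dvdn_gt0 q0).
have e0 : (0 < q %/ d)%N by rewrite divn_gt0// dvdn_leq.
have P0 (P : pred nat) : 0 <= \sum_(h < X | P h) s h by apply: sumr_ge0.
apply: (le_trans (ler_pM (P0 (fun h => d %| 6 * h.+1)%N) (P0 (fun m => q %/ d %| m.+1)%N)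
  (sum_rsqrt6 X d0) (sum_rsqrt X e0))).
have -> : q%:R = (q %/ d)%:R * d%:R :> R by rewrite -natrM divnK.
have -> : 24 * X%:R = 24 * (Num.sqrt X%:R * Num.sqrt X%:R) :> R.
  by rewrite -expr2 sqr_sqrtr.
rewrite le_eqVlt; apply/orP; left; apply/eqP; field.
by rewrite !pnatr_eq0 -!lt0n d0 e0.
Qed.

(** Write [b = t - a / q]. If [q] does not divide [l = 6 h m], then [l a / q] is at
    least [1 / q] away from the integers and [l b] is much smaller, so the term is
    [O(q)]. If [q] divides [l], then the distance from [l t] to the integers is
    exactly [l |b|], and the term, at most [min (3 N, 1 / (l |b|))], is at most
    [6 N ^ 2 / sqrt (h m L)]; the terms of this kind are summed by
    [sum_rsqrt_pairs]. *)
Lemma weyl_sum_major N r q a (t L : R) :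
  (192 <= r)%N -> (r ^ 4 <= N)%N -> (0 < q)%N ->
  (q <= r ^ 2)%N -> coprime q a ->
  `|t - a%:R / q%:R| <= (q * (N ^ 2 * r))%:R^-1 ->
  L = Num.max 1 (N%:R ^+ 3 * `|t - a%:R / q%:R|) ->
  weyl_sum N.*2.+1 N.*2 t <= 8 * N%:R ^+ 3 / r%:R +
    288 * N%:R ^+ 3 * (size (divisors q))%:R / (q%:R * Num.sqrt L).
Proof.
move=> r192 rN q0 qr qa ta LE; set b := t - a%:R / q%:R in ta LE.
have r0 : (0 < r)%N by rewrite (leq_trans _ r192).
have N0 : (0 < N)%N by rewrite (leq_trans _ rN)// expn_gt0 r0.
have Y0 : (0 < N ^ 2 * r)%N by rewrite muln_gt0 expn_gt0 N0.
have L1 : 1 <= L by rewrite LE le_max lexx.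
have L0 : 0 < L by rewrite (lt_le_trans ltr01).
have sL : 0 < Num.sqrt L by rewrite sqrtr_gt0.
have rR : 192 <= r%:R :> R by rewrite ler_nat.
have qR : 1 <= q%:R :> R by rewrite ler1n.
have nR : 1 <= N%:R :> R by rewrite ler1n.
pose K := N.*2.+1.
have K3 : K%:R <= 3 * N%:R :> R by rewrite -natrM ler_nat double_le3.
have small (h m : 'I_N.*2) : (6 * h.+1 * m.+1 <= 24 * N ^ 2)%N.
  rewrite -mulnA (_ : 24 * N ^ 2 = 6 * (4 * N ^ 2))%N; last by rewrite mulnA.
  by rewrite leq_mul2l leq_mul_double.
have qr0 : 0 < q%:R * r%:R :> R by apply: mulr_gt0; lra.
have lY l : (l <= 24 * N ^ 2)%N -> l%:R / (q * (N ^ 2 * r))%:R <= 24 / (q%:R * r%:R) :> R.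
  move=> lN; have qY0 : 0 < (q * (N ^ 2 * r))%:R :> R by rewrite ltr0n muln_gt0 q0.
  rewrite ler_pdivrMr// mulrAC ler_pdivlMr// -!natrM ler_nat.
  by rewrite [(q * (N ^ 2 * r))%N]mulnCA [leqRHS]mulnA leq_mul.
have off l : (l <= 24 * N ^ 2)%N -> ~~ (q %| l)%N -> geo K (l%:R * t) <= 2 * q%:R.
  move=> lN nql.
  have c1 : (1 <= minn (l * a %% q) (q - l * a %% q))%N.
    rewrite leq_min subn_gt0 ltn_pmod// andbT lt0n -/(_ %| _)%N Gauss_dvdl//.
  have := @chord_frac_ge R _ _ (ltn_pmod (l * a) q0); rewrite -chord_residue// => h1.
  have := chord_mul_approx ta l; rewrite ?q0 ?Y0// => h2.
  have h3 := lY l lN.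
  have : 24 / (q%:R * r%:R) <= 8^-1 / q%:R :> R.
    by rewrite invfM mulrCA [leRHS]mulrC ler_wpM2l ?invr_ge0// ler_pdivrMr; lra.
  have : (minn (l * a %% q) (q - l * a %% q))%:R >= 1 :> R by rewrite ler1n.
  move=> c1R h4; have h5 : 2 / q%:R <= chord (l%:R * (a%:R / q%:R) : R).
    by rewrite ler_pdivrMr; lra.
  have h6 : q%:R^-1 <= chord (l%:R * t) by lra.
  have := ler_wpM2l (geo_ge0 K (l%:R * t)) h6.
  move=> /le_trans /(_ (geo_chord K (l%:R * t))).
  by rewrite ler_pdivrMr//; lra.
have on (h m : 'I_N.*2) : (q %| 6 * h.+1 * m.+1)%N ->
    geo K ((6 * h.+1 * m.+1)%:R * t) <=
    6 * N%:R ^+ 2 / Num.sqrt L * ((Num.sqrt h.+1%:R)^-1 * (Num.sqrt m.+1%:R)^-1).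
  move=> ql; set l := (6 * h.+1 * m.+1)%N.
  set G := geo _ _; have G0 : 0 <= G by exact: geo_ge0.
  have tE : l%:R * t = l%:R * b + (l %/ q * a)%:Z%:~R.
    have -> : (l %/ q * a)%:Z%:~R = l%:R * (a%:R / q%:R) :> R.
      have lE : l%:R = (l %/ q)%:R * q%:R :> R by rewrite -natrM divnK.
      rewrite -pmulrn natrM lE.
      by field; rewrite pnatr_eq0 -lt0n.
    by rewrite /b; ring.
  have lb : `|l%:R * b| <= 24 / (q%:R * r%:R).
    rewrite normrM ger0_norm// (le_trans _ (lY l (small h m)))// ler_wpM2l//.
  have l2 : `|l%:R * b| <= 2^-1.
    rewrite (le_trans lb)// ler_pdivrMr//.
    by have := ler_pM _ _ qR rR; lra.
  have c2 : 2 * (l%:R * `|b|) <= chord (l%:R * t).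
    by rewrite tE chordDint -[X in X * `|b|]ger0_norm// -normrM chord_ge.
  have Gl : G * (l%:R * `|b|) <= 1.
    by have := ler_wpM2l G0 c2; have := geo_chord K (l%:R * t); rewrite -/G; lra.
  have GK : G <= 3 * N%:R by rewrite (le_trans (geo_le _ _)).
  have hm0 : 0 < Num.sqrt h.+1%:R :> R by rewrite sqrtr_gt0.
  have mm0 : 0 < Num.sqrt m.+1%:R :> R by rewrite sqrtr_gt0.
  rewrite -invfM -mulrA -invfM ler_pdivlMr ?mulr_gt0//.
  have rhs0 : 0 <= 6 * N%:R ^+ 2 :> R by rewrite mulr_ge0 ?exprn_ge0.
  have lhs0 : 0 <= G * (Num.sqrt L * (Num.sqrt h.+1%:R * Num.sqrt m.+1%:R)).
    by rewrite !mulr_ge0 ?sqrtr_ge0.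
  rewrite -(ler_pXn2r (_ : 0 < 2)%N)//.
  have -> : (G * (Num.sqrt L * (Num.sqrt h.+1%:R * Num.sqrt m.+1%:R))) ^+ 2 =
      G ^+ 2 * (h.+1%:R * m.+1%:R) * L.
    by rewrite !exprMn !sqr_sqrtr ?ltW//; ring.
  have -> : (6 * N%:R ^+ 2) ^+ 2 = 36 * N%:R ^+ 4 :> R by ring.
  rewrite /l !natrM in Gl.
  have hm : h.+1%:R * m.+1%:R <= 4 * N%:R ^+ 2 :> R.
    by rewrite -natrX -!natrM ler_nat leq_mul_double.
  move: hm Gl; set P := h.+1%:R * m.+1%:R => hm Gl.
  have P0 : 0 <= P by exact: mulr_ge0.
  have [Lb|/ltW Lb] := leP 1 (N%:R ^+ 3 * `|b|).
    rewrite LE (max_r Lb).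
    have -> : G ^+ 2 * P * (N%:R ^+ 3 * `|b|) =
        6^-1 * (G * N%:R ^+ 3) * (G * (6 * h.+1%:R * m.+1%:R * `|b|)).
      by rewrite /P; field.
    apply: (@le_trans _ _ (6^-1 * (3 * N%:R * N%:R ^+ 3) * 1)).
      apply: ler_pM => //; rewrite ?mulr_ge0 ?exprn_ge0 ?invr_ge0//.
      by rewrite ler_wpM2l ?invr_ge0// ler_wpM2r ?exprn_ge0.
    by have : 0 <= N%:R ^+ 4 :> R; [exact: exprn_ge0 | rewrite mulr1 -mulrA -exprS; lra].
  rewrite LE (max_l Lb) mulr1 (_ : 36 * N%:R ^+ 4 = (3 * N%:R) ^+ 2 * (4 * N%:R ^+ 2)); last by ring.
  by apply: ler_pM => //; rewrite ?exprn_ge0// lerXn2r ?nnegrE ?mulr_ge0.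
apply: (@le_trans _ _ (\sum_(h < N.*2) \sum_(m < N.*2) (2 * q%:R +
    if (q %| 6 * h.+1 * m.+1)%N then 6 * N%:R ^+ 2 / Num.sqrt L *
      ((Num.sqrt h.+1%:R)^-1 * (Num.sqrt m.+1%:R)^-1) else 0))).
  apply: ler_sum => h _; apply: ler_sum => m _; case: ifPn => ql.
    by rewrite (le_trans (on h m ql))// ler_wpDl// mulr_ge0.
  by rewrite addr0 off.
under eq_bigr do rewrite big_split /= sumr_const card_ord -big_mkcond -mulr_sumr.
rewrite big_split /= sumr_const card_ord -mulr_sumr; apply: lerD.
  rewrite -mulrnA -[_ *+ (_ * _)]mulr_natr ler_pdivlMr; last lra.
  rewrite -[N%:R ^+ 3]natrX -!natrM ler_nat.
  have : (q * r <= N)%N.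
    rewrite (leq_trans _ rN)// (@leq_trans (r ^ 2 * r)%N) ?leq_mul2r ?qr ?orbT//.
    by rewrite -expnSr leq_pexp2l.
  rewrite (_ : 2 * q * (N.*2 * N.*2) * r = 8 * N ^ 2 * (q * r))%N; last first.
    by rewrite -mulnn -!muln2; lia.
  have -> : (8 * N ^ 3 = 8 * N ^ 2 * N)%N by rewrite -mulnA -expnSr.
  exact: leq_mul.
apply: (le_trans (ler_wpM2l _ (sum_rsqrt_pairs N.*2 q0))).
  by rewrite divr_ge0 ?sqrtr_ge0// mulr_ge0 ?exprn_ge0.
rewrite -muln2 natrM le_eqVlt; apply/orP; left; apply/eqP; field.
by rewrite gt_eqF// gt_eqF//; lra.
Qed.

End WeylSum.

(** * Pointwise bound for the kernel *)

Section KernelPointwise.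
Variable R : realType.

Definition kernel (N : nat) (x t : R) : R[i] :=
  \sum_(k < N.*2.+1) e (x * (k%:R - N%:R) + t * (k%:R - N%:R) ^+ 3).

Lemma cmod_kernel_le N x t : cmod (kernel N x t) <= N.*2.+1%:R.
Proof.
rewrite (le_trans (ler_cmod_sum _ _ _))//.
by under eq_bigr do rewrite cmod_e; rewrite sumr_const card_ord.
Qed.

Lemma kernel_weyl_sum N x t : (0 < N)%N ->
  cmod (kernel N x t) ^+ 4 <=
    24 * N%:R * (18 * N%:R ^+ 2 + weyl_sum N.*2.+1 N.*2 t).
Proof.
move=> N0; set K := N.*2.+1.
have K3 : K%:R <= 3 * N%:R :> R by rewrite -natrM ler_nat /K; lia.
have K2 : K%:R ^+ 2 <= 9 * N%:R ^+ 2 :> R.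
  by rewrite (_ : 9 * N%:R ^+ 2 = (3 * N%:R) ^+ 2) ?lerXn2r ?nnegrE ?mulr_ge0//; ring.
apply: (le_trans (kernel_fourth _ _ _ _)).
have S0 : 0 <= weyl_sum K N.*2 t.
  by apply: sumr_ge0 => h _; apply: sumr_ge0 => m _; exact: geo_ge0.
have H : \sum_(h < K) \sum_(m < K) geo K ((6 * h * m)%:R * t) <=
    18 * N%:R ^+ 2 + weyl_sum K N.*2 t.
  rewrite big_ord_recl.
  have h1 : \sum_(m < K) geo K ((6 * (@ord0 N.*2 : 'I_K) * m)%:R * t) <= K%:R ^+ 2.
    apply: (@le_trans _ _ (\sum_(m < K) K%:R)); first by apply: ler_sum => m _; exact: geo_le.
    by rewrite sumr_const card_ord expr2 mulr_natl.
  have h2 : \sum_(h < N.*2) \sum_(m < K) geo K ((6 * lift (@ord0 N.*2) h * m)%:R * t) <=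
      K%:R ^+ 2 + weyl_sum K N.*2 t.
    apply: (@le_trans _ _ (\sum_(h < N.*2) (K%:R + \sum_(m < N.*2) geo K ((6 * h.+1 * m.+1)%:R * t)))).
      by apply: ler_sum => h _; rewrite big_ord_recl lerD// geo_le.
    rewrite big_split /= lerD2r sumr_const card_ord -[_ *+ N.*2]mulr_natl expr2 ler_wpM2r//.
    by rewrite ler_nat /K; lia.
  lra.
have h8 : 8 * K%:R <= 24 * N%:R :> R by lra.
apply: ler_pM => //.
by apply: sumr_ge0 => h _; apply: sumr_ge0 => m _; exact: geo_ge0.
Qed.

(** Dirichlet's theorem puts [t] near some [a / q]; for [q >= r ^ 2] with
    [r] about [N ^ (1/4)] Weyl's inequality gives the first term, and for
    smaller [q] the multiples [6 h m t] are near integers only when [q]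
    divides [6 h m], which gives the second. *)
Lemma kernel_pointwise : exists2 C : R, 0 < C &
  forall N (x t : R), (0 < N)%N -> 0 <= t <= 1 ->
  exists q a : nat, [/\ (0 < q <= N)%N, (a <= q)%N &
    cmod (kernel N x t) ^+ 4 <= C * N%:R `^ (4 - 8^-1) +
      C * N%:R ^+ 4 * (q%:R `^ (- (9 / 10)) /
        Num.sqrt (Num.max 1 (N%:R ^+ 3 * `|t - a%:R / q%:R|)))].
Proof.
have e8 : 0 < 8^-1 :> R by rewrite invr_gt0.
have e10 : 0 < 10^-1 :> R by rewrite invr_gt0.
have [CD CD0 HD] := divisor_sup e8.
have [k Hk] := root_bound 1 e10.
have [C0 HC0] := divisors_bound k.
have [Cq Cq0 Hq] := Hk C0.
have {k Hk C0 HC0}Hq q : (0 < q)%N -> (size (divisors q))%:R <= Cq * q%:R `^ 10^-1.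
  by move=> q0; apply: Hq => //; rewrite expn1 HC0.
have [c c0 c192] : exists2 c : R, 0 < c & 192 ^+ 4 = c.
  by exists (192 ^+ 4); rewrite ?exprn_gt0.
pose C := 81 * 16 * c + 24 * (18 + 1820 * CD + 16) + 24 * 288 * Cq.
exists C => [|N x t N0 /andP[t0 t1]]; first by rewrite /C; lra.
have NR : 1 <= N%:R :> R by rewrite ler1n.
have N0R : 0 < N%:R :> R by rewrite ltr0n.
(* [r] is the integer part of the fourth root of [N]. *)
have [r /andP[r0 rN] rmax] : exists2 r, (0 < r)%N && (r ^ 4 <= N)%N & (N < r.+1 ^ 4)%N.
  have ex : exists r, (r ^ 4 <= N)%N by exists 0%N.
  have bd r : (r ^ 4 <= N)%N -> (r <= N)%N.
    by apply: leq_trans; case: r => // r; rewrite -[leqLHS]expn1 leq_pexp2l.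
  have [r rN rm] := ex_maxnP ex bd; exists r; last by rewrite ltnNge; apply/negP => /rm; rewrite ltnn.
  by rewrite rN andbT; apply: rm; rewrite exp1n.
have N16 : (N <= 16 * r ^ 4)%N.
  apply: (@leq_trans (r.+1 ^ 4)); first exact: ltnW.
  rewrite (_ : 16 * r ^ 4 = (2 * r) ^ 4)%N ?leq_exp2r//; first lia.
  by rewrite expnMn.
pose u : R := N%:R `^ (3 - 8^-1).
have u0 : 0 <= u by exact: powR_ge0.
have addN (y z w : R) : y + z = w -> N%:R `^ y * N%:R `^ z = N%:R `^ w.
  by move=> <-; rewrite powRD//; apply/implyP => _; rewrite gt_eqF.
have uE : N%:R `^ (4 - 8^-1) = N%:R * u.
  rewrite /u -[X in _ = X * _](powRr1 (ler0n R N)) (addN _ _ (4 - 8^-1))//.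
  by ring.
have Nu : N%:R ^+ 2 <= u by rewrite -powR_mulrn// ler_powR//; lra.
have r0R : 0 < r%:R :> R by rewrite ltr0n.
have r4 : N%:R `^ 4^-1 <= 2 * r%:R :> R.
  rewrite -(ler_pXn2r (_ : 0 < 4)%N) ?nnegrE ?powR_ge0 ?mulr_ge0//.
  rewrite -powR_mulrn ?powR_ge0// -powRrM mulVf ?pnatr_eq0// powRr1//.
  by rewrite exprMn -!natrX -natrM ler_nat.
have uN : N%:R ^+ 3 = u * N%:R `^ 8^-1.
  by rewrite -powR_mulrn// (addN _ _ 3)//; ring.
have ru : N%:R ^+ 3 / r%:R * N%:R `^ 8^-1 <= 2 * u.
  rewrite mulrAC ler_pdivrMr// uN -mulrA (addN _ _ 4^-1); last by field.
  by rewrite mulrC mulrAC ler_wpM2r.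
have ru' : N%:R ^+ 3 / r%:R <= 2 * u.
  apply: le_trans ru; rewrite ler_peMr ?divr_ge0 ?exprn_ge0//.
  by rewrite -[leLHS](powRr0 N%:R) ler_powR.
have C_u : 0 <= N%:R * u by exact: mulr_ge0.
have rest0 q a : 0 <= C * N%:R ^+ 4 * (q%:R `^ (- (9 / 10)) /
        Num.sqrt (Num.max 1 (N%:R ^+ 3 * `|t - a%:R / q%:R|))).
  rewrite mulr_ge0 ?divr_ge0 ?sqrtr_ge0 ?powR_ge0// mulr_ge0 ?exprn_ge0//.
  by rewrite /C; lra.
have Cq_u : 0 <= Cq * (N%:R * u) by rewrite mulr_ge0// ltW.
have CD_u : 0 <= CD * (N%:R * u) by rewrite mulr_ge0// ltW.
(* For bounded [N] the trivial bound suffices. *)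
have [r192|r192] := ltnP r 192.
  exists 1%N, 0%N; split => //; apply: ler_wpDr; first exact: rest0.
  have h1 : cmod (kernel N x t) ^+ 4 <= (3 * N%:R) ^+ 4.
    rewrite lerXn2r ?nnegrE ?cmod_ge0 ?mulr_ge0// (le_trans (cmod_kernel_le _ _ _))//.
    by rewrite -natrM ler_nat double_le3.
  apply: (le_trans h1); rewrite uE.
  have -> : (3 * N%:R) ^+ 4 = 81 * N%:R * N%:R ^+ 3 :> R by ring.
  have h2 : N%:R `^ 8^-1 <= 16 * c.
    apply: (@le_trans _ _ (N%:R : R)).
      by rewrite -[leRHS](powRr1 (ler0n R N)) ler_powR//; lra.
    apply: (@le_trans _ _ (16 * r%:R ^+ 4)); first by rewrite -natrX -natrM ler_nat.
    by rewrite ler_wpM2l// -c192 lerXn2r ?nnegrE// ler_nat ltnW.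
  have h3 : N%:R * u * N%:R `^ 8^-1 <= N%:R * u * (16 * c) by rewrite ler_wpM2l.
  have -> : 81 * N%:R * N%:R ^+ 3 = 81 * (N%:R * u * N%:R `^ 8^-1) by rewrite uN; ring.
  move: h3 C_u Cq_u CD_u; rewrite /C; set w := N%:R * u => h3 ? ? ?.
  lra.
have [q [a [/andP[q0 qY] qa ta]]] := @dirichlet R t (N ^ 2 * r) t0
  ltac:(by rewrite muln_gt0 expn_gt0 N0).
have W := kernel_weyl_sum x t N0.
have final S T : cmod (kernel N x t) ^+ 4 <= 24 * N%:R * (18 * N%:R ^+ 2 + S) ->
    S <= (1820 * CD + 16) * u + T -> 0 <= T ->
    cmod (kernel N x t) ^+ 4 <= C * (N%:R * u) + 24 * N%:R * T.
  move=> h hS T0; apply: (le_trans h).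
  apply: (@le_trans _ _ (24 * N%:R * ((18 + 1820 * CD + 16) * u + T))).
    by rewrite ler_wpM2l ?mulr_ge0//; lra.
  rewrite mulrDr lerD2r /C.
  move: C_u Cq_u CD_u; set w := N%:R * u => *.
  have -> : 24 * N%:R * ((18 + 1820 * CD + 16) * u) = 24 * (18 + 1820 * CD + 16) * w.
    by rewrite /w; ring.
  have : 0 <= c * w by rewrite mulr_ge0// ltW.
  lra.
have [rq|rq] := leqP (r ^ 2) q.
  exists 1%N, 0%N; split => //; apply: ler_wpDr; first exact: rest0.
  have [D [D0 D_ge DN]] := HD N N0.
  have S := weyl_sum_minor r0 rN D_ge rq qY qa ta.
  rewrite uE -[leRHS]addr0 -[X in _ + X](mulr0 (24 * N%:R)).
  apply: final W _ _ => //; rewrite addr0 (le_trans S)//.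
  have h1 : N%:R ^+ 3 / r%:R * D%:R <= N%:R ^+ 3 / r%:R * (CD * N%:R `^ 8^-1).
    by rewrite ler_wpM2l// divr_ge0// exprn_ge0.
  have h2 : CD * (N%:R ^+ 3 / r%:R * N%:R `^ 8^-1) <= CD * (2 * u).
    by rewrite ler_wpM2l// ltW.
  have -> : 910 * D%:R * N%:R ^+ 3 / r%:R = 910 * (N%:R ^+ 3 / r%:R * D%:R) :> R by ring.
  lra.
exists q, a; split.
- by rewrite q0 (leq_trans (ltnW rq))// (leq_trans _ rN)// leq_pexp2l.
- have q0R : 0 < q%:R :> R by rewrite ltr0n.
  have : `|a%:R - t * q%:R| < 1.
    have -> : a%:R - t * q%:R = - ((t - a%:R / q%:R) * q%:R).
      by rewrite mulrBl divfK ?gt_eqF// opprB.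
    rewrite normrN normrM [`|q%:R|]ger0_norm//.
    rewrite (le_lt_trans (ler_wpM2r _ ta))// natrM invfM mulrAC mulVf ?gt_eqF// mul1r.
    rewrite invf_lt1 ?ltr0n ?ltr1n; last by rewrite muln_gt0 expn_gt0 N0 r0.
    have r1 : (1 < r)%N by exact: ltn_trans r192.
    by rewrite (leq_trans r1)// leq_pmull// expn_gt0 N0.
  rewrite ltr_norml => /andP[_ h].
  have h' : t * q%:R <= q%:R by rewrite ler_piMl.
  by rewrite -ltnS -(ltr_nat R) -natr1; lra.
have S := weyl_sum_major r192 rN q0 (ltnW rq) qa ta erefl.
set L := Num.max _ _ in S *.
have L0 : 0 < L by rewrite lt_max ltr01.
have sL : 0 < Num.sqrt L by rewrite sqrtr_gt0.
have q0R : 0 < q%:R :> R by rewrite ltr0n.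
pose P := q%:R `^ (- (9 / 10)) / Num.sqrt L.
have P0 : 0 <= P by apply: divr_ge0; [exact: powR_ge0 | exact: ltW].
have N3 : 0 <= 288 * N%:R ^+ 3 :> R by apply: mulr_ge0; [exact: ler0n | exact: exprn_ge0].
pose T := 288 * N%:R ^+ 3 * (Cq * P).
have T0 : 0 <= T by apply: mulr_ge0 => //; apply: mulr_ge0 => //; exact: ltW.
apply: (le_trans (final _ T W _ T0)).
  apply: (le_trans S); apply: lerD.
    have -> : 8 * N%:R ^+ 3 / r%:R = 8 * (N%:R ^+ 3 / r%:R) :> R by ring.
    have : 0 <= CD * u by rewrite mulr_ge0// ltW.
    lra.
  rewrite /T /P -[leLHS]mulrA; apply: ler_wpM2l => //.
  rewrite invfM [leLHS]mulrA [leRHS]mulrA ler_wpM2r ?invr_ge0 ?sqrtr_ge0//.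
  rewrite ler_pdivrMr// (le_trans (Hq q q0))// -mulrA; apply: ler_wpM2l; first exact: ltW.
  rewrite -[X in _ <= _ * X](powRr1 (ltW q0R)) -powRD; last first.
    by apply/implyP => _; rewrite gt_eqF.
  by rewrite (_ : - (9 / 10) + 1 = 10^-1)//; field.
rewrite uE; apply: lerD => //.
rewrite -/P /T.
have -> : 24 * N%:R * (288 * N%:R ^+ 3 * (Cq * P)) = 24 * 288 * Cq * (N%:R ^+ 4 * P) by ring.
rewrite -[leRHS]mulrA; apply: ler_wpM2r; first by rewrite mulr_ge0// exprn_ge0.
rewrite /C; clear -c0 CD0 Cq0.
lra.
Qed.

End KernelPointwise.

(** * The twelfth moment of the kernel *)

Section KernelMoment.
Variable R : realType.

(** Compare with the increments of [- 4 / m `^ 4^-1], a primitive of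
    [m `^ (- (5 / 4))]. *)
Lemma sum_powR54 n : \sum_(i < n) i.+1%:R `^ (- (5 / 4)) <= 5 :> R.
Proof.
suff H m : \sum_(i < m.+1) i.+1%:R `^ (- (5 / 4)) <= 5 - 4 / m.+1%:R `^ 4^-1 :> R.
  case: n => [|n]; first by rewrite big_ord0.
  by rewrite (le_trans (H n))// gerBl divr_ge0// powR_ge0.
elim: m => [|m IH].
  by rewrite big_ord1 !powR1 divr1; lra.
rewrite big_ord_recr /=; apply: (le_trans (lerD IH (lexx _))).
set u := m.+1%:R `^ 4^-1; set v := m.+2%:R `^ 4^-1.
have u0 : 0 < u by rewrite powR_gt0.
have v0 : 0 < v by rewrite powR_gt0.
have p4 k : (k.+1%:R `^ 4^-1) ^+ 4 = k.+1%:R :> R.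
  by rewrite -powR_mulrn ?powR_ge0// -powRrM mulVf ?pnatr_eq0// powRr1.
have v4 : v ^+ 4 = u ^+ 4 + 1 by rewrite !p4 natr1.
have uv : u <= v by rewrite ge0_ler_powR ?nnegrE// ?ler_nat// invr_ge0.
have -> : m.+2%:R `^ (- (5 / 4)) = v ^- 5.
  rewrite powRN /v -powR_mulrn ?powR_ge0// -powRrM.
  by congr (_ `^ _)^-1; field.
have H : 1 <= 4 * v ^+ 3 * (v - u).
  rewrite [leLHS](_ : 1 = (v ^+ 3 + v ^+ 2 * u + v * u ^+ 2 + u ^+ 3) * (v - u)); last first.
    by rewrite -[LHS](addrK (u ^+ 4)) [1 + _]addrC -v4; ring.
  have vu : 0 <= v - u by lra.
  apply: ler_wpM2r => //.
  have h2 : u ^+ 2 <= v ^+ 2 by rewrite lerXn2r ?nnegrE// ltW.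
  have h3 : u ^+ 3 <= v ^+ 3 by rewrite lerXn2r ?nnegrE// ltW.
  have h4 : v ^+ 2 * u <= v ^+ 2 * v by rewrite ler_wpM2l// sqr_ge0.
  have h5 : v * u ^+ 2 <= v * v ^+ 2 by rewrite ler_wpM2l// ltW.
  clear -h3 h4 h5; lra.
have -> : 5 - 4 / v = 5 - 4 / u + 4 * (v - u) / (u * v).
  by field; rewrite !gt_eqF.
rewrite lerD2l ler_pdivlMr ?mulr_gt0// mulrC ler_pdivrMr ?exprn_gt0//.
apply: (@le_trans _ _ (v * v)); first by rewrite ler_wpM2r// ltW.
have -> : 4 * (v - u) * v ^+ 5 = v * v * (4 * v ^+ 3 * (v - u)) by ring.
by rewrite ler_peMr// mulr_ge0// ltW.
Qed.

Definition bump (y : R) : R := Num.max 1 y `^ (- (5 / 4)).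

Lemma bump_ge0 y : 0 <= bump y. Proof. exact: powR_ge0. Qed.

Lemma bump_le y z : y <= z -> bump z <= bump y.
Proof.
move=> yz; rewrite /bump !powRN lef_pV2 ?posrE ?powR_gt0 ?lt_max ?ltr01//.
have m0 x : 0 <= Num.max 1 x :> R by rewrite le_max ler01.
apply: ge0_ler_powR; rewrite ?nnegrE ?m0//.
by rewrite ge_max !le_max lexx yz orbT.
Qed.

Lemma sum_bump n : \sum_(i < n) bump i%:R <= 6.
Proof.
case: n => [|n]; first by rewrite big_ord0.
rewrite big_ord_recl (_ : 6 = 1 + 5 :> R)//.
apply: lerD; first by rewrite /bump (max_l ler01) powR1.
apply: le_trans (sum_powR54 n); apply: ler_sum => i _.
by rewrite /bump /= max_r// ler1n.
Qed.

(** There are at most [2 K] points [k] for each value of the integer part of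
    [|k - b| / K]. *)
Lemma sum_bump_scaled (N3 K b : nat) : (0 < K)%N -> (b <= N3 * K)%N ->
  \sum_(k < N3 * K) bump (`|k%:R - b%:R| / K%:R) <= 12 * K%:R.
Proof.
move=> K0 bQ; set Q := (N3 * K)%N in bQ *.
have KR : 0 < K%:R :> R by rewrite ltr0n.
have tot n : \sum_(i < n * K) bump (i%:R / K%:R) <= 6 * K%:R.
  rewrite -(big_mkord xpredT (fun i => bump (i%:R / K%:R))) big_nat_mul.
  apply: (@le_trans _ _ (\sum_(0 <= i < n) K%:R * bump i%:R)); last first.
    by rewrite -mulr_sumr big_mkord mulrC ler_wpM2r ?sum_bump// ltW.
  apply: ler_sum => i _; rewrite mulSn -{1}[(i * K)%N]add0n big_addn addnK.
  have -> : K%:R * bump i%:R = \sum_(j < K) bump i%:R.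
    by rewrite sumr_const card_ord [LHS]mulr_natl.
  rewrite big_mkord; apply: ler_sum => j _.
  by apply: bump_le; rewrite ler_pdivlMr// -natrM ler_nat leq_addl.
pose F (i : nat) : R := bump (i%:R / K%:R).
have F0 i : 0 <= F i by exact: bump_ge0.
have mono n m : (n <= m)%N -> \sum_(i < n) F i <= \sum_(i < m) F i.
  move=> nm; rewrite (big_ord_widen _ F nm) big_mkcond /=.
  by apply: ler_sum => i _; case: ifP.
have -> : \sum_(k < Q) bump (`|k%:R - b%:R| / K%:R) =
    \sum_(k < b) F k.+1 + \sum_(i < Q - b) F i.
  rewrite -(big_mkord xpredT (fun k => bump (`|k%:R - b%:R| / K%:R))).
  rewrite (big_cat_nat (n := b))//=; congr (_ + _).
    rewrite big_mkord (reindex_inj rev_ord_inj) /=; apply: eq_bigr => k _.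
    rewrite /F natrB//; have -> : b%:R - k.+1%:R - b%:R = - k.+1%:R :> R by ring.
    by rewrite normrN ger0_norm.
  rewrite -{1}[b]add0n big_addn big_mkord; apply: eq_bigr => k _.
  by rewrite /F natrD addrK ger0_norm.
apply: (@le_trans _ _ (6 * K%:R + 6 * K%:R)); last by lra.
apply: lerD; last first.
  by apply: le_trans (tot N3); apply: mono; rewrite leq_subr.
apply: le_trans (tot N3.+1).
apply: (@le_trans _ _ (\sum_(i < b.+1) F i)).
  by rewrite big_ord_recl lerDr.
by apply: mono; rewrite mulSn; lia.
Qed.

Section Grid.
Variables (N K Q : nat).
Hypothesis N0 : (0 < N)%N.
Hypothesis K12 : (12 < K)%N.
Hypothesis QE : Q = (N ^ 3 * K)%N.
Hypothesis Qdvd : forall q, (0 < q <= N)%N -> (q %| Q)%N.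

Let K0 : (0 < K)%N. Proof. exact: leq_trans K12. Qed.

Let QN : (12 * N ^ 3 < Q)%N.
Proof. by rewrite QE mulnC ltn_pmul2l// expn_gt0 N0. Qed.

(** Up to a constant, this dominates the part of [|D| ^ 10 / N ^ 10] due to the
    major arcs, where [D] is the kernel: the exponents are those of the fourth
    power bound multiplied by [5 / 2]. *)
Definition majorant (k : 'I_Q) : R :=
  \sum_(q < N) \sum_(a < q.+2) q.+1%:R `^ (- (9 / 4)) *
    bump (N%:R ^+ 3 * `|k%:R / Q%:R - a%:R / q.+1%:R|).

(** When [q] divides [Q] the rational [a / q] is a grid point, so that
    [sum_bump_scaled] bounds the inner sum by [12 K]. There are [q + 1] numerators
    for the denominator [q], which leaves the convergent series of
    [q `^ (- (5 / 4))]. *)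
Lemma sum_majorant : \sum_k majorant k <= 120 * K%:R.
Proof.
have KR : 0 < K%:R :> R by rewrite ltr0n.
have NR : 0 < N%:R :> R by rewrite ltr0n.
have N3 : 0 < N%:R ^+ 3 :> R by rewrite exprn_gt0.
have QR : Q%:R = N%:R ^+ 3 * K%:R :> R by rewrite QE natrM natrX.
have inner (q : 'I_N) (a : 'I_q.+2) :
    \sum_(k < Q) bump (N%:R ^+ 3 * `|k%:R / Q%:R - a%:R / q.+1%:R|) <= 12 * K%:R.
  have qQ : (q.+1 %| Q)%N by apply: Qdvd; rewrite ltn_ord.
  pose b := (a * (Q %/ q.+1))%N.
  have bQ : (b <= Q)%N.
    by rewrite /b -[leqRHS](divnK qQ) mulnC leq_mul2l -ltnS ltn_ord orbT.
  have E (k : 'I_Q) : N%:R ^+ 3 * `|k%:R / Q%:R - a%:R / q.+1%:R| =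
      `|k%:R - b%:R| / K%:R :> R.
    have -> : a%:R / q.+1%:R = b%:R / Q%:R :> R.
      have d0 : (0 < Q %/ q.+1)%N.
        by rewrite divn_gt0// dvdn_leq// QE muln_gt0 expn_gt0 N0.
      have QdE : Q%:R = (Q %/ q.+1)%:R * q.+1%:R :> R by rewrite -natrM divnK.
      rewrite /b natrM [in RHS]QdE [_ * q.+1%:R]mulrC -mulf_div divff ?mulr1//.
      by rewrite pnatr_eq0 -lt0n.
    rewrite -mulrBl normrM normfV [`|Q%:R|]ger0_norm// QR.
    by field; rewrite !gt_eqF.
  under eq_bigr do rewrite E.
  have := @sum_bump_scaled (N ^ 3) K b K0; rewrite -QE; exact.
rewrite /majorant exchange_big /=.
apply: (@le_trans _ _ (\sum_(q < N) 24 * K%:R * q.+1%:R `^ (- (5 / 4)))); last first.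
  rewrite -mulr_sumr (_ : 120 * K%:R = 24 * K%:R * 5); last by ring.
  by rewrite ler_wpM2l ?mulr_ge0 ?sum_powR54// ltW.
apply: ler_sum => q _; rewrite exchange_big /=.
have q0 : 0 < q.+1%:R :> R by rewrite ltr0n.
apply: (@le_trans _ _ (\sum_(a < q.+2) q.+1%:R `^ (- (9 / 4)) * (12 * K%:R))).
  by apply: ler_sum => a _; rewrite -mulr_sumr ler_wpM2l ?powR_ge0 ?inner.
rewrite sumr_const card_ord -[_ *+ q.+2]mulr_natl.
have h : q.+2%:R <= 2 * q.+1%:R :> R by rewrite -natrM ler_nat; lia.
rewrite (_ : q.+1%:R `^ (- (5 / 4)) = q.+1%:R `^ (- (9 / 4)) * q.+1%:R); last first.
  rewrite -[X in _ = _ * X](powRr1 (ltW q0)) -powRD.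
    by congr (_ `^ _); field.
  by apply/implyP => _; rewrite gt_eqF.
set P := _ `^ _; have P0 : 0 <= P by exact: powR_ge0.
have := ler_wpM2r (mulr_ge0 P0 (ltW KR)) h.
lra.
Qed.

(** Parseval in the first variable. *)
Lemma sum_row_osum (k : 'I_Q) :
  \sum_(j < Q) cmod (osum (N := N) (fun=> 1) (j, k)) ^+ 2 <= Q%:R * N.*2.+1%:R :> R.
Proof.
pose X (i : 'I_(N.*2.+1)) (j : 'I_Q) : R[i] := e ((freq i)%:~R * j%:R / Q%:R).
pose c (i : 'I_(N.*2.+1)) : R[i] := e ((freq i ^+ 3)%:~R * k%:R / Q%:R).
have Q0 : (0 < Q)%N by rewrite QE muln_gt0 expn_gt0 N0.
have E j : osum (N := N) (fun=> 1) (j, k) = \sum_i c i * X i j.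
  apply: eq_bigr => i _; rewrite mul1r /c /X -eD /chi /=; congr e; ring.
under eq_bigr do rewrite E.
have orth s t : \sum_j X s j * ((X t j)^*)%C =
    if (Q %| freq s - freq t)%Z then (Q%:R : R)%:C%C else 0.
  rewrite rmorph_nat -sum_e_grid//; apply: eq_bigr => j _.
  by rewrite /X -eN -eD; congr e; rewrite intrB; ring.
apply: (le_trans (parseval_le c (ler0n R Q) orth)).
rewrite ler_wpM2l//.
apply: (@le_trans _ _ (\sum_(s < N.*2.+1) (1 : R))); last by rewrite sumr_const card_ord.
apply: ler_sum => s _; rewrite (bigD1 s); last by rewrite subrr dvdz0.
rewrite /c !cmod_e mulr1 big1 /= ?addr0// => t /andP[st ts].
case/negP: ts; rewrite eq_sym -(inj_eq (freq_inj (N := N))) -subr_eq0; apply/eqP.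
apply: (dvdz_small st).
rewrite (le_lt_trans (ler_normB _ _))// (le_lt_trans (lerD (freq_le s) (freq_le t)))//.
rewrite -PoszD ltz_nat (leq_ltn_trans _ QN)//.
have : (N <= N ^ 3)%N by rewrite -[leqLHS]expn1 leq_pexp2l.
by move: (N ^ 3)%N => m; lia.
Qed.

(** Where the kernel is not below the minor arc threshold, Weyl's bound on
    [|D| ^ 4] is raised to the power [5 / 2] and dominated by the full sum over
    all arcs, so that the arc may depend on both variables. *)
Lemma kernel_twelfth_pointwise (C : R) (z t : R) (k : 'I_Q) : 0 < C ->
  t = k%:R / Q%:R ->
  (exists q a : nat, [/\ (0 < q <= N)%N, (a <= q)%N &
    z ^+ 4 <= C * N%:R `^ (4 - 8^-1) + C * N%:R ^+ 4 * (q%:R `^ (- (9 / 10)) /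
        Num.sqrt (Num.max 1 (N%:R ^+ 3 * `|t - a%:R / q%:R|)))]) ->
  0 <= z ->
  z ^+ 12 <= (2 * C) `^ 2^-1 * N%:R `^ (2 - 16^-1) * z ^+ 10 +
             (2 * C) `^ (5 / 2) * N%:R ^+ 10 * majorant k * z ^+ 2.
Proof.
move=> C0 tE [q [a [/andP[q0 qN] aq H]]] z0.
have C2 : 0 <= 2 * C by rewrite mulr_ge0// ltW.
have z40 : 0 <= z ^+ 4 by exact: exprn_ge0.
have M0 : 0 <= majorant k.
  by apply: sumr_ge0 => ? _; apply: sumr_ge0 => ? _; rewrite mulr_ge0 ?powR_ge0.
have zp (m : nat) (x : R) : x * 4 = m%:R -> (z ^+ 4) `^ x = z ^+ m.
  by move=> h; rewrite -powR_mulrn// -powRrM mulrC h powR_mulrn.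
set A := C * _ in H; set B := C * _ * _ in H.
have pow2 (b : R) x y : 0 <= x -> x <= y -> 0 <= b -> x `^ b <= y `^ b.
  by move=> x0 xy b0; rewrite ge0_ler_powR ?nnegrE ?(le_trans x0 xy).
case: (leP B A) => AB.
  have h : z ^+ 2 <= (2 * C) `^ 2^-1 * N%:R `^ (2 - 16^-1).
    rewrite -(zp 2 2^-1); last by field.
    apply: (@le_trans _ _ ((2 * C * N%:R `^ (4 - 8^-1)) `^ 2^-1)).
      by apply: pow2 => //; rewrite ?invr_ge0//; rewrite /A in H AB; lra.
    rewrite powRM ?powR_ge0// -powRrM.
    rewrite (_ : (4 - 8^-1) * 2^-1 = 2 - 16^-1 :> R); first by [].
    by field.
  apply: ler_wpDr; first by rewrite !mulr_ge0 ?powR_ge0 ?exprn_ge0.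
  have -> : z ^+ 12 = z ^+ 2 * z ^+ 10 by rewrite -exprD.
  by rewrite ler_wpM2r// exprn_ge0.
apply: ler_wpDl; first by rewrite !mulr_ge0 ?powR_ge0 ?exprn_ge0.
have -> : z ^+ 12 = z ^+ 10 * z ^+ 2 by rewrite -exprD.
apply: ler_wpM2r; first exact: exprn_ge0.
rewrite -(zp 10 (5 / 2)); last by field.
set L := Num.max 1 _ in B H AB *.
have L0 : 0 <= L by rewrite le_max ler01.
apply: (@le_trans _ _ ((2 * C * (N%:R ^+ 4 * (q%:R `^ (- (9 / 10)) / Num.sqrt L))) `^ (5 / 2))).
  by apply: pow2 => //; rewrite /B in H AB; lra.
have NN : 0 <= N%:R ^+ 4 :> R by exact: exprn_ge0.
have qL : 0 <= q%:R `^ (- (9 / 10)) / Num.sqrt L by rewrite divr_ge0 ?powR_ge0 ?sqrtr_ge0.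
have NqL : 0 <= N%:R ^+ 4 * (q%:R `^ (- (9 / 10)) / Num.sqrt L) by exact: mulr_ge0.
rewrite (powRM _ C2 NqL) (powRM _ NN qL) -[leRHS]mulrA.
apply: ler_wpM2l; first exact: powR_ge0.
rewrite -powR_mulrn// -powRrM (_ : 4 * (5 / 2) = 10%:R :> R); last by field.
rewrite powR_mulrn//; apply: ler_wpM2l; first exact: exprn_ge0.
rewrite powRM ?powR_ge0 ?invr_ge0 ?sqrtr_ge0// -powRrM.
rewrite (_ : - (9 / 10) * (5 / 2) = - (9 / 4) :> R); last by field.
rewrite -powR12_sqrt// -powRN -powRrM (_ : - 2^-1 * (5 / 2) = - (5 / 4) :> R); last by field.
rewrite /L; clear - tE q0 qN aq; case: q q0 qN aq => // q _ qN aq.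
rewrite /majorant (bigD1 (Ordinal qN))//= (bigD1 (Ordinal (aq : (a < q.+2)%N)))//= -tE.
rewrite -addrA ler_wpDr ?addr_ge0 ?sumr_ge0// => [i _|i _].
  by rewrite mulr_ge0 ?powR_ge0.
by apply: sumr_ge0 => ? _; rewrite mulr_ge0 ?powR_ge0.
Qed.

End Grid.

Lemma osum1E N Q (g : 'I_Q * 'I_Q) :
  osum (N := N) (fun=> 1 : R[i]) g = kernel N (g.1%:R / Q%:R) (g.2%:R / Q%:R).
Proof.
apply: eq_bigr => i _; rewrite mul1r /chi /freq; congr e.
by rewrite rmorphXn /= intrB -!pmulrn; ring.
Qed.

Lemma energy1 N : energy (fun _ : 'I_(N.*2.+1) => 1 : R[i]) = N.*2.+1%:R.
Proof.
rewrite /energy; under eq_bigr do rewrite cmod1 expr1n.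
by rewrite sumr_const card_ord.
Qed.

(** Integrate [kernel_twelfth_pointwise]. In the first term the saving of
    [N `^ (- 16^-1)] pays for the loss in the tenth moment taken with
    [eps = 16^-1]. In the second, [majorant] depends on one grid variable only;
    Parseval in the other one leaves its sum. *)
Lemma twelfth_moment : exists2 C : R, 0 < C &
  forall N K Q, (0 < N)%N -> (12 < K)%N -> Q = (N ^ 3 * K)%N ->
    (forall q, (0 < q <= N)%N -> (q %| Q)%N) ->
    \sum_g cmod (osum (N := N) (Q := Q) (fun=> 1 : R[i]) g) ^+ 12 <=
      C * Q%:R ^+ 2 * N%:R ^+ 8.
Proof.
have [C1 C10 H1] := kernel_pointwise R.
have e16 : 0 < 16^-1 :> R by rewrite invr_gt0.
have [C2 C20 H2] := tenth_moment e16.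
pose c1 := (2 * C1) `^ 2^-1; pose c2 := (2 * C1) `^ (5 / 2).
have c10 : 0 < c1 by rewrite powR_gt0// mulr_gt0.
have c20 : 0 < c2 by rewrite powR_gt0// mulr_gt0.
exists (3 ^+ 5 * (c1 * C2) + 120 * 3 * c2) => [|N K Q N0 K12 QE Qdvd].
  have h : 0 < c1 * C2 by exact: mulr_gt0.
  by rewrite addr_gt0 ?(mulr_gt0 _ h) ?(mulr_gt0 _ c20) ?exprn_gt0 ?mulr_gt0.
have QN : (12 * N ^ 3 < Q)%N by rewrite QE mulnC ltn_pmul2l// expn_gt0 N0.
have Q0 : (0 < Q)%N by exact: leq_ltn_trans QN.
have NR : 0 < N%:R :> R by rewrite ltr0n.
have N3 : N.*2.+1%:R <= 3 * N%:R :> R by rewrite -natrM ler_nat double_le3.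
have QR : Q%:R = N%:R ^+ 3 * K%:R :> R by rewrite QE natrM natrX.
pose f (g : 'I_Q * 'I_Q) : R := cmod (osum (N := N) (fun=> 1) g).
have f0 g : 0 <= f g by exact: cmod_ge0.
apply: (@le_trans _ _ (\sum_(g : 'I_Q * 'I_Q) (c1 * N%:R `^ (2 - 16^-1) * f g ^+ 10 +
    c2 * N%:R ^+ 10 * majorant N g.2 * f g ^+ 2))).
  apply: ler_sum => g _.
  apply: (kernel_twelfth_pointwise C10 (t := g.2%:R / Q%:R)) => //; last exact: f0.
  rewrite /f osum1E; apply: H1 => //.
  by rewrite divr_ge0// ler_pdivrMr ?ltr0n// mul1r ler_nat ltnW.
rewrite big_split /= -mulr_sumr mulrDl mulrDl; apply: lerD.
  have := H2 N Q (fun=> 1) N0 QN; rewrite -/f energy1 => h.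
  apply: (@le_trans _ _ (c1 * N%:R `^ (2 - 16^-1) *
      (C2 * Q%:R ^+ 2 * N%:R `^ (1 + 16^-1) * (3 * N%:R) ^+ 5))).
    apply: ler_wpM2l; first by rewrite mulr_ge0 ?powR_ge0.
    apply: (le_trans h); apply: ler_wpM2l.
      by rewrite !mulr_ge0 ?powR_ge0 ?exprn_ge0// ltW.
    by rewrite lerXn2r ?nnegrE ?mulr_ge0.
  have -> : N%:R ^+ 8 = N%:R `^ (2 - 16^-1) * N%:R `^ (1 + 16^-1) * N%:R ^+ 5 :> R.
    rewrite -powRD; last by apply/implyP => _; rewrite gt_eqF.
    rewrite (_ : 2 - 16^-1 + (1 + 16^-1) = 3%:R :> R); last by ring.
    by rewrite powR_mulrn// -exprD.
  by rewrite le_eqVlt; apply/orP; left; apply/eqP; ring.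
under eq_bigr do rewrite -mulrA.
rewrite -mulr_sumr -(pair_bigA _ (fun j k => majorant N k * f (j, k) ^+ 2)) /=.
rewrite exchange_big /=.
apply: (@le_trans _ _ (c2 * N%:R ^+ 10 * (\sum_(k < Q) majorant N k * (Q%:R * (3 * N%:R))))).
  apply: ler_wpM2l; first by rewrite mulr_ge0 ?exprn_ge0 ?powR_ge0.
  apply: ler_sum => k _; rewrite -mulr_sumr; apply: ler_wpM2l.
    by apply: sumr_ge0 => ? _; apply: sumr_ge0 => ? _; rewrite mulr_ge0 ?powR_ge0.
  apply: (le_trans (sum_row_osum N0 K12 QE k)).
  by rewrite ler_wpM2l.
rewrite -mulr_suml.
apply: (@le_trans _ _ (c2 * N%:R ^+ 10 * (120 * K%:R * (Q%:R * (3 * N%:R))))).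
  apply: ler_wpM2l; first by rewrite mulr_ge0 ?exprn_ge0 ?powR_ge0.
  by rewrite ler_wpM2r ?mulr_ge0// (sum_majorant N0 K12 QE Qdvd).
have -> : Q%:R ^+ 2 = N%:R ^+ 3 * K%:R * Q%:R :> R by rewrite -QR.
by rewrite le_eqVlt; apply/orP; left; apply/eqP; ring.
Qed.

End KernelMoment.

(** * The twenty-fourth moment of arbitrary sequences *)

Section TwentyFourth.
Variables (R : realType) (N Q : nat).
Hypothesis Q0 : (0 < Q)%N.
Let I := 'I_(N.*2.+1).
Implicit Types a : I -> R[i].

Let wt (i : I) : int * int := (freq i, freq i ^+ 3).

Lemma osum_exp a n (g : 'I_Q * 'I_Q) :
  osum a g ^+ n = \sum_(s : {ffun 'I_n -> I}) (\prod_i a (s i)) * chi R (\sum_i wt (s i)) g.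
Proof.
rewrite -[in LHS](card_ord n) -prodr_const bigA_distr_bigA /=; apply: eq_bigr => s _.
rewrite big_split /=; congr (_ * _).
by rewrite (big_morph (fun u => chi R u g) (fun u v => chiD R u v g) (chi0 R g)).
Qed.

(** The Fourier coefficients of [f ^ 12] are sums of products of coefficients
    over representations of a frequency; by Cauchy-Schwarz their squares sum to
    at most [energy a ^ 12] times the largest number of representations, and that
    number is a Fourier coefficient of the 12th power of the kernel. *)
Lemma twentyfourth_moment a :
  \sum_g cmod (osum (Q := Q) a g) ^+ 24 <=
    energy a ^+ 12 * \sum_g cmod (osum (N := N) (Q := Q) (fun=> 1 : R[i]) g) ^+ 12.
Proof.
set M := \sum_(g : 'I_Q * 'I_Q) cmod (osum (fun=> 1) g) ^+ 12.
pose S := {ffun 'I_12 -> I}.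
pose phi (s : S) : int * int := \sum_i wt (s i).
pose c (s : S) : R[i] := \prod_i a (s i).
pose r (s t : S) := (Q %| (phi s).1 - (phi t).1)%Z && (Q %| (phi s).2 - (phi t).2)%Z.
have dC (x y : int) : (Q %| x - y)%Z = (Q %| y - x)%Z by rewrite -rpredN opprB.
have rC s t : r s t = r t s by rewrite /r dC [X in _ && X]dC.
have orth s t : \sum_(g : 'I_Q * 'I_Q) chi R (phi s) g * ((chi R (phi t) g)^*)%C =
    if r s t then (Q%:R ^+ 2 : R)%:C%C else 0.
  by rewrite chi_orthogonal.
have rep s : Q%:R ^+ 2 * \sum_(t | r t s) 1 <= M.
  have E : (Q%:R ^+ 2 * \sum_(t | r t s) 1 : R)%:C%C =
      \sum_(g : 'I_Q * 'I_Q) osum (N := N) (fun=> 1) g ^+ 12 * ((chi R (phi s) g)^*)%C.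
    rewrite rmorphM rmorph_sum mulr_sumr big_mkcond /=.
    under [RHS]eq_bigr do rewrite osum_exp mulr_suml.
    rewrite exchange_big; apply: eq_bigr => t _.
    under eq_bigr do rewrite big1_eq mul1r.
    rewrite orth; case: ifP => // _; by rewrite mulr1.
  have P0 : 0 <= Q%:R ^+ 2 * \sum_(t | r t s) 1 :> R.
    by rewrite mulr_ge0 ?exprn_ge0 ?sumr_ge0.
  rewrite -[leLHS](ger0_norm P0) -cmodC E (le_trans (ler_cmod_sum _ _ _))//.
  by apply: ler_sum => g _; rewrite cmodM cmod_conj cmod_chi mulr1 cmodX.
have en : \sum_s cmod (c s) ^+ 2 = energy a ^+ 12.
  rewrite -[in RHS](card_ord 12) -prodr_const /energy bigA_distr_bigA /=.
  apply: eq_bigr => s _; rewrite /c.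
  by rewrite (big_morph _ (@cmodM R) (cmod1 R)) -prodrXl.
apply: (@le_trans _ _ (\sum_(g : 'I_Q * 'I_Q) cmod (\sum_s c s * chi R (phi s) g) ^+ 2)).
  by apply: ler_sum => g _; rewrite -osum_exp cmodX -exprM.
apply: (le_trans (parseval_le c _ orth)); first exact: sqr_ge0.
rewrite mulr_sumr -en mulr_suml.
apply: (@le_trans _ _ (\sum_s \sum_(t | r s t)
    (Q%:R ^+ 2 / 2 * cmod (c s) ^+ 2 + Q%:R ^+ 2 / 2 * cmod (c t) ^+ 2))).
  apply: ler_sum => s _; rewrite mulr_sumr; apply: ler_sum => t _.
  have := mulr_ge0 (sqr_ge0 Q%:R) (sqr_ge0 (cmod (c s) - cmod (c t))).
  by rewrite sqrrB; lra.
have sym : \sum_s \sum_(t | r s t) Q%:R ^+ 2 / 2 * cmod (c t) ^+ 2 =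
    \sum_s \sum_(t | r s t) Q%:R ^+ 2 / 2 * cmod (c s) ^+ 2.
  rewrite (exchange_big_dep xpredT)//=; apply: eq_bigr => s _.
  by apply: eq_bigl => t; rewrite rC.
under eq_bigr do rewrite big_split /=.
rewrite big_split /= sym -big_split /=; apply: ler_sum => s _.
rewrite -big_split /= -(eq_bigl _ _ (fun t => rC t s)).
apply: (@le_trans _ _ (cmod (c s) ^+ 2 * (Q%:R ^+ 2 * \sum_(t | r t s) 1))).
  rewrite mulr_sumr mulr_sumr; apply: ler_sum => t _; rewrite mulr1; lra.
by rewrite ler_wpM2l ?sqr_ge0.
Qed.

End TwentyFourth.

(** * Higher powers on the grid *)

Section GridBounds.
Variable R : realType.

Lemma sum_cmod_le N (a : 'I_(N.*2.+1) -> R[i]) : (0 < N)%N ->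
  (\sum_i cmod (a i)) ^+ 2 <= 3 * N%:R * energy a.
Proof.
move=> N0; apply: (le_trans (sqr_sum_le _)); rewrite card_ord.
by apply: ler_wpM2r; [exact: energy_ge0 | rewrite -natrM ler_nat double_le3].
Qed.

Lemma cmod_osum_le N Q (a : 'I_(N.*2.+1) -> R[i]) (g : 'I_Q * 'I_Q) : (0 < N)%N ->
  cmod (osum a g) ^+ 2 <= 3 * N%:R * energy a.
Proof.
move=> N0; apply: le_trans (sum_cmod_le a N0).
rewrite lerXn2r ?nnegrE ?cmod_ge0 ?sumr_ge0// => [i _|]; first exact: cmod_ge0.
apply: (le_trans (ler_cmod_sum _ _ _)); apply: ler_sum => i _.
by rewrite cmodM cmod_chi mulr1.
Qed.

(** The powers above an integer [m] are charged to the sup norm. *)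
Lemma powR_le_sup (x B p : R) (m : nat) : 0 <= x -> x ^+ 2 <= B -> 0 < p ->
  m%:R <= p -> x `^ p <= B `^ ((p - m%:R) / 2) * x ^+ m.
Proof.
move=> x0 xB p0 mp; have [->|xn0] := eqVneq x 0.
  by rewrite powR0 ?gt_eqF// mulr_ge0 ?powR_ge0 ?exprn_ge0.
rewrite -[X in x `^ X](subrK m%:R p) powRD; last by apply/implyP => _; exact: xn0.
rewrite powR_mulrn// ler_wpM2r ?exprn_ge0//.
have -> : x `^ (p - m%:R) = (x ^+ 2) `^ ((p - m%:R) / 2).
  by rewrite -powR_mulrn// -powRrM; congr (_ `^ _); field.
apply: ge0_ler_powR => //; rewrite ?nnegrE ?exprn_ge0//.
  by rewrite divr_ge0// subr_ge0.
by apply: le_trans xB; rewrite exprn_ge0.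
Qed.

Lemma sum_powR_osum N Q (a : 'I_(N.*2.+1) -> R[i]) (p : R) (m : nat) : (0 < N)%N ->
  0 < p -> m%:R <= p ->
  \sum_g cmod (osum (Q := Q) a g) `^ p <=
    3 `^ ((p - m%:R) / 2) * N%:R `^ ((p - m%:R) / 2) * energy a `^ ((p - m%:R) / 2) *
    \sum_g cmod (osum (Q := Q) a g) ^+ m.
Proof.
move=> N0 p0 mp; rewrite -!powRM ?mulr_ge0 ?energy_ge0// mulr_sumr.
by apply: ler_sum => g _; apply: powR_le_sup; rewrite ?cmod_ge0 ?cmod_osum_le.
Qed.

Lemma energy_powRD N (a : 'I_(N.*2.+1) -> R[i]) (p : R) (m : nat) : 0 < p ->
  (m.*2)%:R <= p ->
  energy a `^ ((p - m.*2%:R) / 2) * energy a ^+ m = energy a `^ (p / 2).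
Proof.
move=> p0 mp; rewrite -powR_mulrn ?energy_ge0// -powRD.
  by congr (_ `^ _); rewrite -muln2 natrM; field.
rewrite -muln2 natrM; apply/implyP.
rewrite (_ : (p - m%:R * 2) / 2 + m%:R = p / 2); last by field.
by rewrite gt_eqF// divr_gt0.
Qed.

(** The tenth moment has the exponent [1 + eps] of [N], and the sup norm
    contributes [(p - 10) / 2]. *)
Lemma grid_bound_eps (p eps : R) : 12 <= p -> 0 < eps ->
  exists2 C : R, 0 < C & forall N Q (a : 'I_(N.*2.+1) -> R[i]),
    (0 < N)%N -> (12 * N ^ 3 < Q)%N ->
    \sum_g cmod (osum (Q := Q) a g) `^ p <=
      C * Q%:R ^+ 2 * N%:R `^ (p / 2 - 4 + eps) * energy a `^ (p / 2).
Proof.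
move=> p12 e0; have [C C0 H] := tenth_moment e0.
have p0 : 0 < p by lra.
exists (3 `^ ((p - 10%:R) / 2) * C) => [|N Q a N0 QN]; first by rewrite mulr_gt0// powR_gt0.
have m10 : (5.*2)%:R <= p by rewrite (_ : 5.*2 = 10)%N//; lra.
have NR : 0 < N%:R :> R by rewrite ltr0n.
apply: (le_trans (sum_powR_osum Q a N0 p0 m10)).
set W := energy a `^ ((p - _) / 2).
apply: (@le_trans _ _ (3 `^ ((p - 10%:R) / 2) * N%:R `^ ((p - 10%:R) / 2) * W *
    (C * Q%:R ^+ 2 * N%:R `^ (1 + eps) * energy a ^+ 5))).
  by apply: ler_wpM2l; [rewrite !mulr_ge0 ?powR_ge0 | exact: H].
rewrite -(energy_powRD a p0 m10) -/W.
have -> : N%:R `^ (p / 2 - 4 + eps) = N%:R `^ ((p - 10%:R) / 2) * N%:R `^ (1 + eps).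
  rewrite -powRD; first by congr (_ `^ _); field.
  by apply/implyP => _; rewrite gt_eqF.
by rewrite le_eqVlt; apply/orP; left; apply/eqP; ring.
Qed.

(** The twenty-fourth moment replaces the tenth, for it has no factor [N `^ eps]. *)
Lemma grid_bound_sharp (p : R) : 24 <= p ->
  exists2 C : R, 0 < C & forall N K Q (a : 'I_(N.*2.+1) -> R[i]),
    (0 < N)%N -> (12 < K)%N -> Q = (N ^ 3 * K)%N ->
    (forall q, (0 < q <= N)%N -> (q %| Q)%N) ->
    \sum_g cmod (osum (Q := Q) a g) `^ p <=
      C * Q%:R ^+ 2 * N%:R `^ (p / 2 - 4) * energy a `^ (p / 2).
Proof.
move=> p24; have [C C0 H] := twelfth_moment R.
have p0 : 0 < p by lra.
exists (3 `^ ((p - 24%:R) / 2) * C) => [|N K Q a N0 K12 QE Qdvd].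
  by rewrite mulr_gt0// powR_gt0.
have m24 : (12.*2)%:R <= p by rewrite (_ : 12.*2 = 24)%N//; lra.
have NR : 0 < N%:R :> R by rewrite ltr0n.
have Q0 : (0 < Q)%N by rewrite QE muln_gt0 expn_gt0 N0 (leq_trans _ K12).
apply: (le_trans (sum_powR_osum Q a N0 p0 m24)).
set W := energy a `^ ((p - _) / 2).
apply: (@le_trans _ _ (3 `^ ((p - 24%:R) / 2) * N%:R `^ ((p - 24%:R) / 2) * W *
    (energy a ^+ 12 * (C * Q%:R ^+ 2 * N%:R ^+ 8)))).
  apply: ler_wpM2l; first by rewrite !mulr_ge0 ?powR_ge0.
  apply: (le_trans (twentyfourth_moment Q0 a)); apply: ler_wpM2l.
    by rewrite exprn_ge0// energy_ge0.
  exact: (H N K).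
rewrite -(energy_powRD a p0 m24) -/W.
have -> : N%:R `^ (p / 2 - 4) = N%:R `^ ((p - 24%:R) / 2) * N%:R ^+ 8.
  rewrite -powR_mulrn// -powRD; first by congr (_ `^ _); field.
  by apply/implyP => _; rewrite gt_eqF.
by rewrite le_eqVlt; apply/orP; left; apply/eqP; ring.
Qed.

End GridBounds.

(** * Integration over the cells of a grid *)

Section Sampling.
Variable R : realType.

Lemma powRD_le2 (x y p : R) : 0 <= x -> 0 <= y -> 0 <= p ->
  (x + y) `^ p <= 2 `^ p * (x `^ p + y `^ p).
Proof.
move=> x0 y0 p0; wlog xy : x y x0 y0 / x <= y.
  move=> H; have [xy|/ltW yx] := leP x y; first exact: H.
  by rewrite addrC [x `^ p + _]addrC; exact: H.
apply: (@le_trans _ _ ((2 * y) `^ p)).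
  by apply: ge0_ler_powR; rewrite ?nnegrE ?addr_ge0 ?mulr_ge0//; lra.
rewrite powRM//; apply: ler_wpM2l; first exact: powR_ge0.
by rewrite lerDr powR_ge0.
Qed.

(** Overlaps of the sets [A i] are harmless since only an upper bound is wanted;
    this allows closed cells that share their edges. *)
Lemma integral_le_cover d (T : measurableType d) (m : {measure set T -> \bar R})
    (I : finType) (c : I -> R) (A : I -> set T) (D : set T) (F : T -> R) :
  (forall i, 0 <= c i) -> (forall i, measurable (A i)) -> measurable D ->
  m (~` D)%classic = 0%E -> measurable_fun setT F -> (forall z, 0 <= F z) ->
  (forall z, D z -> F z <= \sum_i c i * \1_(A i) z) ->
  (\int[m]_z (F z)%:E <= \sum_i (c i)%:E * m (A i))%E.
Proof.
move=> c0 mA mD D0 mF F0 FA.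
apply: (@le_trans _ _ (\int[m]_z (\sum_i ((c i)%:E * (\1_(A i) z)%:E)))%E).
  apply: ae_ge0_le_integral => //.
  - by move=> z _; rewrite lee_fin.
  - exact/measurable_EFinP.
  - by move=> z _; apply: sume_ge0 => i _; rewrite mule_ge0 ?lee_fin.
  - apply: emeasurable_sum => i; apply: emeasurable_funM => //.
    by apply/measurable_EFinP; exact: measurable_indic.
  - exists (~` D)%classic; split => //; first exact: measurableC.
    move=> z /= nF Dz; apply: nF => _.
    by under eq_bigr do rewrite -EFinM; rewrite sumEFin lee_fin FA.
rewrite ge0_integral_sum//.
- apply: lee_sum => i _; rewrite ge0_integralZl_EFin//.
  + by rewrite integral_indic// setIT.
  + by apply/measurable_EFinP; exact: measurable_indic.
- move=> i; apply: emeasurable_funM => //.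
  by apply/measurable_EFinP; exact: measurable_indic.
- by move=> i z _; rewrite mule_ge0 ?lee_fin.
Qed.

Definition cell Q (g : 'I_Q * 'I_Q) : set (R * R) :=
  (`[g.1%:R / Q%:R, g.1.+1%:R / Q%:R] `*` `[g.2%:R / Q%:R, g.2.+1%:R / Q%:R])%classic.

Lemma exists_cell1 Q (x : R) : (0 < Q)%N -> x \in `[0, 1] ->
  exists j : 'I_Q, x \in `[j%:R / Q%:R, j.+1%:R / Q%:R].
Proof.
move=> Q0; rewrite in_itv /= => /andP[x0 x1].
have QR : 0 < Q%:R :> R by rewrite ltr0n.
have [xQ|xQ] := ltnP (Num.truncn (x * Q%:R)) Q.
  exists (Ordinal xQ); rewrite in_itv /= ler_pdivrMr// ler_pdivlMr//.
  have /andP[-> /ltW ->//] : (Num.truncn (x * Q%:R))%:R <= x * Q%:R < (Num.truncn (x * Q%:R)).+1%:R.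
  by apply: truncn_itv; rewrite mulr_ge0.
(* Only the right endpoint falls outside the half-open cells. *)
have xE : x = 1.
  apply/eqP; rewrite eq_le x1 /= -(ler_pM2r QR) mul1r.
  by rewrite -truncn_ge_nat// mulr_ge0.
have Qp : (Q.-1 < Q)%N by rewrite prednK.
exists (Ordinal Qp); rewrite in_itv /= prednK// divff ?gt_eqF// xE lexx andbT.
by rewrite ler_pdivrMr// mul1r ler_nat ltnW.
Qed.

Lemma measurable_cell Q (g : 'I_Q * 'I_Q) :
  measurable (cell g : set (measurableTypeR R * measurableTypeR R)).
Proof. by apply: measurableX; exact: measurable_itv. Qed.

Lemma lebesgue_cell1 Q (j : 'I_Q) :
  lebesgue_measure `[j%:R / Q%:R : R, j.+1%:R / Q%:R]%classic = (Q%:R^-1)%:E.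
Proof.
have Q0 : 0 < Q%:R :> R by rewrite ltr0n (leq_trans _ (ltn_ord j)).
rewrite lebesgue_measure_itv /= lte_fin ltr_pM2r ?invr_gt0// ltr_nat ltnSn.
by rewrite -EFinB -mulrBl -natrB// subSnn mul1r.
Qed.

Lemma torus_cell Q (g : 'I_Q * 'I_Q) :
  (torus_measure R (cell g) <= (Q%:R ^- 2)%:E)%E.
Proof.
rewrite /torus_measure /= /mrestr.
apply: (@le_trans _ _ ((@lebesgue_measure R \x @lebesgue_measure R)%E (cell g))).
  apply: le_measure; rewrite ?inE//.
  - by apply: measurableI; [exact: measurable_cell | exact: measurable_unit_square].
  - exact: measurable_cell.
rewrite product_measure1E; try exact: measurable_itv.
rewrite [X in (X * _)%E]lebesgue_cell1 [X in (_ * X)%E]lebesgue_cell1.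
by rewrite -EFinM -expr2 exprVn.
Qed.

Lemma torus_outside : torus_measure R (~` @unit_square R)%classic = 0%E.
Proof. by rewrite /torus_measure /= /mrestr setICl measure0. Qed.

End Sampling.

(** * Sampling cubic sums *)

Section SamplingCubic.
Variable R : realType.

Lemma sum_freqs (V : zmodType) N (F : int -> V) :
  \sum_(n <- freqs N) F n = \sum_(i < N.*2.+1) F (freq i).
Proof.
by rewrite big_map -{1}(subn0 N.*2.+1) -/(index_iota _ _) big_mkord.
Qed.

Lemma l2norm_energy N (a : int -> R[i]) :
  l2norm N a = Num.sqrt (energy (fun i : 'I_(N.*2.+1) => a (freq i))).
Proof. by rewrite /l2norm sum_freqs. Qed.

Lemma phase_near (N Q : nat) (n : int) (x t u v : R) : (0 < N)%N -> (0 < Q)%N ->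
  `|n| <= N%:Z -> `|x - u| <= Q%:R^-1 -> `|t - v| <= Q%:R^-1 ->
  `|(u * n%:~R + v * n%:~R ^+ 3) - (x * n%:~R + t * n%:~R ^+ 3)| <= 2 * N%:R ^+ 3 / Q%:R.
Proof.
move=> N0 Q0 nN xu tv.
have nR : `|n%:~R| <= N%:R :> R by rewrite -intr_norm (ler_int R `|n| N%:Z).
have N1 : 1 <= N%:R :> R by rewrite ler1n.
have n3 : `|n%:~R ^+ 3| <= N%:R ^+ 3 :> R.
  by rewrite normrX lerXn2r// nnegrE.
have n1 : `|n%:~R| <= N%:R ^+ 3 :> R.
  by apply: (le_trans nR); rewrite -[leLHS]expr1 ler_weXn2l.
have -> : (u * n%:~R + v * n%:~R ^+ 3) - (x * n%:~R + t * n%:~R ^+ 3) =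
    - ((x - u) * n%:~R + (t - v) * n%:~R ^+ 3) :> R by ring.
rewrite normrN; apply: (le_trans (ler_normD _ _)).
rewrite [`|_ * n%:~R|]normrM [`|_ * n%:~R ^+ 3|]normrM.
have -> : 2 * N%:R ^+ 3 / Q%:R = Q%:R^-1 * N%:R ^+ 3 + Q%:R^-1 * N%:R ^+ 3 :> R by ring.
by apply: lerD; apply: ler_pM.
Qed.

(** Within a cell the phases vary by at most [2 N ^ 3 / Q], hence each exponential
    by [16 N ^ 3 / Q]; as the [|a i|] sum to at most [3 N] times the
    square root of the energy, the choice [48 N ^ 4 <= Q] makes the total at most
    that square root. *)
Lemma cubic_sum_near N Q (a : int -> R[i]) (g : 'I_Q * 'I_Q) (z : R * R) :
  (0 < N)%N -> (48 * N ^ 4 <= Q)%N -> cell g z ->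
  cmod (cubic_sum N a z) <=
    cmod (osum (fun i : 'I_(N.*2.+1) => a (freq i)) g) +
    Num.sqrt (energy (fun i : 'I_(N.*2.+1) => a (freq i))).
Proof.
move=> N0 QN [/= zx zt]; set b := fun i => a (freq i).
have Q0 : (0 < Q)%N by apply: leq_trans QN; rewrite muln_gt0 expn_gt0 N0.
have QR : 0 < Q%:R :> R by rewrite ltr0n.
have near (w : R) (j : 'I_Q) : w \in `[j%:R / Q%:R, j.+1%:R / Q%:R] ->
    `|w - j%:R / Q%:R| <= Q%:R^-1.
  rewrite in_itv /= => /andP[jw wj]; rewrite ger0_norm ?subr_ge0//.
  by rewrite lerBlDr; apply: (le_trans wj); rewrite -natr1 mulrDl mul1r addrC.
apply: (le_trans (ler_cmodB _ (osum b g))); rewrite lerD2l.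
rewrite /cubic_sum sum_freqs /osum -sumrB.
apply: (le_trans (ler_cmod_sum _ _ _)).
apply: (@le_trans _ _ (\sum_i cmod (b i) * (16 * N%:R ^+ 3 / Q%:R))).
  apply: ler_sum => i _; rewrite -mulrBr cmodM; apply: ler_wpM2l; first exact: cmod_ge0.
  rewrite /chi cmod_eB; apply: (le_trans (chord_le _)).
  apply: (@le_trans _ _ (8 * (2 * N%:R ^+ 3 / Q%:R))); last by rewrite !mulrA -natrM.
  apply: ler_wpM2l => //.
  have -> : ((freq i, freq i ^+ 3).1%:~R * g.1%:R + (freq i, freq i ^+ 3).2%:~R * g.2%:R) / Q%:R =
      g.1%:R / Q%:R * (freq i)%:~R + g.2%:R / Q%:R * (freq i)%:~R ^+ 3 :> R.
    by rewrite /= rmorphXn /=; ring.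
  by apply: phase_near => //; [exact: freq_le | exact: near | exact: near].
rewrite -mulr_suml.
set S := \sum_i _.
have S0 : 0 <= S by apply: sumr_ge0 => i _; exact: cmod_ge0.
have E0 := energy_ge0 b.
have S3 : S <= 3 * N%:R * Num.sqrt (energy b).
  rewrite -(@ler_pXn2r _ 2) ?nnegrE ?mulr_ge0 ?sqrtr_ge0//.
  apply: (le_trans (sum_cmod_le b N0)); rewrite exprMn sqr_sqrtr//.
  apply: ler_wpM2r => //; rewrite -natrM -natrX ler_nat.
  by rewrite leq_pmull// muln_gt0.
apply: (@le_trans _ _ (3 * N%:R * Num.sqrt (energy b) * (16 * N%:R ^+ 3 / Q%:R))).
  by apply: ler_wpM2r => //; rewrite divr_ge0 ?mulr_ge0 ?exprn_ge0.
rewrite mulrA ler_pdivrMr//.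
have -> : 3 * N%:R * Num.sqrt (energy b) * (16 * N%:R ^+ 3) =
    Num.sqrt (energy b) * (48 * N ^ 4)%:R :> R by rewrite natrM natrX; ring.
by apply: ler_wpM2l; [exact: sqrtr_ge0 | rewrite ler_nat].
Qed.

Lemma measurable_cubic_powR N (a : int -> R[i]) (p : R) :
  measurable_fun setT
    (fun z : measurableTypeR R * measurableTypeR R => cmod (cubic_sum N a z) `^ p).
Proof.
pose th n (z : measurableTypeR R * measurableTypeR R) : R :=
  2 * pi * (z.1 * n%:~R + z.2 * n%:~R ^+ 3).
have mth n : measurable_fun setT (th n).
  apply: measurable_funM; first exact: measurable_cst.
  apply: measurable_funD; apply: measurable_funM; try exact: measurable_cst.
    exact: measurable_fst.
  exact: measurable_snd.
have mcos n : measurable_fun setT (fun z => cos (th n z)).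
  apply: measurableT_comp => //.
  by apply: continuous_measurable_fun; exact: continuous_cos.
have msin n : measurable_fun setT (fun z => sin (th n z)).
  apply: measurableT_comp => //.
  by apply: continuous_measurable_fun; exact: continuous_sin.
pose A z := \sum_(n <- freqs N) (complex.Re (a n) * cos (th n z) - complex.Im (a n) * sin (th n z)).
pose B z := \sum_(n <- freqs N) (complex.Re (a n) * sin (th n z) + complex.Im (a n) * cos (th n z)).
have mA : measurable_fun setT A.
  apply: measurable_sum => n; apply: measurable_funB; apply: measurable_funM => //;
    exact: measurable_cst.
have mB : measurable_fun setT B.
  apply: measurable_sum => n; apply: measurable_funD; apply: measurable_funM => //;
    exact: measurable_cst.
have E z : cubic_sum N a z = (A z +i* B z)%C.
  rewrite /cubic_sum /A /B; elim/big_rec3 : _ => [//|n x y w _ ->].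
  by case: (a n) => u v; rewrite /e /=; congr (_ +i* _)%C.
under eq_fun do rewrite E.
apply: (@measurableT_comp _ _ _ _ _ _ (fun x : R => x `^ p)); first exact: measurable_powR.
rewrite /cmod /ComplexField.Normc.normc.
apply: (@measurableT_comp _ _ _ _ _ _ (@Num.sqrt R)).
  by apply: continuous_measurable_fun; exact: sqrt_continuous.
by apply: measurable_funD; apply: measurable_funX.
Qed.

(** Sampling: on a grid of mesh far below the wavelength of the sum, its value
    at a point and at a corner of the cell of that point differ by at most the
    [l^2] norm of the coefficients. *)
Lemma integral_cubic_le_grid N Q (a : int -> R[i]) (p : R) :
  let b := fun i : 'I_(N.*2.+1) => a (freq i) in
  (0 < N)%N -> (48 * N ^ 4 <= Q)%N -> 0 < p ->
  (\int[torus_measure R]_z (cmod (cubic_sum N a z) `^ p)%:E <=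
    (2 `^ p * (Q%:R ^- 2 * \sum_g cmod (osum (Q := Q) b g) `^ p + energy b `^ (p / 2)))%:E)%E.
Proof.
move=> b N0 QN p0.
have Q0 : (0 < Q)%N by apply: leq_trans QN; rewrite muln_gt0 expn_gt0 N0.
have QR : 0 < Q%:R :> R by rewrite ltr0n.
have sE : Num.sqrt (energy b) `^ p = energy b `^ (p / 2).
  by rewrite -powR12_sqrt ?energy_ge0// -powRrM; congr (_ `^ _); rewrite mulrC.
pose c g := 2 `^ p * (cmod (osum (Q := Q) b g) `^ p + energy b `^ (p / 2)).
have c0 g : 0 <= c g by rewrite mulr_ge0 ?addr_ge0 ?powR_ge0.
apply: (@le_trans _ _ (\sum_g (c g)%:E * torus_measure R (cell g))%E).
  apply: (@integral_le_cover R _ _ (torus_measure R) _ c (@cell R Q) (@unit_square R)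
    (fun z => cmod (cubic_sum N a z) `^ p)) => //.
  - by move=> g; exact: measurable_cell.
  - exact: measurable_unit_square.
  - exact: torus_outside.
  - exact: measurable_cubic_powR.
  - by move=> z; exact: powR_ge0.
  move=> z [/= zx zt].
  have [j zj] := exists_cell1 Q0 zx; have [k zk] := exists_cell1 Q0 zt.
  have zg : cell (j, k) z by [].
  rewrite (bigD1 (j, k))//= indicE mem_set// mulr1.
  apply: ler_wpDr; first by apply: sumr_ge0 => g _; rewrite mulr_ge0.
  rewrite /c -sE; apply: le_trans (powRD_le2 (cmod_ge0 _) (sqrtr_ge0 _) (ltW p0)).
  apply: ge0_ler_powR; rewrite ?nnegrE ?addr_ge0 ?cmod_ge0 ?sqrtr_ge0//.
    exact: ltW.
  exact: cubic_sum_near.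
apply: (@le_trans _ _ (\sum_(g : 'I_Q * 'I_Q) (c g * Q%:R ^- 2)%:E)%E).
  by apply: lee_sum => g _; rewrite [leRHS]EFinM; apply: lee_wpmul2l; [rewrite lee_fin | exact: torus_cell].
rewrite sumEFin lee_fin -mulr_suml /c -mulr_sumr big_split /= sumr_const card_prod card_ord.
rewrite -[X in _ + X]mulr_natl natrM le_eqVlt; apply/orP; left; apply/eqP.
by field; rewrite gt_eqF.
Qed.

End SamplingCubic.

(** * The best constant *)

Section GridToTorus.
Variable R : realType.

(** The error term of the sampling inequality is absorbed thanks to
    [1 <= N `^ s]. *)
Lemma best_constant_of_grid (p C s : R) N Q : (0 < N)%N -> (48 * N ^ 4 <= Q)%N ->
  0 < p -> 0 < C -> 0 <= s ->
  (forall b : 'I_(N.*2.+1) -> R[i], \sum_g cmod (osum (Q := Q) b g) `^ p <=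
      C * Q%:R ^+ 2 * N%:R `^ s * energy b `^ (p / 2)) ->
  (best_constant p N <= (2 * (C + 1) `^ p^-1 * N%:R `^ (s / p))%:E)%E.
Proof.
move=> N0 QN p0 C0 s0 H; apply: ereal_inf_lbound => /=.
set K := 2 * _ * _; exists K => // a; set b := fun i : 'I_(N.*2.+1) => a (freq i).
have QR : 0 < Q%:R :> R.
  by rewrite ltr0n; apply: leq_trans QN; rewrite muln_gt0 expn_gt0 N0.
have E0 : 0 <= energy b := energy_ge0 b.
have s1 : 1 <= N%:R `^ s :> R.
  by rewrite -[leLHS](powRr0 N%:R); apply: ler_powR => //; rewrite ler1n.
have pn0 : p != 0 by rewrite gt_eqF.
set W := energy b `^ (p / 2).
have W0 : 0 <= W by exact: powR_ge0.
pose B := 2 `^ p * ((C + 1) * N%:R `^ s * W).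
have B0 : 0 <= B by rewrite /B !mulr_ge0 ?powR_ge0// addr_ge0// ltW.
have IB : (\int[torus_measure R]_z (cmod (cubic_sum N a z) `^ p)%:E <= B%:E)%E.
  apply: (le_trans (integral_cubic_le_grid a N0 QN p0)); rewrite lee_fin -/b -/W.
  apply: ler_wpM2l; first exact: powR_ge0.
  have -> : (C + 1) * N%:R `^ s * W = C * N%:R `^ s * W + N%:R `^ s * W by ring.
  apply: lerD; last by rewrite ler_peMl.
  rewrite mulrC ler_pdivrMr ?exprn_gt0//.
  by apply: (le_trans (H b)); rewrite le_eqVlt; apply/orP; left; apply/eqP; rewrite /W; ring.
have -> : (K * l2norm N a)%:E = (B%:E `^ p^-1)%E.
  rewrite poweR_EFin; congr (_%:E); rewrite /B /K l2norm_energy -/b.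
  rewrite powRM ?powR_ge0//; last by rewrite !mulr_ge0 ?powR_ge0// addr_ge0// ltW.
  rewrite powRM; last 2 first.
  - by rewrite mulr_ge0 ?powR_ge0// addr_ge0// ltW.
  - exact: powR_ge0.
  rewrite powRM ?powR_ge0//; last by rewrite addr_ge0// ltW.
  rewrite -!powRrM divff// powRr1// -powR12_sqrt// (_ : p / 2 / p = 2^-1) ?mulrA//.
  by field.
rewrite /cubic_Lp_norm unlock; apply: gt0_ler_poweR.
- by rewrite invr_ge0 ltW.
- rewrite in_itv /= leey andbT; apply: integral_ge0 => z _; rewrite lee_fin; exact: powR_ge0.
- by rewrite in_itv /= leey andbT lee_fin.
apply: le_trans IB; rewrite le_eqVlt; apply/orP; left; apply/eqP.
apply: eq_integral => z _.
by rewrite abse_EFin ger0_norm ?cmod_ge0// poweR_EFin.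
Qed.

(** The factorial makes every rational of denominator at most [N] a grid point, as
    the twelfth moment of the kernel requires. *)
Lemma sampling_size N : (0 < N)%N ->
  let K := (48 * N * N`!)%N in let Q := (N ^ 3 * K)%N in
  [/\ (12 < K)%N, (48 * N ^ 4 <= Q)%N, (12 * N ^ 3 < Q)%N &
      forall q, (0 < q <= N)%N -> (q %| Q)%N].
Proof.
move=> N0 K Q; have F0 := fact_gt0 N.
have K12 : (12 < K)%N.
  by rewrite /K -mulnA; apply: (@leq_trans (48 * 1)) => //; rewrite leq_mul2l muln_gt0 N0.
split=> //.
- by rewrite /Q /K (_ : N ^ 3 * _ = 48 * N ^ 4 * N`!)%N ?leq_pmulr//; ring.
- by rewrite mulnC ltn_pmul2l// expn_gt0 N0.
by move=> q qN; rewrite !dvdn_mull// dvdn_fact.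
Qed.

End GridToTorus.

Unset Implicit Arguments.

Theorem corollary1p4 (R : realType) (p : R) (hp : 12 <= p) :
  (forall eps : R, 0 < eps ->
     exists C : R, 0 < C /\
       forall N : nat, (0 < N)%N ->
         (best_constant p N <=
            (C * N%:R `^ (2^-1 * (1 - 8 / p) + eps))%:E)%E) /\
  (24 < p ->
     exists C : R, 0 < C /\
       forall N : nat, (0 < N)%N ->
         (best_constant p N <= (C * N%:R `^ (2^-1 * (1 - 8 / p)))%:E)%E).
Proof.
have p0 : 0 < p by lra.
have pn0 : p != 0 by rewrite gt_eqF.
split=> [eps eps0|p24].
- have [C C0 H] := grid_bound_eps hp (mulr_gt0 eps0 p0).
  exists (2 * (C + 1) `^ p^-1); split=> [|N N0].
    by rewrite mulr_gt0// powR_gt0// addr_gt0.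
  have [_ QN QN3 _] := sampling_size N0.
  have -> : 2^-1 * (1 - 8 / p) + eps = (p / 2 - 4 + eps * p) / p by field.
  apply: best_constant_of_grid QN p0 C0 _ _ => //.
    by rewrite addr_ge0 ?mulr_ge0 ?ltW//; lra.
  by move=> b; exact: H.
- have [C C0 H] := grid_bound_sharp (ltW p24).
  exists (2 * (C + 1) `^ p^-1); split=> [|N N0].
    by rewrite mulr_gt0// powR_gt0// addr_gt0.
  have [K12 QN _ Qdvd] := sampling_size N0.
  have -> : 2^-1 * (1 - 8 / p) = (p / 2 - 4) / p by field.
  apply: best_constant_of_grid QN p0 C0 _ _ => //; first by lra.
  by move=> b; exact: (H _ _ _ b N0 K12 erefl Qdvd).
Qed.
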